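(* (i) Uniqueness: Any bounded Jacobi matrix $J$ with $a_j>0$ and $b_j\in\mathbb{C}$ for all $j\ge0$ is uniquely determined by its spectral data $\Lambda(J)$; that is, if $J$ and $J'$ are two such matrices with $\Lambda(J)=\Lambda(J')$, then $J=J'$. (ii) Surjectivity: Let $\nu$ be a probability measure with bounded infinite support in $[0,\infty)$. Let $\psi\in L^\infty(\nu)$ be a function such that $|\psi(s)|\le1$ for $\nu$-a.e. $s\ge0$ and $\psi(0)=1$. Then $(\nu,\psi)=\Lambda(J)$ for some bounded Jacobi matrix $J$ with $a_j>0$ and $b_j\in\mathbb{C}$ for all $j\ge0$.
   Context: Let $\delta_j$, $j\ge0$, be the standard basis of $\ell^2(\mathbb{N}_0)$, $\mathbb{N}_0=\{0,1,2,\dots\}$, and let $\langle\cdot,\cdot\rangle$ be the inner product of $\ell^2(\mathbb{N}_0)$, linear in the first argument. A Jacobi matrix with parameters $(a_j)_{j\ge0}$, $(b_j)_{j\ge0}$ is the infinite tridiagonal symmetric matrix $J$ with $J_{j,j}=b_j$, $J_{j,j+1}=J_{j+1,j}=a_j$ and all other entries zero. It is bounded if $\sup_{j\ge0}(|a_j|+|b_j|)<\infty$; it is then regarded as a bounded linear operator on $\ell^2(\mathbb{N}_0)$. We write $|J|=\sqrt{J^*J}$. For a bounded Jacobi matrix $J$ with $a_j>0$, $b_j\in\mathbb{C}$, the spectral data is the pair $\Lambda(J)=(\nu,\psi)$, where $\nu(\Delta)=\langle\chi_\Delta(|J|)\delta_0,\delta_0\rangle$ is the spectral measure of $|J|$ corresponding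 to $\delta_0$ (a Borel probability measure with bounded support in $[0,\infty)$), and the phase function $\psi$ is the unique element of $L^\infty(\nu)$ with $\psi(0)=1$, $|\psi(s)|\le1$ for $\nu$-a.e. $s\ge0$, and $$\langle Jf(|J|)\delta_0,\delta_0\rangle=\int_0^\infty s f(s)\psi(s)\,\mathrm{d}\nu(s)\quad\text{for all } f\in C(\mathbb{R})$$ (such $\psi$ exists and is unique). Functions $\psi$ are identified if they are equal $\nu$-a.e. *)

(* Defs.v *)
From HB Require Import structures.
From mathcomp Require Import all_boot all_order all_algebra.
From mathcomp Require Import complex.
From mathcomp Require Import all_classical all_reals all_analysis.

Set Implicit Arguments.
Unset Strict Implicit.
Unset Printing Implicit Defensive.

Import Order.TTheory GRing.Theory Num.Theory.
Import numFieldNormedType.Exports.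

Local Open Scope classical_set_scope.
Local Open Scope complex_scope.
Local Open Scope ring_scope.

(* Vectors of l^2(N_0) are the sequences x : nat -> R[i] satisfying [l2 x];
   operators are maps on sequences, and only their values on l^2 matter.
   The topology of R[i] is carried by its alias (R[i])^o. *)

Section Hilbert.
Variable R : realType.
Implicit Types (x y : nat -> R[i]) (T S A B : (nat -> R[i]) -> nat -> R[i]).

Definition l2 x : Prop :=
  cvgn (series (fun j => complex.Re (`|x j| ^+ 2))).

Definition inner x y : R[i] :=
  limn (fun n => \sum_(j < n) x j * (y j)^*%C : (R[i])^o).

Definition l2norm x : R := Num.sqrt (complex.Re (inner x x)).

Definition delta (j : nat) : nat -> R[i] := fun k => (k == j)%:R.

Record bounded_op T : Prop := BoundedOp {
  bop_l2 : forall x, l2 x -> l2 (T x);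
  bop_linear : forall (c : R[i]) x y, l2 x -> l2 y ->
    T (fun n => c * x n + y n) = (fun n => c * T x n + T y n);
  bop_bounded : exists M : R, forall x, l2 x -> l2norm (T x) <= M * l2norm x
}.

Definition is_adjoint T S : Prop :=
  bounded_op S /\ forall x y, l2 x -> l2 y -> inner (T x) y = inner x (S y).

(* The order of R[i] makes [0 <= z] say that z is real and nonnegative. *)
Definition positive_op A : Prop :=
  bounded_op A /\ forall x, l2 x -> 0 <= inner (A x) x.

(* A = |T|, the positive square root of T^* T *)
Definition is_abs T A : Prop :=
  positive_op A /\
  exists S, is_adjoint T S /\ forall x, l2 x -> A (A x) = S (T x).

End Hilbert.

Section FunctionalCalculus.
Variable R : realType.
Local Notation borelR := (measurableTypeR R).
Local Notation op := ((nat -> R[i]) -> nat -> R[i]).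
Implicit Types (E : set borelR -> op) (f : R -> R[i]) (A B : op).

Definition cintegral (mu : {measure set borelR -> \bar R}) (D : set borelR) f
    : R[i] :=
  (\int[mu]_(s in D) complex.Re (f s)) +i* (\int[mu]_(s in D) complex.Im (f s)).

(* Projection-valued measures (resolutions of the identity) on the Borel sets
   of the line *)
Record is_pvm E : Prop := IsPvm {
  pvm_bounded : forall D, measurable D -> bounded_op (E D);
  pvm_selfadjoint : forall D, measurable D -> is_adjoint (E D) (E D);
  pvm_set0 : forall x, l2 x -> E set0 x = (fun=> 0);
  pvm_setT : forall x, l2 x -> E setT x = x;
  (* with D = D', E D is idempotent *)
  pvm_setI : forall D D', measurable D -> measurable D' ->
    forall x, l2 x -> E (D `&` D') x = E D (E D' x);
  pvm_sigma_additive : forall F : (set borelR)^nat,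
    (forall n, measurable (F n)) -> trivIset setT F ->
    forall x y, l2 x -> l2 y ->
    (fun n => \sum_(k < n) inner (E (F k) x) y : (R[i])^o) @ \oo
      --> (inner (E (\bigcup_k F k) x) y : (R[i])^o)
}.

(* B is the operator \int f dE: the quadratic form <B x, x> is the integral of
   f with respect to the measure <E(.) x, x>. *)
Definition is_op_integral E f B : Prop :=
  bounded_op B /\
  forall x, l2 x ->
    exists mu : {finite_measure set borelR -> \bar R},
      [/\ forall D, measurable D -> inner (E D x) x = (fine (mu D))%:C,
          mu.-integrable setT (EFin \o (fun s => complex.Re (f s))),
          mu.-integrable setT (EFin \o (fun s => complex.Im (f s))) &
          inner (B x) x = cintegral mu setT f].

(* B = f(A) for a bounded self-adjoint A, through the spectral resolution of A,
   which is unique by the spectral theorem *)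
Definition is_fun_of_op A f B : Prop :=
  exists E, [/\ is_pvm E, is_op_integral E (fun s => s%:C) A
              & is_op_integral E f B].

Definition Linfty (nu : {measure set borelR -> \bar R}) f : Prop :=
  ((fun s => complex.Re (f s)) : borelR -> R) \in Lfun nu +oo%E /\
  ((fun s => complex.Im (f s)) : borelR -> R) \in Lfun nu +oo%E.

Definition msupport (nu : {measure set borelR -> \bar R}) : set R :=
  [set s | forall U : set R, open U -> U s -> (0 < nu U)%E].

End FunctionalCalculus.

Section Jacobi.
Variable R : realType.
Implicit Types (a : nat -> R) (b : nat -> R[i]).

Definition jacobi a b (j k : nat) : R[i] :=
  if k == j then b j
  else if k == j.+1 then (a j)%:C
  else if j == k.+1 then (a k)%:C
  else 0.

(* Row j of the matrix vanishes beyond column j.+1. *)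
Definition jacobi_op a b (x : nat -> R[i]) : nat -> R[i] :=
  fun j => \sum_(k < j.+2) jacobi a b j k * x k.

Definition bounded_jacobi a b : Prop :=
  exists M : R, forall j, `|(a j)%:C| + `|b j| <= M%:C.

(* (nu, psi) = Lambda(J), where J is the Jacobi matrix with parameters a and b
   and A = |J|. A measure on [0, oo) is a Borel measure on the line for which
   the negative half-line is null, and psi is a representative of its class
   in L^oo(nu) with psi 0 = 1. *)
Definition spectral_data a b (nu : probability (measurableTypeR R) R)
    (psi : R -> R[i]) : Prop :=
  exists A : (nat -> R[i]) -> nat -> R[i],
  [/\ is_abs (jacobi_op a b) A,
      forall D : set (measurableTypeR R), measurable D ->
        exists B, is_fun_of_op A (fun s => (\1_D s)%:C) B /\
          (fine (nu D))%:C = inner (B (delta R 0)) (delta R 0) &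
      [/\ Linfty nu psi,
          psi 0 = 1,
          {ae nu, forall s : R, 0 <= s -> `|psi s| <= 1} &
          forall f : R -> (R[i])^o, continuous f ->
          exists B, is_fun_of_op A f B /\
            inner (jacobi_op a b (B (delta R 0))) (delta R 0) =
            cintegral nu `[0, +oo[%classic (fun s => s%:C * f s * psi s)]].

End Jacobi.

(* Main.v *)
Require Import Defs.
From HB Require Import structures.
From mathcomp Require Import all_boot all_order all_algebra.
From mathcomp Require Import complex.
From mathcomp Require Import all_classical all_reals all_analysis.
From mathcomp Require Import measurable_realfun.
From mathcomp Require Import ring lra.

Set Implicit Arguments.
Unset Strict Implicit.
Unset Printing Implicit Defensive.

Import Order.TTheory GRing.Theory Num.Theory.
Import numFieldNormedType.Exports.

Local Open Scope classical_set_scope.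
Local Open Scope complex_scope.
Local Open Scope ring_scope.

(** The idea is to replace the complex symmetric matrix J by the antilinear
operator T = C J, where C is complex conjugation of sequences. Since J is a
symmetric matrix, T is symmetric in the sense that <T x, y> = <T y, x>, and
T^2 = J^* J = |J|^2. So T is to J what a self-adjoint operator is to a real
Jacobi matrix, and both parts follow the classical proof of Favard's theorem
with the powers of T applied to delta_0.

Uniqueness. The vectors T^k delta_0 form a triangular matrix with positive
diagonal, from which J can be read off. Their Gram matrix consists of the moments
<T^m delta_0, delta_0>, up to conjugation ([gram_step]), and determines this
triangular matrix, its Cholesky factor ([Tpow_eq]). For even m = 2n the moment
is the integral of s^(2n) with respect to nu, and for m = 2n + 1 it is the
conjugate of the integral of s^(2n+1) psi(s) ([Tpow_moments]), so the moments are
determined by the spectral data. Since each function of |J| may come with a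
resolution of its own, it must be shown that every resolution gives s^n the value
|J|^n ([quad_integral_pow]) and gives delta_0 the spectral measure nu
([nu_smeas]). The latter uses that half-lines in [0, M] are bounded limits of
polynomials in s^2 ([thr_poly_halfline]).

Surjectivity. On polynomials let T be multiplication by the variable after
conjugation of the coefficients. The even and the odd part of a polynomial at s
are paired through the weight matrix with rows (1, psi(s)), (psi(s)^*, 1), which
is nonnegative because |psi| <= 1, and the result is integrated with respect to
nu. T is symmetric for this form. The form is positive definite
([ip_gt0]): a polynomial p of norm zero satisfies |ev p|^2 = |od p|^2 on the
support of nu, and the difference of the two sides is the polynomial
Re (p(s) p(-s)^* ), which has finitely many zeros unless p = 0. The Lanczos
recursion for T yields orthonormal polynomials e_n and coefficients a_n > 0, b_n.
Multiplication by a bounded function phi(s) has a bounded matrix in the basis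
e_n. Products of functions correspond to products of matrices ([Parseval]),
because the polynomials in s^2 are dense in L^2(nu) ([even_approx_bddon]). Hence
these matrices form the functional calculus of |J| ([symbol_op_integral],
[model_abs]), and the first vector e_0 = 1 has the spectral data (nu, psi)
([model_spectral_data]). *)

(** * Complex numbers *)

Section ComplexPlane.
Variable R : realType.
Implicit Types (z w : R[i]) (c d : R).
Local Notation Re := (@complex.Re R).
Local Notation Im := (@complex.Im R).

(** |z|^2 as an element of R, on which the order and the arithmetic of R are
available. *)
Definition sqn z : R := Re z ^+ 2 + Im z ^+ 2.

Lemma ReD z w : Re (z + w) = Re z + Re w. Proof. by case: z w => ? ? []. Qed.
Lemma ImD z w : Im (z + w) = Im z + Im w. Proof. by case: z w => ? ? []. Qed.
Lemma ReN z : Re (- z) = - Re z. Proof. by case: z. Qed.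
Lemma ImN z : Im (- z) = - Im z. Proof. by case: z. Qed.
Lemma ReM z w : Re (z * w) = Re z * Re w - Im z * Im w.
Proof. by case: z w => ? ? []. Qed.
Lemma ImM z w : Im (z * w) = Re z * Im w + Im z * Re w.
Proof. by case: z w => ? ? []. Qed.
Lemma ReJ z : Re z^*%C = Re z. Proof. by case: z. Qed.
Lemma ImJ z : Im z^*%C = - Im z. Proof. by case: z. Qed.
Lemma ReMr c z : Re (c%:C * z) = c * Re z.
Proof. by rewrite ReM /= mul0r subr0. Qed.
Lemma ImMr c z : Im (c%:C * z) = c * Im z.
Proof. by rewrite ImM /= mul0r addr0. Qed.

Definition ReImE := (ReD, ImD, ReN, ImN, ReMr, ImMr, ReM, ImM, ReJ, ImJ).

Lemma eqC z w : Re z = Re w -> Im z = Im w -> z = w.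
Proof. by case: z w => ? ? [? ?] /= -> ->. Qed.

Lemma Re_sum I (r : seq I) (P : pred I) (F : I -> R[i]) :
  Re (\sum_(i <- r | P i) F i) = \sum_(i <- r | P i) Re (F i).
Proof. by apply: (big_morph Re) => //; exact: ReD. Qed.

Lemma Im_sum I (r : seq I) (P : pred I) (F : I -> R[i]) :
  Im (\sum_(i <- r | P i) F i) = \sum_(i <- r | P i) Im (F i).
Proof. by apply: (big_morph Im) => //; exact: ImD. Qed.

Lemma conjc_sum I (r : seq I) (P : pred I) (F : I -> R[i]) :
  (\sum_(i <- r | P i) F i)^*%C = \sum_(i <- r | P i) (F i)^*%C.
Proof. exact: (rmorph_sum (@conjc R)). Qed.

Lemma conjcM z w : (z * w)^*%C = z^*%C * w^*%C.
Proof. exact: (rmorphM (@conjc R)). Qed.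

Lemma conjcD z w : (z + w)^*%C = z^*%C + w^*%C.
Proof. exact: (rmorphD (@conjc R)). Qed.

Lemma realC_sum I (r : seq I) (P : pred I) (F : I -> R) :
  (\sum_(i <- r | P i) F i)%:C = \sum_(i <- r | P i) (F i)%:C.
Proof. exact: (rmorph_sum (real_complex R)). Qed.

Lemma realCM c d : (c * d)%:C = c%:C * d%:C.
Proof. exact: (rmorphM (real_complex R)). Qed.

Lemma realCD c d : (c + d)%:C = c%:C + d%:C.
Proof. exact: (rmorphD (real_complex R)). Qed.

Lemma sqn_ge0 z : 0 <= sqn z. Proof. by rewrite addr_ge0 ?sqr_ge0. Qed.

Lemma sqn0 : sqn 0 = 0. Proof. by rewrite /sqn /= expr0n addr0. Qed.

Lemma sqnM z w : sqn (z * w) = sqn z * sqn w.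
Proof. by case: z w => a b [c d]; rewrite /sqn /=; ring. Qed.

Lemma sqnN z : sqn (- z) = sqn z.
Proof. by rewrite /sqn ReN ImN !sqrrN. Qed.

Lemma sqnJ z : sqn z^*%C = sqn z.
Proof. by rewrite /sqn ReJ ImJ sqrrN. Qed.

Lemma sqnR c : sqn c%:C = c ^+ 2.
Proof. by rewrite /sqn /= expr0n addr0. Qed.

Lemma sqnE z : z * z^*%C = (sqn z)%:C.
Proof. by case: z => a b; apply: eqC; rewrite /sqn /=; ring. Qed.

Lemma sqn_norm z : Re (`|z| ^+ 2) = sqn z.
Proof. by rewrite -add_Re2_Im2. Qed.

Lemma sqn_eq0 z : sqn z = 0 -> z = 0.
Proof.
case: z => a b; rewrite /sqn /= => /eqP.
by rewrite paddr_eq0 ?sqr_ge0// !sqrf_eq0 => /andP[/eqP -> /eqP ->].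
Qed.

Lemma sqnD z w : sqn (z + w) <= 2 * sqn z + 2 * sqn w.
Proof.
case: z w => a b [c d]; rewrite /sqn /=.
have := sqr_ge0 (a - c); have := sqr_ge0 (b - d); rewrite !expr2; nra.
Qed.

Lemma Re_le_sqn z w : `|Re (z * w)| <= (sqn z + sqn w) / 2.
Proof.
case: z w => a b [c d]; rewrite /sqn /= ler_norml !expr2.
have := sqr_ge0 (a - c); have := sqr_ge0 (b - d).
have := sqr_ge0 (a + c); have := sqr_ge0 (b + d); rewrite !expr2 => *.
by apply/andP; split; nra.
Qed.

Lemma Im_le_sqn z w : `|Im (z * w)| <= (sqn z + sqn w) / 2.
Proof.
have -> : Im (z * w) = Re (z * (w * - 'i%C)).
  by case: z w => a b [c d] /=; ring.
have -> : sqn w = sqn (w * - 'i%C).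
  by rewrite sqnM sqnN /sqn /=; ring.
exact: Re_le_sqn.
Qed.

Lemma geC0 z : (0 <= z) = (0 <= Re z) && (Im z == 0).
Proof. by rewrite lecE /= andbC. Qed.

(** All limits in R[i] are reduced to real limits by this equivalence. *)
Lemma cvgC (u : nat -> R[i]) (l : R[i]) :
  ((u : nat -> (R[i])^o) @ \oo --> (l : (R[i])^o)) <->
  (Re \o u @ \oo --> Re l) /\ (Im \o u @ \oo --> Im l).
Proof.
have nE z : `|z| = (Num.sqrt (sqn z))%:C by exact: normc_def.
split=> [ul|[ur ui]].
- suff H (f : R[i] -> R) : (forall z, f z ^+ 2 <= sqn z) ->
      {morph f : x y / x - y} -> f \o u @ \oo --> f l.
    split; apply: H => [z|z w]; rewrite ?ReImE ?lerDl ?lerDr ?sqr_ge0//.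
  move=> fle fB; apply/cvgrPdist_lt => e e0.
  move/cvgrPdist_lt : ul => /(_ e%:C); rewrite ltcR => /(_ e0).
  apply: filterS => n; rewrite nE ltcR; apply: le_lt_trans.
  by rewrite /= -fB -sqrtr_sqr ler_wsqrtr.
- apply/cvgrPdist_lt => e; rewrite ltcE /= => /andP[/eqP ie re].
  have e20 : 0 < Re e / 2 by rewrite divr_gt0.
  move/cvgrPdist_lt : ur => /(_ _ e20) ur.
  move/cvgrPdist_lt : ui => /(_ _ e20) ui.
  near=> n; rewrite nE ltcE /= ie eqxx /=.
  have /= : `|Re l - Re (u n)| < Re e / 2 by near: n.
  have /= : `|Im l - Im (u n)| < Re e / 2 by near: n.
  rewrite -(@ger0_norm _ (Re e)) ?(ltW re)// -(sqrtr_sqr (Re e)) => h1 h2.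
  rewrite ltr_sqrt ?exprn_gt0//.
  rewrite sqrtr_sqr (gtr0_norm re) !ltr_norml in h1 h2.
  rewrite /sqn !ReImE !expr2; move/andP: h1 => [? ?]; move/andP: h2 => [? ?].
  by nra.
Unshelve. all: by end_near.
Qed.

Lemma cvgC_lim (u : nat -> R[i]) (l : R[i]) :
  (u : nat -> (R[i])^o) @ \oo --> (l : (R[i])^o) ->
  limn (u : nat -> (R[i])^o) = l.
Proof. by move=> ul; apply/cvg_lim => //; exact: norm_hausdorff. Qed.

Lemma cvgC_uniq (u : nat -> R[i]) (k l : R[i]) :
  (u : nat -> (R[i])^o) @ \oo --> (k : (R[i])^o) ->
  (u : nat -> (R[i])^o) @ \oo --> (l : (R[i])^o) -> k = l.
Proof. by move=> /cvgC_lim <- /cvgC_lim <-. Qed.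

Lemma cvgC_sqn (u : nat -> R[i]) (l : R[i]) :
  (fun n => sqn (u n - l)) @ \oo --> (0 : R) ->
  (u : nat -> (R[i])^o) @ \oo --> (l : (R[i])^o).
Proof.
move=> h.
suff H (f : R[i] -> R) : (forall z, f z ^+ 2 <= sqn z) ->
    {morph f : x y / x - y} -> f \o u @ \oo --> f l.
  apply/cvgC; split; apply: H => [z|z w];
  rewrite ?ReImE ?lerDl ?lerDr ?sqr_ge0//.
move=> fle fB; apply/cvgrPdist_lt => e e0.
have e20 : 0 < e ^+ 2 by rewrite exprn_gt0.
move/cvgrPdist_lt : h => /(_ _ e20).
apply: filterS => n; rewrite sub0r normrN ger0_norm ?sqn_ge0// => hn.
have : f (u n - l) ^+ 2 < e ^+ 2 by exact: le_lt_trans hn.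
by rewrite fB /= distrC -(real_normK (num_real _)) ltr_pXn2r ?nnegrE// ltW.
Qed.

Lemma sqn_cvg (u : nat -> R[i]) (l : R[i]) :
  (u : nat -> (R[i])^o) @ \oo --> (l : (R[i])^o) ->
  (fun n => sqn (u n)) @ \oo --> sqn l.
Proof.
by move=> /cvgC[ur ui]; rewrite /sqn; apply: cvgD; apply: cvgM.
Qed.

Lemma cvgC_conj (u : nat -> R[i]) (l : R[i]) :
  (u : nat -> (R[i])^o) @ \oo --> (l : (R[i])^o) ->
  ((fun n => (u n)^*%C) : nat -> (R[i])^o) @ \oo --> (l^*%C : (R[i])^o).
Proof.
move=> /cvgC[ur ui]; apply/cvgC; split.
  by rewrite ReJ; apply: cvg_trans ur; apply: near_eq_cvg; near=> n => /=;
     rewrite ReJ.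
rewrite ImJ; apply: cvg_trans (cvgN ui).
by apply: near_eq_cvg; near=> n => /=; rewrite ImJ.
Unshelve. all: by end_near.
Qed.

End ComplexPlane.

(** * Square-summable sequences *)

Section SquareSummable.
Variable R : realType.
Implicit Types (x y z : nat -> R[i]) (c : R[i]).

Definition l2sq x : R := limn (series (fun j => sqn (x j))).

Lemma l2E x : l2 x = cvgn (series (fun j => sqn (x j))).
Proof.
by rewrite /l2; congr (cvgn (series _)); apply/funext => j; rewrite sqn_norm.
Qed.

Lemma seriesE (u : nat -> R) n : series u n = \sum_(j < n) u j.
Proof. by rewrite seriesEord. Qed.

Lemma sqn_series_homo x :
  {homo series (fun j => sqn (x j)) : n m / (n <= m)%N >-> n <= m}.
Proof.
move=> n m nm; rewrite -subr_ge0 sub_series_geq//.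
by apply: sumr_ge0 => i _; exact: sqn_ge0.
Qed.

Lemma l2_bound x (K : R) :
  (forall n, \sum_(j < n) sqn (x j) <= K) -> l2 x.
Proof.
move=> h; rewrite l2E; apply: nondecreasing_is_cvgn.
  exact: sqn_series_homo.
by exists K => _ [n _ <-]; rewrite seriesE.
Qed.

Lemma l2sq_cvg x : l2 x -> (fun n => \sum_(j < n) sqn (x j)) @ \oo --> l2sq x.
Proof.
by rewrite l2E => h; under eq_fun do rewrite -(seriesE (fun j => sqn (x j))).
Qed.

Lemma sum_le_l2sq x n : l2 x -> \sum_(j < n) sqn (x j) <= l2sq x.
Proof.
rewrite l2E => h; rewrite -(seriesE (fun j => sqn (x j))).
by apply: nondecreasing_cvgn_le => //; exact: sqn_series_homo.
Qed.

Lemma l2sq_le x (K : R) : (forall n, \sum_(j < n) sqn (x j) <= K) -> l2sq x <= K.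
Proof.
move=> h; have := l2_bound h; rewrite l2E => hx.
by apply: limr_le => //; apply: nearW => n; rewrite seriesE.
Qed.

Lemma l2sq_ge0 x : l2 x -> 0 <= l2sq x.
Proof. by move=> /(sum_le_l2sq 0); rewrite big_ord0. Qed.

Lemma sqn_le_l2sq x j : l2 x -> sqn (x j) <= l2sq x.
Proof.
move=> /(sum_le_l2sq j.+1); rewrite big_ord_recr /=; apply: le_trans.
by rewrite lerDr sumr_ge0// => i _; exact: sqn_ge0.
Qed.

Lemma l2_le x y (K : R) : l2 y -> (forall j, sqn (x j) <= K * sqn (y j)) ->
  0 <= K -> l2 x /\ l2sq x <= K * l2sq y.
Proof.
move=> hy h K0.
have H n : \sum_(j < n) sqn (x j) <= K * l2sq y.
  apply: (@le_trans _ _ (K * \sum_(j < n) sqn (y j))).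
    by rewrite mulr_sumr ler_sum.
  by rewrite ler_wpM2l// sum_le_l2sq.
by split; [exact: l2_bound H | exact: l2sq_le].
Qed.

Lemma l2Z c x : l2 x -> l2 (fun n => c * x n).
Proof.
move=> hx; apply: (proj1 (@l2_le _ x (sqn c) hx _ (sqn_ge0 c))) => j.
by rewrite sqnM.
Qed.

Arguments l2Z c {x}.

Lemma l2D_l2sq x y : l2 x -> l2 y ->
  l2 (fun n => x n + y n) /\ l2sq (fun n => x n + y n) <= 2 * l2sq x + 2 * l2sq y.
Proof.
move=> hx hy.
have H n : \sum_(j < n) sqn (x j + y j) <= 2 * l2sq x + 2 * l2sq y.
  apply: (@le_trans _ _ (2 * \sum_(j < n) sqn (x j) +
                         2 * \sum_(j < n) sqn (y j))).
    by rewrite !mulr_sumr -big_split /=; apply: ler_sum => i _; exact: sqnD.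
  by rewrite lerD// ler_wpM2l// sum_le_l2sq.
by split; [exact: l2_bound H | exact: l2sq_le].
Qed.

Lemma l2D x y : l2 x -> l2 y -> l2 (fun n => x n + y n).
Proof. by move=> hx hy; exact: (proj1 (l2D_l2sq hx hy)). Qed.

Lemma l2_lin c x y : l2 x -> l2 y -> l2 (fun n => c * x n + y n).
Proof. by move=> hx hy; apply: l2D => //; exact: l2Z. Qed.

Arguments l2_lin c {x y}.

Lemma l2B x y : l2 x -> l2 y -> l2 (fun n => x n - y n).
Proof.
move=> hx hy; have := l2_lin (-1) hy hx.
by congr l2; apply/funext => n; rewrite mulN1r addrC.
Qed.

Lemma l2_conj x : l2 x -> l2 (fun n => (x n)^*%C).
Proof.
move=> hx; apply: (proj1 (@l2_le _ x 1 hx _ _)) => // j.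
by rewrite sqnJ mul1r.
Qed.

Lemma l2_fin x N : (forall j, (N <= j)%N -> x j = 0) -> l2 x.
Proof.
move=> h; apply: (@l2_bound _ (\sum_(j < N) sqn (x j))) => n.
rewrite !(big_ord_widen _ (fun j => sqn (x j)) (leq_maxl _ _ : _ <= maxn n N)%N).
rewrite !(big_ord_widen _ (fun j => sqn (x j)) (leq_maxr _ _ : _ <= maxn n N)%N).
rewrite big_mkcond [leRHS]big_mkcond; apply: ler_sum => i _.
case: ifP => _; case: ltnP => hi; rewrite ?sqn_ge0//.
by rewrite h// sqn0.
Qed.

Lemma l2_0 : l2 (fun=> 0 : R[i]).
Proof. by apply: (@l2_fin _ 0%N). Qed.

Lemma l2_delta j : l2 (delta R j).
Proof.
by apply: (@l2_fin _ j.+1) => i ij; rewrite /delta gtn_eqF.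
Qed.

Arguments l2_delta j : clear implicits.

Lemma sum_delta (F : nat -> R[i]) j n :
  \sum_(k < n) F k * delta R j k = if (j < n)%N then F j else 0.
Proof.
elim: n => [|n IH]; first by rewrite big_ord0.
rewrite big_ord_recr /= IH /delta ltnS [(j <= n)%N]leq_eqVlt (eq_sym j n).
by have [->|nj] := eqVneq n j; rewrite ?ltnn ?mulr1 ?add0r ?mulr0 ?addr0.
Qed.

Lemma dabs_cvg (u : nat -> R) (v : nat -> R) :
  (forall j, `|u j| <= v j) -> cvgn (series v) -> cvgn (series u).
Proof.
move=> uv cv; apply: normed_cvg.
apply: (series_le_cvg _ _ _ cv) => j; last exact: uv.
  exact: normr_ge0.
exact: le_trans (normr_ge0 _) (uv j).
Qed.

(** A summable majorant of both parts of x_j (y_j)^*, by the inequality between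
the arithmetic and the geometric mean. *)
Lemma l2_half_cvg x y : l2 x -> l2 y ->
  cvgn (series (fun j => (sqn (x j) + sqn (y j)) / 2)).
Proof.
rewrite !l2E => hx hy.
have -> : series (fun j => (sqn (x j) + sqn (y j)) / 2) =
  (fun n => (series (fun j => sqn (x j)) n + series (fun j => sqn (y j)) n) / 2).
  by apply/funext => n; rewrite !seriesE -big_split mulr_suml.
by apply: is_cvgM; [exact: is_cvgD | exact: is_cvg_cst].
Qed.

Lemma inner_cvg x y : l2 x -> l2 y ->
  (fun n => \sum_(j < n) x j * (y j)^*%C : (R[i])^o) @ \oo -->
  (inner x y : (R[i])^o).
Proof.
move=> hx hy.
suff [l hl] : exists l : R[i],
    (fun n => \sum_(j < n) x j * (y j)^*%C : (R[i])^o) @ \oo -->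
    (l : (R[i])^o).
  by rewrite /inner (cvgC_lim hl).
have bnd := l2_half_cvg hx hy.
have cr : cvgn (series (fun j => complex.Re (x j * (y j)^*%C))).
  by apply: dabs_cvg bnd => j; rewrite -(sqnJ (y j)); exact: Re_le_sqn.
have ci : cvgn (series (fun j => complex.Im (x j * (y j)^*%C))).
  by apply: dabs_cvg bnd => j; rewrite -(sqnJ (y j)); exact: Im_le_sqn.
exists (limn (series (fun j => complex.Re (x j * (y j)^*%C))) +i*
        limn (series (fun j => complex.Im (x j * (y j)^*%C)))).
apply/cvgC; split => /=.
- apply: cvg_trans cr; apply: near_eq_cvg; apply: nearW => n.
  by rewrite seriesE /= Re_sum.
- apply: cvg_trans ci; apply: near_eq_cvg; apply: nearW => n.
  by rewrite seriesE /= Im_sum.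
Qed.

Lemma inner_eq x y c : l2 x -> l2 y ->
  (fun n => \sum_(j < n) x j * (y j)^*%C : (R[i])^o) @ \oo -->
    (c : (R[i])^o) -> inner x y = c.
Proof. by move=> hx hy; apply: cvgC_uniq; exact: inner_cvg. Qed.

Lemma inner_lin c x y z : l2 x -> l2 y -> l2 z ->
  inner (fun n => c * x n + y n) z = c * inner x z + inner y z.
Proof.
move=> hx hy hz; apply: inner_eq => //; first exact: l2_lin.
have -> : (fun n => \sum_(j < n) (c * x j + y j) * (z j)^*%C : (R[i])^o) =
  (fun n => c * (\sum_(j < n) x j * (z j)^*%C) + \sum_(j < n) y j * (z j)^*%C).
  apply/funext => n; rewrite mulr_sumr -big_split /=.
  by apply: eq_bigr => i _; rewrite mulrDl mulrA.
apply: cvgD (inner_cvg hy hz).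
exact: (@cvgM (R[i])^o _ _ _ _ _ _ _ (cvg_cst _) (inner_cvg hx hz)).
Qed.

Lemma innerC x y : l2 x -> l2 y -> inner y x = (inner x y)^*%C.
Proof.
move=> hx hy; apply: inner_eq => //.
apply: cvg_trans (cvgC_conj (inner_cvg hx hy)).
apply: near_eq_cvg; apply: nearW => n /=; rewrite conjc_sum.
by apply: eq_bigr => i _; rewrite conjcM conjcK mulrC.
Qed.

Lemma inner_linr c x y z : l2 x -> l2 y -> l2 z ->
  inner z (fun n => c * x n + y n) = c^*%C * inner z x + inner z y.
Proof.
move=> hx hy hz; rewrite (innerC (l2_lin c hx hy) hz) inner_lin//.
by rewrite conjcD conjcM -!innerC.
Qed.

Lemma inner_self x : l2 x -> inner x x = (l2sq x)%:C.
Proof.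
move=> hx; apply: inner_eq => //; apply/cvgC; split => /=.
  apply: cvg_trans (l2sq_cvg hx); apply: near_eq_cvg; apply: nearW => n /=.
  by rewrite Re_sum; apply: eq_bigr => i _; rewrite sqnE.
apply: cvg_near_cst; apply: nearW => n /=.
by rewrite Im_sum big1// => i _; rewrite sqnE.
Qed.

Lemma l2norm_sqr x : l2 x -> l2norm x ^+ 2 = l2sq x.
Proof. by move=> hx; rewrite /l2norm inner_self//= sqr_sqrtr// l2sq_ge0. Qed.

Lemma inner_delta x j : l2 x -> inner x (delta R j) = x j.
Proof.
move=> hx; apply: inner_eq => //; first exact: l2_delta.
apply: cvg_near_cst; exists j.+1 => // n /= jn.
rewrite -[RHS](_ : (if (j < n)%N then x j else 0) = _); last by rewrite jn.
rewrite -sum_delta; apply: eq_bigr => i _.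
by rewrite /delta conjc_nat.
Qed.

Lemma inner_deltal x j : l2 x -> inner (delta R j) x = (x j)^*%C.
Proof. by move=> hx; rewrite (innerC hx (l2_delta j)) inner_delta. Qed.

Lemma l2sq_eq0 x : l2 x -> l2sq x = 0 -> x = fun=> 0.
Proof.
move=> hx x0; apply/funext => j; apply: sqn_eq0; apply/eqP.
by rewrite eq_le sqn_ge0 andbT -x0 sqn_le_l2sq.
Qed.

Lemma Re_inner_le x y : l2 x -> l2 y ->
  `|complex.Re (inner x y)| <= (l2sq x + l2sq y) / 2.
Proof.
move=> hx hy; have /cvgC[hr _] := inner_cvg hx hy.
have hn : (fun n => `|complex.Re (\sum_(j < n) x j * (y j)^*%C)|) @ \oo -->
    `|complex.Re (inner x y)| by exact: (cvg_norm hr).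
rewrite -(cvg_lim (@Rhausdorff R) hn); apply: limr_le; first exact: cvgP hn.
apply: nearW => n; rewrite Re_sum; apply: le_trans (ler_norm_sum _ _ _) _.
apply: (@le_trans _ _ ((\sum_(j < n) sqn (x j) + \sum_(j < n) sqn (y j)) / 2)).
  rewrite -big_split mulr_suml; apply: ler_sum => i _.
  by rewrite -(sqnJ (y i)); exact: Re_le_sqn.
by rewrite ler_wpM2r// lerD// sum_le_l2sq.
Qed.

Lemma inner0l y : l2 y -> inner (fun=> 0 : R[i]) y = 0.
Proof.
move=> hy; apply: inner_eq => //; first exact: l2_0.
by apply: cvg_near_cst; apply: nearW => n; rewrite big1// => i _; rewrite mul0r.
Qed.

Lemma innerZl c x y : l2 x -> l2 y ->
  inner (fun n => c * x n) y = c * inner x y.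
Proof.
move=> hx hy.
have -> : (fun n => c * x n) = (fun n => c * x n + (fun=> 0) n).
  by apply/funext => n; rewrite addr0.
by rewrite inner_lin// ?inner0l ?addr0//; exact: l2_0.
Qed.

Lemma innerZr c x y : l2 x -> l2 y ->
  inner y (fun n => c * x n) = c^*%C * inner y x.
Proof.
by move=> hx hy; rewrite (innerC (l2Z c hx) hy) innerZl// conjcM -innerC.
Qed.

Lemma l2sqZ c x : l2 x -> l2sq (fun n => c * x n) = sqn c * l2sq x.
Proof.
move=> hx; apply: (@complexI R); rewrite -inner_self; last exact: l2Z.
rewrite innerZl ?innerZr//; last exact: l2Z.
by rewrite inner_self// mulrA sqnE realCM.
Qed.

Lemma CauchySchwarz x y : l2 x -> l2 y -> sqn (inner x y) <= l2sq x * l2sq y.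
Proof.
move=> hx hy; set w := inner x y.
(* optimise the arithmetic-geometric bound for <w^* x, t y> over real t *)
have H (t : R) : sqn w * t * 2 <= sqn w * l2sq x + t ^+ 2 * l2sq y.
  have hx' := l2Z (w^*%C) hx; have hy' := l2Z (t%:C) hy.
  have := Re_inner_le hx' hy'; rewrite !l2sqZ// sqnJ sqnR.
  have -> : inner (fun n => w^*%C * x n) (fun n => t%:C * y n) =
     (sqn w * t)%:C.
    by rewrite innerZl// innerZr// conjc_real -/w mulrCA [_ * w]mulrC sqnE
               realCM mulrC.
  move=> /(le_trans (ler_norm _)) /=.
  by rewrite ler_pdivlMr// mulrAC.
have [y0|y0] := eqVneq (l2sq y) 0.
  have := l2sq_eq0 hy y0 => yE; rewrite y0 mulr0.
  have -> : w = 0.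
    rewrite /w yE; apply: inner_eq => //; first exact: l2_0.
    apply: cvg_near_cst; apply: nearW => n.
    by rewrite big1// => i _; rewrite conjc0 mulr0.
  by rewrite sqn0.
have y1 : 0 < l2sq y by rewrite lt_neqAle eq_sym y0 l2sq_ge0.
have [w0|w0] := eqVneq (sqn w) 0; first by rewrite w0 mulr_ge0 ?l2sq_ge0.
have w1 : 0 < sqn w by rewrite lt_neqAle eq_sym w0 sqn_ge0.
have := H (sqn w / l2sq y).
have -> : (sqn w / l2sq y) ^+ 2 * l2sq y = sqn w * (sqn w / l2sq y) by field.
rewrite -mulrA -mulrDr ler_pM2l// => h.
by rewrite -ler_pdivrMr//; lra.
Qed.

Definition trunc N x : nat -> R[i] := fun j => if (j < N)%N then x j else 0.

Lemma l2_trunc N x : l2 (trunc N x).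
Proof. by apply: (@l2_fin _ N) => j; rewrite /trunc ltnNge => ->. Qed.

Arguments l2_trunc N x : clear implicits.

Lemma tail_cvg x : l2 x -> (fun N => l2sq (fun j => x j - trunc N x j)) @ \oo --> (0 : R).
Proof.
move=> hx.
have hN N : l2 (fun j => x j - trunc N x j) by apply: l2B => //; exact: l2_trunc.
apply: (@squeeze_cvgr _ _ _ _ (fun=> 0)
  (fun N => l2sq x - \sum_(j < N) sqn (x j))).
- apply: nearW => N; rewrite l2sq_ge0//=; apply: l2sq_le => n.
  rewrite lerBrDr; apply: le_trans (sum_le_l2sq (maxn n N) hx).
  rewrite (big_ord_widen _ (fun j => sqn (x j - trunc N x j))
    (leq_maxl _ _ : _ <= maxn n N)%N).
  rewrite (big_ord_widen _ (fun j => sqn (x j)) (leq_maxr _ _ : _ <= maxn n N)%N).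
  rewrite big_mkcond [X in _ + X]big_mkcond -big_split /=.
  apply: ler_sum => i _; rewrite /trunc.
  case: (ltnP i N) => iN; rewrite ?subrr ?sqn0 ?subr0 ?addr0.
    by case: ifP; rewrite add0r.
  by case: ifP => _//; rewrite sqn_ge0.
- exact: cvg_cst.
- rewrite -[X in _ --> X](subrr (l2sq x)).
  by apply: cvgB; [exact: cvg_cst|exact: l2sq_cvg].
Qed.

(** The explicit constant K allows one bound for a whole sequence of
functionals, which weak convergence requires. *)
Record bfunctional (K : R) (phi : (nat -> R[i]) -> R[i]) : Prop := BFunctional {
  bfunctional_lin : forall c x y, l2 x -> l2 y ->
    phi (fun n => c * x n + y n) = c * phi x + phi y ;
  bfunctional_bnd : forall x, l2 x -> sqn (phi x) <= K * l2sq x }.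

Lemma bfunctional0 K phi : bfunctional K phi -> phi (fun=> 0) = 0.
Proof.
move=> [hl _]; have := hl (-1) _ _ l2_0 l2_0.
have -> : (fun n : nat => -1 * 0 + 0 : R[i]) = (fun=> 0).
  by apply/funext => n; rewrite mulr0 addr0.
by rewrite mulN1r addNr.
Qed.

Lemma truncS N x :
  trunc N.+1 x = fun j => x N * delta R N j + trunc N x j.
Proof.
apply/funext => j; rewrite /trunc /delta ltnS leq_eqVlt.
by case: (ltngtP j N) => [jn|nj|->] /=; rewrite ?mulr0 ?addr0 ?mulr1 ?add0r.
Qed.

Lemma bfunctional_trunc K phi N x : bfunctional K phi ->
  phi (trunc N x) = \sum_(k < N) x k * phi (delta R k).
Proof.
move=> h; elim: N => [|N IH].
  rewrite big_ord0 -(bfunctional0 h); congr phi; exact/funext.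
rewrite truncS (bfunctional_lin h); [|exact: l2_delta|exact: l2_trunc].
by rewrite IH big_ord_recr addrC.
Qed.

Lemma bfunctional_trunc_cvg K phi x : bfunctional K phi -> l2 x ->
  (fun N => phi (trunc N x) : (R[i])^o) @ \oo --> (phi x : (R[i])^o).
Proof.
move=> h hx; apply: cvgC_sqn.
apply: (@squeeze_cvgr _ _ _ _ (fun=> 0)
  (fun N => K * l2sq (fun j => x j - trunc N x j))).
- apply: nearW => N; rewrite sqn_ge0/=.
  have E : trunc N x = fun n => (-1) * (fun j => x j - trunc N x j) n + x n.
    by apply/funext => n; rewrite mulN1r opprB subrK.
  have hd : l2 (fun j => x j - trunc N x j) by apply: l2B => //; exact: l2_trunc.
  rewrite [in X in phi X]E (bfunctional_lin h)// addrK mulN1r sqnN.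
  exact: (bfunctional_bnd h).
- exact: cvg_cst.
- by rewrite -[X in _ --> X](mulr0 K); apply: cvgM; [exact: cvg_cst|exact: tail_cvg].
Qed.

(** Both functionals are limits of their values on truncations, which are finite
sums over the basis. *)
Lemma bfunctional_ext K K' phi phi' x : bfunctional K phi -> bfunctional K' phi' ->
  (forall k, phi (delta R k) = phi' (delta R k)) -> l2 x -> phi x = phi' x.
Proof.
move=> h h' hd hx; apply: cvgC_uniq (bfunctional_trunc_cvg h hx) _.
apply: cvg_trans (bfunctional_trunc_cvg h' hx); apply: near_eq_cvg; apply: nearW => N.
by rewrite (bfunctional_trunc _ _ h) (bfunctional_trunc _ _ h'); apply: eq_bigr => k _;
   rewrite hd.
Qed.

Lemma cvgC_sum (F : nat -> nat -> R[i]) (G : nat -> R[i]) (c : nat -> R[i]) N :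
  (forall k, (fun n => F n k : (R[i])^o) @ \oo --> (G k : (R[i])^o)) ->
  (fun n => \sum_(k < N) c k * F n k : (R[i])^o) @ \oo -->
  (\sum_(k < N) c k * G k : (R[i])^o).
Proof.
move=> h; elim: N => [|N IH].
  by rewrite big_ord0; under eq_fun do rewrite big_ord0; exact: cvg_cst.
rewrite big_ord_recr; under eq_fun do rewrite big_ord_recr.
apply: cvgD IH _.
exact: (@cvgM (R[i])^o _ _ _ _ _ _ _ (cvg_cst _) (h N)).
Qed.

(** The tail of x is small uniformly in n because the functionals share the
bound K; on the truncation of x only finitely many basis values occur. *)
Lemma bfunctional_cvg K (phi_ : nat -> (nat -> R[i]) -> R[i]) phi x :
  (forall n, bfunctional K (phi_ n)) -> bfunctional K phi ->
  (forall k, (fun n => phi_ n (delta R k) : (R[i])^o) @ \oo -->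
     (phi (delta R k) : (R[i])^o)) ->
  l2 x ->
  (fun n => phi_ n x : (R[i])^o) @ \oo --> (phi x : (R[i])^o).
Proof.
move=> hn h hd hx; apply: cvgC_sqn.
have K0 : 0 <= `|K| by [].
apply/cvgrPdist_lt => e e0.
(* |phi_n x - phi x|^2 <= 2|phi_n x_N - phi x_N|^2 + 8 K |x - x_N|^2 *)
have key N n : sqn (phi_ n x - phi x) <=
    2 * sqn (phi_ n (trunc N x) - phi (trunc N x)) +
    8 * (`|K| * l2sq (fun j => x j - trunc N x j)).
  set r := (fun j => x j - trunc N x j).
  have hr : l2 r by apply: l2B => //; exact: l2_trunc.
  have E : x = fun n => 1 * r n + trunc N x n.
    by apply/funext => m; rewrite mul1r subrK.
  have D psi : bfunctional K psi -> psi x = psi r + psi (trunc N x).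
    move=> hp; rewrite [in LHS]E (bfunctional_lin hp) ?mul1r//.
    exact: l2_trunc.
  have B psi : bfunctional K psi -> sqn (psi r) <= `|K| * l2sq r.
    move=> hp; apply: le_trans (bfunctional_bnd hp hr) _.
    by rewrite ler_wpM2r ?l2sq_ge0// ler_norm.
  rewrite (D _ (hn n)) (D _ h).
  have -> : phi_ n r + phi_ n (trunc N x) - (phi r + phi (trunc N x)) =
    (phi_ n (trunc N x) - phi (trunc N x)) + (phi_ n r - phi r) by ring.
  apply: le_trans (sqnD _ _) _; rewrite lerD2l.
  have := sqnD (phi_ n r) (- phi r); rewrite sqnN.
  have := B _ (hn n); have := B _ h; lra.
have tl : (fun N => 8 * (`|K| * l2sq (fun j => x j - trunc N x j))) @ \oo --> (0 : R).
  rewrite -(mulr0 8) -[X in 8 * X](mulr0 `|K|); apply: cvgM; first exact: cvg_cst.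
  by apply: cvgM; [exact: cvg_cst|exact: tail_cvg].
have e20 : 0 < e / 2 by rewrite divr_gt0.
move/cvgrPdist_lt : tl => /(_ _ e20)[N _ /(_ N (leqnn N))].
rewrite sub0r normrN => /(le_lt_trans (ler_norm _)) hN.
have : (fun n => 2 * sqn (phi_ n (trunc N x) - phi (trunc N x))) @ \oo --> (0 : R).
  rewrite -(mulr0 2); apply: cvgM; first exact: cvg_cst.
  rewrite -(sqn0 R); apply: sqn_cvg; rewrite -(subrr (phi (trunc N x))).
  apply: (@cvgB _ (R[i])^o); last exact: cvg_cst.
  rewrite (bfunctional_trunc _ _ h).
  under eq_fun do rewrite (bfunctional_trunc _ _ (hn _)).
  exact: (@cvgC_sum (fun n k => phi_ n (delta R k))
                    (fun k => phi (delta R k))).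
move/cvgrPdist_lt => /(_ _ e20); apply: filterS => n.
rewrite !sub0r !normrN => /(le_lt_trans (ler_norm _)) hn'.
rewrite ger0_norm ?sqn_ge0//; apply: le_lt_trans (key N n) _; lra.
Qed.

End SquareSummable.
Arguments l2_delta {R} j.
Arguments l2_trunc {R} N x.
Arguments l2Z {R} c {x}.
Arguments l2_lin {R} c {x y}.

(** * Bounded operators *)

Section BoundedOperators.
Variable R : realType.
Local Notation op := ((nat -> R[i]) -> nat -> R[i]).
Implicit Types (x y z : nat -> R[i]) (c : R[i]) (S T A : op).

Lemma bop_l2sq T : bounded_op T ->
  exists2 K : R, 0 <= K & forall x, l2 x -> l2sq (T x) <= K * l2sq x.
Proof.
move=> [h2 _ [M hM]]; exists (M ^+ 2); first exact: sqr_ge0.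
move=> x hx; rewrite -!l2norm_sqr//; last exact: h2.
rewrite -exprMn -[leRHS]real_normK ?num_real// lerXn2r ?nnegrE//.
  by rewrite sqrtr_ge0.
by apply: le_trans (hM x hx) _; rewrite ler_norm.
Qed.

Lemma bop_build T (K : R) :
  (forall x, l2 x -> l2 (T x)) ->
  (forall c x y, l2 x -> l2 y ->
    T (fun n => c * x n + y n) = fun n => c * T x n + T y n) ->
  (forall x, l2 x -> l2sq (T x) <= K * l2sq x) -> bounded_op T.
Proof.
move=> h2 hl hb; split => //; exists (Num.sqrt `|K|) => x hx.
rewrite -[leLHS]ger0_norm ?sqrtr_ge0// -sqrtr_sqr l2norm_sqr; last exact: h2.
rewrite -[l2norm x]ger0_norm ?sqrtr_ge0// -[`|l2norm x|]sqrtr_sqr l2norm_sqr//.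
rewrite -sqrtrM// ler_wsqrtr//; apply: le_trans (hb x hx) _.
by rewrite ler_wpM2r ?l2sq_ge0// ler_norm.
Qed.

Lemma bop_id : bounded_op (fun x => x : nat -> R[i]).
Proof. by apply: (@bop_build _ 1) => // x; rewrite mul1r. Qed.

Lemma bop_comp S T : bounded_op S -> bounded_op T ->
  bounded_op (fun x => S (T x)).
Proof.
move=> hS hT; have [K K0 hK] := bop_l2sq hS; have [L L0 hL] := bop_l2sq hT.
apply: (@bop_build _ (K * L)) => [x hx|d x y hx hy|x hx].
- by apply: (bop_l2 hS); exact: (bop_l2 hT).
- by rewrite (bop_linear hT)// (bop_linear hS)//; exact: (bop_l2 hT).
- apply: le_trans (hK _ (bop_l2 hT hx)) _.
  by rewrite -mulrA ler_wpM2l// hL.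
Qed.

Lemma bop_lin d S T : bounded_op S -> bounded_op T ->
  bounded_op (fun x n => d * S x n + T x n).
Proof.
move=> hS hT; have [K K0 hK] := bop_l2sq hS; have [L L0 hL] := bop_l2sq hT.
apply: (@bop_build _ (2 * (sqn d * K) + 2 * L)) => [x hx|e x y hx hy|x hx].
- by apply: l2_lin; [exact: (bop_l2 hS)|exact: (bop_l2 hT)].
- rewrite (bop_linear hT)// (bop_linear hS)//; apply/funext => n; ring.
- have hSx := bop_l2 hS hx; have hTx := bop_l2 hT hx.
  apply: le_trans (proj2 (l2D_l2sq (l2Z d hSx) hTx)) _.
  rewrite l2sqZ//; have := hL x hx.
  have : sqn d * l2sq (S x) <= sqn d * (K * l2sq x).
    by rewrite ler_wpM2l ?sqn_ge0// hK.
  by rewrite mulrA; lra.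
Qed.

Lemma bfunctional_innerl T K y : bounded_op T ->
  (forall x, l2 x -> l2sq (T x) <= K * l2sq x) -> l2 y ->
  bfunctional (K * l2sq y) (fun x => inner (T x) y).
Proof.
move=> hT hK hy; split=> [d x z hx hz|x hx].
  by rewrite (bop_linear hT)// inner_lin//; exact: (bop_l2 hT).
apply: le_trans (CauchySchwarz (bop_l2 hT hx) hy) _.
by rewrite mulrAC ler_wpM2r ?l2sq_ge0// hK.
Qed.

Lemma bfunctional_inner y : l2 y -> bfunctional (l2sq y) (fun x => inner x y).
Proof.
by move=> hy; split=> [d x z hx hz|x hx]; [exact: inner_lin|
   rewrite mulrC; exact: CauchySchwarz].
Qed.

(** A bounded operator is determined by its matrix: each coordinate of the image
is a bounded functional. *)
Lemma bop_ext S T x : bounded_op S -> bounded_op T ->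
  (forall j k, S (delta R k) j = T (delta R k) j) -> l2 x -> S x = T x.
Proof.
move=> hS hT h hx; have [K _ hK] := bop_l2sq hS; have [L _ hL] := bop_l2sq hT.
have dl := @l2_delta R; apply/funext => j.
rewrite -inner_delta; last exact: (bop_l2 hS).
rewrite -[RHS]inner_delta; last exact: (bop_l2 hT).
apply: bfunctional_ext (bfunctional_innerl hS hK (dl j)) (bfunctional_innerl hT hL (dl j)) _ hx => k.
by rewrite !inner_delta//; [exact: (bop_l2 hT)|exact: (bop_l2 hS)].
Qed.

Lemma adjoint_entries S T : bounded_op S -> bounded_op T ->
  (forall j k, S (delta R j) k = (T (delta R k) j)^*%C) ->
  forall x y, l2 x -> l2 y -> inner (T x) y = inner x (S y).
Proof.
move=> hS hT h x y hx hy; have [K _ hK] := bop_l2sq hS; have [L _ hL] := bop_l2sq hT.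
have hSy := bop_l2 hS hy; have dl := @l2_delta R.
apply: bfunctional_ext (bfunctional_innerl hT hL hy) (bfunctional_inner hSy) _ hx => k.
have hTk := bop_l2 hT (dl k).
rewrite (innerC hy hTk) (innerC hSy (dl k)); congr (_^*%C).
apply: bfunctional_ext (bfunctional_inner hTk) (bfunctional_innerl hS hK (dl k)) _ hy => j.
rewrite inner_deltal// inner_delta ?h//; exact: (bop_l2 hS).
Qed.

(** Weak convergence of a bounded sequence of operators follows from convergence
of the matrix entries, by passing from the basis to all vectors first in x and
then in y. *)
Lemma bop_weak_cvg K (T_ : nat -> op) T x y :
  (forall n, bounded_op (T_ n)) ->
  (forall n x, l2 x -> l2sq (T_ n x) <= K * l2sq x) -> bounded_op T ->
  (forall j k, (fun n => T_ n (delta R k) j : (R[i])^o) @ \oo -->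
     (T (delta R k) j : (R[i])^o)) ->
  l2 x -> l2 y ->
  (fun n => inner (T_ n x) y : (R[i])^o) @ \oo --> (inner (T x) y : (R[i])^o).
Proof.
move=> hn hK hT h hx hy; have [L _ hL] := bop_l2sq hT; have dl := @l2_delta R.
pose M := Num.max K L.
have hKM n z : l2 z -> l2sq (T_ n z) <= M * l2sq z.
  by move=> hz; apply: le_trans (hK n z hz) _; rewrite ler_wpM2r ?l2sq_ge0// le_max lexx.
have hLM z : l2 z -> l2sq (T z) <= M * l2sq z.
  by move=> hz; apply: le_trans (hL z hz) _; rewrite ler_wpM2r ?l2sq_ge0// le_max lexx orbT.
apply: (@bfunctional_cvg _ (M * l2sq y) (fun n x => inner (T_ n x) y)
          (fun x => inner (T x) y)) => // [n||k].
- exact: (bfunctional_innerl (hn n) (hKM n) hy).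
- exact: (bfunctional_innerl hT hLM hy).
have hTk := bop_l2 hT (dl k); have hnk n := bop_l2 (hn n) (dl k).
rewrite (innerC hy hTk); under eq_fun do rewrite (innerC hy (hnk _)).
apply: cvgC_conj.
have lf z : l2 z -> l2sq z <= M -> bfunctional M (fun v => inner v z).
  move=> hz le; have [h1 h2] := bfunctional_inner hz; split => // v hv.
  by apply: le_trans (h2 v hv) _; rewrite ler_wpM2r ?l2sq_ge0.
have nd : l2sq (delta R k) = 1.
  apply: (@complexI R); rewrite -inner_self// inner_delta// /delta eqxx.
  by apply: eqC.
apply: (@bfunctional_cvg _ M (fun n v => inner v (T_ n (delta R k)))
          (fun v => inner v (T (delta R k)))) => // [n||j].
- by apply: lf => //; apply: le_trans (hKM n _ (dl k)) _; rewrite nd mulr1.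
- by apply: lf => //; apply: le_trans (hLM _ (dl k)) _; rewrite nd mulr1.
rewrite inner_deltal//; under eq_fun do rewrite inner_deltal//.
exact: cvgC_conj.
Qed.

Lemma quad_trunc_cvg T x : bounded_op T -> l2 x ->
  (fun N => inner (T (trunc N x)) (trunc N x) : (R[i])^o) @ \oo -->
    (inner (T x) x : (R[i])^o).
Proof.
move=> hT hx; have [K K0 hK] := bop_l2sq hT.
pose r N := fun j => x j - trunc N x j.
have ht N := l2_trunc N x.
have hr N : l2 (r N) by apply: l2B.
have tx N : l2sq (trunc N x) <= l2sq x.
  rewrite -[leRHS]mul1r; apply: (proj2 (@l2_le _ _ x 1 hx _ _)) => // j.
  by rewrite /trunc mul1r; case: ifP => // _; rewrite sqn0 sqn_ge0.
apply: cvgC_sqn.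
apply: (@squeeze_cvgr _ _ _ _ (fun=> 0) (fun N => 4 * K * l2sq x * l2sq (r N))).
- apply: nearW => N; rewrite sqn_ge0/=.
  have E : x = fun n => 1 * r N n + trunc N x n.
    by apply/funext => n; rewrite mul1r subrK.
  have -> : inner (T x) x = inner (T x) (r N) +
      (inner (T (r N)) (trunc N x) + inner (T (trunc N x)) (trunc N x)).
    rewrite {2}E inner_linr// ?conjc1 ?mul1r; last exact: (bop_l2 hT).
    congr (_ + _); rewrite {1}E (bop_linear hT)// inner_lin ?mul1r//;
      exact: (bop_l2 hT).
  have -> : forall a b c : R[i], a - (b + (c + a)) = - b - c by move=> *; ring.
  apply: le_trans (sqnD _ _) _; rewrite !sqnN.
  have h1 := CauchySchwarz (bop_l2 hT hx) (hr N).
  have h2 := CauchySchwarz (bop_l2 hT (hr N)) (ht N).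
  have h3 := hK _ hx; have h4 := hK _ (hr N).
  have r0 := l2sq_ge0 (hr N); have x0 := l2sq_ge0 hx.
  have h5 : l2sq (T x) * l2sq (r N) <= K * l2sq x * l2sq (r N) by rewrite ler_wpM2r.
  have h6 : l2sq (T (r N)) * l2sq (trunc N x) <= K * l2sq (r N) * l2sq x.
    apply: ler_pM => //; first by apply: l2sq_ge0; exact: (bop_l2 hT).
    exact: l2sq_ge0.
  rewrite [K * l2sq (r N) * l2sq x]mulrAC in h6; lra.
- exact: cvg_cst.
- rewrite -[X in _ --> X](mulr0 (4 * K * l2sq x)).
  by apply: cvgM; [exact: cvg_cst|exact: tail_cvg].
Qed.

Lemma polarization T y z : bounded_op T -> l2 y -> l2 z ->
  let q c := inner (T (fun n => c * z n + y n)) (fun n => c * z n + y n) in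
  4 * inner (T y) z = q 1 - q (-1) + 'i%C * q 'i%C - 'i%C * q (- 'i%C).
Proof.
move=> hT hy hz q.
have hTy := bop_l2 hT hy; have hTz := bop_l2 hT hz.
have E c : q c = c * c^*%C * inner (T z) z + c * inner (T z) y +
    c^*%C * inner (T y) z + inner (T y) y.
  rewrite /q (bop_linear hT)// inner_lin//; last exact: l2_lin.
  by rewrite !inner_linr//; ring.
have Ji : ('i%C : R[i])^*%C = - 'i%C by apply: eqC => /=; rewrite ?oppr0.
have JN w : (- w : R[i])^*%C = - w^*%C by exact: (rmorphN (@conjc R)).
rewrite !E !JN Ji conjc1.
have i2 := @sqr_i R; rewrite expr2 in i2.
apply/eqP; rewrite -subr_eq0; apply/eqP.
transitivity (('i%C * 'i%C + 1) * (2 * inner (T y) z - 2 * inner (T z) y)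
    : R[i]); last by rewrite i2 addNr mul0r.
ring.
Qed.

(** Polarization: over the complex numbers the quadratic form determines the
operator. *)
Lemma polar_ext S T x : bounded_op S -> bounded_op T ->
  (forall x, l2 x -> inner (S x) x = inner (T x) x) -> l2 x -> S x = T x.
Proof.
move=> hS hT h hx; apply: (bop_ext hS hT) hx => j k.
have dl := @l2_delta R.
rewrite -inner_delta; last exact: (bop_l2 hS).
rewrite -[RHS]inner_delta; last exact: (bop_l2 hT).
have n4 : (4 : R[i]) != 0 by rewrite pnatr_eq0.
apply: (mulfI n4); rewrite !polarization// !h//; exact: l2_lin.
Qed.

End BoundedOperators.

Section MatrixOperators.
Variable R : realType.
Implicit Types (x y z : nat -> R[i]) (F G H : nat -> nat -> R[i]).

(** The action of an infinite matrix; the conjugate turns the row times column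
product into an inner product. *)
Definition matop F x : nat -> R[i] := fun j => inner x (fun k => (F j k)^*%C).

(** Boundedness of the sesquilinear form of F, in the additive shape that an
estimate under the integral sign produces. *)
Definition form_bounded (K : R) F := forall n N x y,
  complex.Re (\sum_(j < n) \sum_(k < N) F j k * x k * (y j)^*%C) <=
  K * (\sum_(k < N) sqn (x k) + \sum_(j < n) sqn (y j)).

(** The form is tested on the conjugate of a truncated row and on a multiple of
a basis vector large enough to absorb the right-hand side. *)
Lemma form_bounded_row K F j : 0 <= K -> form_bounded K F -> l2 (F j).
Proof.
move=> K0 hF; apply: (@l2_bound _ _ (K * (2 * K + 1) ^+ 2)) => N.
have := hF j.+1 N (fun k => (F j k)^*%C)
   (fun i => (2 * K + 1)%:C * delta R j i).
have sd : \sum_(i < j.+1) sqn ((2 * K + 1)%:C * delta R j i) = (2 * K + 1) ^+ 2.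
  rewrite big_ord_recr/= big1 ?add0r => [|i _] /=.
    by rewrite /delta eqxx/= mulr1 sqnR.
  by rewrite /delta ltn_eqF// mulr0 sqn0.
rewrite sd big_ord_recr/= big1 ?add0r => [|i _] /=; last first.
  by rewrite big1// => k _; rewrite /delta ltn_eqF// mulr0 conjc0 mulr0.
have -> : \sum_(k < N) F j k * (F j k)^*%C * ((2 * K + 1)%:C * delta R j j)^*%C
    = ((2 * K + 1) * \sum_(k < N) sqn (F j k))%:C.
  rewrite realCM realC_sum mulr_sumr; apply: eq_bigr => k _.
  have d1 : delta R j j = 1 by rewrite /delta eqxx.
  by rewrite sqnE d1 mulr1 conjc_real mulrC.
under [X in K * (X + _)]eq_bigr do rewrite sqnJ.
set S := \sum_(_ < _) _ => /= h.
have : 0 <= S by apply: sumr_ge0 => i _; exact: sqn_ge0.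
have : 0 <= K * S by rewrite mulr_ge0// sumr_ge0// => i _; exact: sqn_ge0.
by rewrite mulrDr in h; lra.
Qed.

Lemma form_bounded_rowJ K F j : 0 <= K -> form_bounded K F -> l2 (fun k => (F j k)^*%C).
Proof. by move=> K0 hF; apply: l2_conj; exact: form_bounded_row hF. Qed.

(** The form is tested on x and on a small multiple s of a truncation of F x,
so that the quadratic term in F x is absorbed. *)
Lemma matop_l2sq K F x : 0 <= K -> form_bounded K F -> l2 x ->
  l2 (matop F x) /\ l2sq (matop F x) <= 2 * K * (2 * K + 1) * l2sq x.
Proof.
move=> K0 hF hx.
have h n : \sum_(j < n) sqn (matop F x j) <= 2 * K * (2 * K + 1) * l2sq x.
  set s := (2 * K + 1)^-1; have s0 : 0 < s by rewrite invr_gt0; lra.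
  set S := \sum_(j < n) _.
  have S0 : 0 <= S by apply: sumr_ge0 => i _; exact: sqn_ge0.
  have H N : complex.Re (\sum_(j < n) s%:C * (matop F x j)^*%C *
        (\sum_(k < N) x k * (F j k)^*%C^*%C)) <= K * (l2sq x + s ^+ 2 * S).
    have := hF n N x (fun j => s%:C * matop F x j).
    have -> : \sum_(j < n) sqn (s%:C * matop F x j) = s ^+ 2 * S.
      by rewrite mulr_sumr; apply: eq_bigr => j _; rewrite sqnM sqnR.
    have -> : \sum_(j < n) \sum_(k < N) F j k * x k * (s%:C * matop F x j)^*%C =
      \sum_(j < n) s%:C * (matop F x j)^*%C * (\sum_(k < N) x k * (F j k)^*%C^*%C).
      apply: eq_bigr => j _; rewrite mulr_sumr; apply: eq_bigr => k _.
      by rewrite conjcK conjcM conjc_real; ring.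
    move=> /le_trans; apply; rewrite ler_wpM2l// lerD2r.
    exact: sum_le_l2sq.
  have : s * S <= K * (l2sq x + s ^+ 2 * S).
    have := @cvgC_sum R (fun N j => \sum_(k < N) x k * (F j k)^*%C^*%C)
       (matop F x) (fun j => s%:C * (matop F x j)^*%C) n.
    move=> /(_ (fun j => inner_cvg hx (@form_bounded_rowJ K F j K0 hF))) /cvgC[/= hr _].
    have -> : s * S = complex.Re (\sum_(k < n) s%:C * (matop F x k)^*%C * matop F x k).
      rewrite Re_sum mulr_sumr; apply: eq_bigr => j _.
      by rewrite -mulrA [_ * matop _ _ _]mulrC sqnE ReMr.
    rewrite -(cvg_lim (@Rhausdorff R) hr); apply: limr_le; first exact: cvgP hr.
    by apply: nearW => N; exact: H.
  have ss : (2 * K + 1) * s = 1 by rewrite mulfV//; lra.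
  have Ks : K * s <= 1 / 2 by lra.
  have : K * s * (s * S) <= 1 / 2 * (s * S) by rewrite ler_wpM2r// mulr_ge0// ltW.
  rewrite expr2 => h1 h2.
  have h3 : s * S <= 2 * K * l2sq x by lra.
  have -> : S = (2 * K + 1) * (s * S) by rewrite mulrA ss mul1r.
  rewrite [2 * K * _]mulrC -mulrA ler_wpM2l//; lra.
by split; [exact: l2_bound h|exact: l2sq_le].
Qed.

Lemma bop_matop K F : 0 <= K -> form_bounded K F -> bounded_op (matop F).
Proof.
move=> K0 hF; apply: (@bop_build _ _ (2 * K * (2 * K + 1))) => [x|c x y hx hy|x] *.
- exact: (proj1 (matop_l2sq K0 hF _)).
- apply/funext => j; rewrite /matop inner_lin//; exact: form_bounded_rowJ hF.
- exact: (proj2 (matop_l2sq K0 hF _)).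
Qed.

Lemma matop_delta K F j k : 0 <= K -> form_bounded K F -> matop F (delta R k) j = F j k.
Proof.
by move=> K0 hF; rewrite /matop inner_deltal ?conjcK//; exact: form_bounded_rowJ hF.
Qed.

Lemma matop_trunc K F N x : 0 <= K -> form_bounded K F ->
  inner (matop F (trunc N x)) (trunc N x) =
  \sum_(j < N) \sum_(k < N) F j k * x k * (x j)^*%C.
Proof.
move=> K0 hF; have ht := l2_trunc N x; have hT := bop_matop K0 hF.
have hO := bop_l2 hT ht.
have E (u : nat -> R[i]) : l2 u ->
    inner u (trunc N x) = \sum_(j < N) u j * (x j)^*%C.
  move=> hu; rewrite (innerC ht hu) (bfunctional_trunc _ _ (bfunctional_inner hu)) conjc_sum.
  apply: eq_bigr => j _; rewrite conjcM -innerC//; last exact: l2_delta.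
  by rewrite inner_delta// mulrC.
rewrite E//; apply: eq_bigr => j _.
have [L _ hL] := bop_l2sq hT.
rewrite -inner_delta// (bfunctional_trunc _ _ (bfunctional_innerl hT hL (l2_delta j))).
rewrite mulr_suml; apply: eq_bigr => k _.
rewrite inner_delta ?(matop_delta _ _ K0 hF) 1?[x k * _]mulrC//.
exact: (bop_l2 hT (l2_delta k)).
Qed.

Lemma matop_ge0 K F x : 0 <= K -> form_bounded K F ->
  (forall N x, 0 <= \sum_(j < N) \sum_(k < N) F j k * x k * (x j)^*%C) ->
  l2 x -> 0 <= inner (matop F x) x.
Proof.
move=> K0 hF h hx.
have /cvgC[hr hi] := quad_trunc_cvg (bop_matop K0 hF) hx.
have H N : 0 <= inner (matop F (trunc N x)) (trunc N x).
  by rewrite (matop_trunc _ _ K0 hF).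
rewrite geC0; apply/andP; split.
  rewrite -(cvg_lim (@Rhausdorff R) hr); apply: limr_ge; first exact: cvgP hr.
  by apply: nearW => N /=; have := H N; rewrite geC0 => /andP[].
rewrite -(cvg_lim (@Rhausdorff R) hi); apply/eqP/cvg_lim => //.
apply: cvg_near_cst; apply: nearW => N /=.
by have := H N; rewrite geC0 => /andP[_ /eqP].
Qed.

(** The series that gives an entry of the product is the inner product of a
row of F with a column of G, so entrywise convergence is enough. *)
Lemma matop_comp K L M F G H x : 0 <= K -> 0 <= L -> 0 <= M ->
  form_bounded K F -> form_bounded L G -> form_bounded M H ->
  (forall j k, (fun n => \sum_(i < n) F j i * G i k : (R[i])^o) @ \oo -->
     (H j k : (R[i])^o)) ->
  l2 x -> matop F (matop G x) = matop H x.
Proof.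
move=> K0 L0 M0 hF hG hH h hx.
have bF := bop_matop K0 hF; have bG := bop_matop L0 hG; have bH := bop_matop M0 hH.
apply: (@bop_ext _ (fun x => matop F (matop G x))) => //; first exact: bop_comp.
move=> j k; rewrite (matop_delta _ _ M0 hH) {1}/matop.
apply: inner_eq; first exact: (bop_l2 bG (l2_delta k)).
  exact: form_bounded_rowJ hF.
apply: cvg_trans (h j k); apply: near_eq_cvg; apply: nearW => n.
by apply: eq_bigr => i _; rewrite (matop_delta _ _ L0 hG) conjcK mulrC.
Qed.

End MatrixOperators.

(** * Bounded integrands *)

Section BoundedIntegrands.
Variable R : realType.
Local Notation borelR := (measurableTypeR R).
Implicit Types (f g : R -> R) (D : set borelR).

(** Measurable on the whole line and bounded on Z: closed under the algebraic
operations, and integrable over Z for every finite measure. *)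
Definition bddon (Z : set R) (f : R -> R) :=
  measurable_fun setT (f : borelR -> borelR) /\
  exists C : R, forall s, Z s -> `|f s| <= C.

Variable Z : set borelR.

Lemma bddon_cst (c : R) : bddon Z (fun=> c).
Proof. by split; [exact: measurable_cst|exists `|c|]. Qed.

Lemma bddonD f g : bddon Z f -> bddon Z g -> bddon Z (fun s => f s + g s).
Proof.
move=> [mf [C hC]] [mg [C' hC']]; split; first exact: measurable_funD.
exists (C + C') => s Zs; apply: le_trans (ler_normD _ _) _.
by rewrite lerD// ?hC ?hC'.
Qed.

Lemma bddonM f g : bddon Z f -> bddon Z g -> bddon Z (fun s => f s * g s).
Proof.
move=> [mf [C hC]] [mg [C' hC']]; split; first exact: measurable_funM.
exists (C * C') => s Zs; rewrite normrM.
by rewrite ler_pM// ?hC ?hC'.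
Qed.

Lemma bddonZ (c : R) f : bddon Z f -> bddon Z (fun s => c * f s).
Proof. by move=> hf; apply: bddonM => //; exact: bddon_cst. Qed.

Lemma bddonB f g : bddon Z f -> bddon Z g -> bddon Z (fun s => f s - g s).
Proof.
move=> hf /(bddonZ (-1)) /(bddonD hf); congr (bddon Z _).
by apply/funext => s; rewrite mulN1r.
Qed.

Lemma bddonX f n : bddon Z f -> bddon Z (fun s => f s ^+ n).
Proof.
move=> hf; elim: n => [|n IH]; first exact: bddon_cst.
by under eq_fun do rewrite exprS; exact: bddonM.
Qed.

Lemma bddon_sum N (F : nat -> R -> R) :
  (forall i, bddon Z (F i)) -> bddon Z (fun s => \sum_(i < N) F i s).
Proof.
move=> h; elim: N => [|N IH].
  by under eq_fun do rewrite big_ord0; exact: bddon_cst.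
by under eq_fun do rewrite big_ord_recr /=; exact: bddonD.
Qed.

Lemma bddon_indic D : measurable D -> bddon Z (\1_D).
Proof.
move=> mD; split; first exact: measurable_realfun.measurable_indic.
by exists 1 => s _; rewrite indicE; case: (_ \in _); rewrite ?normr1 ?normr0.
Qed.

Lemma bddon_poly f (p : {poly R}) : bddon Z f -> bddon Z (fun s => p.[f s]).
Proof.
move=> hf; elim/poly_ind: p => [|p c IH].
  by under eq_fun do rewrite horner0; exact: bddon_cst.
under eq_fun do rewrite hornerMXaddC.
by apply: bddonD; [exact: bddonM|exact: bddon_cst].
Qed.

Section DisjointIndicators.
Variable D_ : nat -> set borelR.
Hypothesis tD : trivIset setT D_.

Lemma sum_indic_in s j n : D_ j s ->
  \sum_(i < n) (\1_(D_ i) s : R) = (j < n)%:R.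
Proof.
move=> Dj; have D1 i : (\1_(D_ i) s : R) = (i == j)%:R.
  rewrite indicE; congr ((nat_of_bool _)%:R); apply/idP/eqP => [/set_mem Di|->].
    by apply: tD => //; exists s.
  exact: mem_set.
elim: n => [|n IH]; first by rewrite big_ord0.
rewrite big_ord_recr/= IH D1 -natrD ltnS [(j <= n)%N]leq_eqVlt (eq_sym n).
by case: (ltngtP j n) => // ->.
Qed.

Lemma sum_indic_out s n : (forall j, ~ D_ j s) ->
  \sum_(i < n) (\1_(D_ i) s : R) = 0.
Proof. by move=> h; rewrite big1// => i _; rewrite indicE memNset. Qed.

Lemma sum_indic_le1 s n : `|\sum_(i < n) (\1_(D_ i) s : R)| <= 1.
Proof.
have [[j Dj]|/forallNP h] := pselect (exists j, D_ j s).
  by rewrite (sum_indic_in _ Dj); case: (j < n)%N; rewrite ?normr1 ?normr0.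
by rewrite sum_indic_out// normr0.
Qed.

Lemma sum_indic_cvg s : (fun n => \sum_(i < n) (\1_(D_ i) s : R)) @ \oo -->
  (\1_(\bigcup_k D_ k) s : R).
Proof.
have [[j Dj]|/forallNP h] := pselect (exists j, D_ j s).
  rewrite indicE mem_set; last by exists j.
  apply: cvg_near_cst; exists j.+1 => // n /= jn.
  by rewrite (sum_indic_in _ Dj) jn.
rewrite indicE memNset; last by move=> [j _]; exact: h.
by apply: cvg_near_cst; apply: nearW => n; rewrite sum_indic_out.
Qed.

End DisjointIndicators.

(** Uniform approximation by the step function that rounds f down to the grid
of mesh e. *)
Lemma step_approx f e : bddon Z f -> 0 < e ->
  exists N (c : nat -> R) (D : nat -> set borelR),
    (forall i, measurable (D i)) /\
    forall s, Z s -> `|f s - \sum_(i < N) c i * \1_(D i) s| <= e.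
Proof.
move=> [mf [C hC]] e0.
pose K := Num.bound (`|C| / e).
have CK : `|C| < e * K%:R.
  by rewrite mulrC -ltr_pdivrMr// archi_boundP// divr_ge0// ltW.
pose D (i : nat) : set borelR :=
  f @^-1` [set t | i%:R <= t / e + K%:R] `&` f @^-1` [set t | t / e + K%:R < i.+1%:R].
exists (K + K)%N, (fun i => e * (i%:R - K%:R)), D; split.
  have mg : measurable_fun setT ((fun s => f s / e + K%:R) : borelR -> borelR).
    by apply: measurable_funD => //; apply: measurable_funM.
  move=> i; apply: measurableI.
    rewrite -[X in measurable X]setTI; have := mg measurableT `[i%:R, +oo[%classic.
    rewrite set_itvE; apply; rewrite -set_itvcy; exact: measurable_itv.
  rewrite -[X in measurable X]setTI; have := mg measurableT `]-oo, i.+1%:R[%classic.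
  rewrite set_itvE; apply; rewrite -set_itvNyo; exact: measurable_itv.
move=> s Zs; have hs : `|f s| < e * K%:R.
  by apply: le_lt_trans CK; apply: le_trans (hC s Zs) (ler_norm _).
pose u := f s / e + K%:R.
have : `|f s / e| < K%:R.
  by rewrite normrM normfV (gtr0_norm e0) ltr_pdivrMr// mulrC.
rewrite ltr_norml => /andP[h1 h2].
have u0 : 0 <= u by rewrite /u; lra.
pose m := Num.trunc u.
have mK : (m < K + K)%N.
  have /andP[h _] := truncn_itv u0.
  rewrite -(ltr_nat R) natrD; apply: le_lt_trans h _; rewrite /u; lra.
have ind i : (\1_(D i) s : R) = (i == m)%:R.
  rewrite indicE; congr ((nat_of_bool _)%:R); rewrite [RHS]eq_sym truncn_eq//.
  by apply/idP/andP => [/set_mem[]|[? ?]]//; apply/mem_set.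
have -> : \sum_(i < K + K) e * (i%:R - K%:R) * \1_(D i) s = e * (m%:R - K%:R).
  rewrite (bigD1 (Ordinal mK))//= ind eqxx mulr1 big1 ?addr0// => i im.
  by rewrite ind -val_eqE/= in im *; rewrite (negbTE im) mulr0.
have /andP[h3 h4] := truncn_itv u0; rewrite -/m in h3 h4.
have fE : f s = e * (u - K%:R) by rewrite /u addrK mulrC divfK// gt_eqF.
rewrite fE -mulrBr ler_norml.
rewrite -natr1 in h4; apply/andP; split; nra.
Qed.

Variable mu : {finite_measure set borelR -> \bar R}.
Hypothesis mZ : measurable Z.
Let I f := (\int[mu]_(s in Z) f s)%R.

Lemma bddon_integrable f : bddon Z f -> mu.-integrable Z (EFin \o f).
Proof.
move=> [mf [C hC]]; apply: measurable_bounded_integrable => //.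
- by rewrite ltey_eq fin_num_measure.
- exact: measurable_funS mf.
- exists C; split; first exact: num_real.
  by move=> x Cx s Zs /=; apply: le_trans (hC s Zs) (ltW Cx).
Qed.

Lemma IntD f g : bddon Z f -> bddon Z g -> I (fun s => f s + g s) = I f + I g.
Proof. by move=> hf hg; rewrite /I RintegralD//; exact: bddon_integrable. Qed.

Lemma IntB f g : bddon Z f -> bddon Z g -> I (fun s => f s - g s) = I f - I g.
Proof. by move=> hf hg; rewrite /I RintegralB//; exact: bddon_integrable. Qed.

Lemma IntZ c f : bddon Z f -> I (fun s => c * f s) = c * I f.
Proof. by move=> hf; rewrite /I RintegralZl//; exact: bddon_integrable. Qed.

Lemma Int_cst c : I (fun=> c) = c * fine (mu Z).
Proof. by rewrite /I Rintegral_cst. Qed.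

Lemma Int_sum N (F : nat -> R -> R) : (forall i, bddon Z (F i)) ->
  I (fun s => \sum_(i < N) F i s) = \sum_(i < N) I (F i).
Proof.
move=> h; elim: N => [|N IH].
  by rewrite big_ord0; under eq_fun do rewrite big_ord0; rewrite Int_cst mul0r.
rewrite big_ord_recr/= -IH -IntD//; last exact: bddon_sum.
by congr I; apply/funext => s; rewrite big_ord_recr.
Qed.

Lemma Int_indic D : measurable D ->
  I (\1_D) = fine (mu (D `&` Z)).
Proof. by move=> mD; rewrite /I /Rintegral integral_indic. Qed.

Lemma Int_le f g : bddon Z f -> bddon Z g -> (forall s, Z s -> f s <= g s) ->
  I f <= I g.
Proof. by move=> hf hg h; apply: le_Rintegral => //; exact: bddon_integrable. Qed.

Lemma Int_ge0 f : (forall s, Z s -> 0 <= f s) -> 0 <= I f.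
Proof. by move=> h; exact: Rintegral_ge0. Qed.

Lemma Int_eq f g : (forall s, Z s -> f s = g s) -> I f = I g.
Proof. by move=> h; apply: eq_Rintegral => s /set_mem; exact: h. Qed.

Lemma Int_bound f C : bddon Z f -> (forall s, Z s -> `|f s| <= C) ->
  `|I f| <= C * fine (mu Z).
Proof.
move=> hf h; rewrite ler_norml -mulNr -!Int_cst; apply/andP; split.
  apply: Int_le => //; first exact: bddon_cst.
  by move=> s /h; rewrite ler_norml => /andP[].
apply: Int_le => //; first exact: bddon_cst.
by move=> s /h; rewrite ler_norml => /andP[].
Qed.

Lemma Int_cvg (f_ : nat -> R -> R) f C :
  (forall n, measurable_fun setT (f_ n : borelR -> borelR)) ->
  measurable_fun setT (f : borelR -> borelR) ->
  (forall n s, Z s -> `|f_ n s| <= C) ->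
  (forall s, Z s -> f_ ^~ s @ \oo --> f s) ->
  (fun n => I (f_ n)) @ \oo --> I f.
Proof.
move=> mf_ mf hC h.
have [] := @dominated_convergence _ _ R mu Z mZ (fun n => EFin \o f_ n)
   (EFin \o f) (cst C%:E).
- by move=> n; apply/measurable_EFinP; exact: measurable_funS (mf_ n).
- by apply/measurable_EFinP; exact: measurable_funS mf.
- by apply: aeW => s Zs; apply: cvg_EFin; [exact: nearW|exact: h].
- by apply: (bddon_integrable (bddon_cst C)).
- by apply: aeW => s n Zs; rewrite /= lee_fin hC.
move=> intf _ cv; rewrite /I /Rintegral.
apply: fine_cvg; rewrite fineK//.
exact: integrable_fin_num.
Qed.

Lemma Int_setT f D : measurable D -> Z `<=` D -> mu (D `\` Z) = 0%E -> bddon Z f ->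
  mu.-integrable D (EFin \o f) /\ (\int[mu]_(s in D) f s)%R = I f.
Proof.
move=> mD ZD mu0 hf; have mf := proj1 hf.
have mN : measurable (D `\` Z) by exact: measurableD.
have E : D `\` (D `\` Z) = Z by rewrite setDD setIidr.
have mfD : measurable_fun D (EFin \o f).
  by apply/measurable_EFinP; exact: measurable_funS mf.
have iD : mu.-integrable D (EFin \o f).
  apply/(negligible_integrable mN mD mfD mu0).
  by rewrite E; exact: bddon_integrable.
split => //; rewrite /I /Rintegral; congr fine.
by rewrite (negligible_integral mN mD iD mu0) E.
Qed.

Lemma Int_step f e N (c : nat -> R) (D : nat -> set borelR) : bddon Z f ->
  (forall i, measurable (D i)) ->
  (forall s, Z s -> `|f s - \sum_(i < N) c i * \1_(D i) s| <= e) ->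
  `|I f - \sum_(i < N) c i * fine (mu (D i `&` Z))| <= e * fine (mu Z).
Proof.
move=> hf mD h.
have hi i : bddon Z (fun s => c i * \1_(D i) s).
  by apply: bddonZ; exact: bddon_indic.
have hs := bddon_sum N hi.
rewrite -[X in `|_ - X|](_ : I (fun s => \sum_(i < N) c i * \1_(D i) s) = _).
  by rewrite -IntB// Int_bound//; exact: bddonB.
rewrite (Int_sum _ hi); apply: eq_bigr => i _.
by rewrite IntZ ?Int_indic//; exact: bddon_indic.
Qed.

End BoundedIntegrands.

Section ThresholdPolynomials.
Variable R : realType.

Lemma bernoulli (x : R) n : -1 <= x -> 1 + n%:R * x <= (1 + x) ^+ n.
Proof.
move=> hx; elim: n => [|n IH]; first by rewrite mul0r addr0 expr0.
rewrite exprS; have h : 0 <= 1 + x by lra.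
apply: le_trans (ler_wpM2l h IH); rewrite -natr1.
have : 0 <= n%:R * x ^+ 2 by rewrite mulr_ge0// sqr_ge0.
rewrite expr2; lra.
Qed.

(** With w = sqrt z, the term m w^m is at most 1 + w + ... + w^(m-1), hence at
most 1 / (1 - w), and a factor w^m remains. *)
Lemma natr_mul_expr_cvg (z : R) : 0 <= z < 1 ->
  (fun m => m%:R * z ^+ m) @ \oo --> (0 : R).
Proof.
move=> /andP[z0 z1]; pose w := Num.sqrt z.
have w0 : 0 <= w by rewrite sqrtr_ge0.
have wz : w ^+ 2 = z by rewrite sqr_sqrtr.
have w1 : w < 1 by rewrite -sqrtr1 ltr_sqrt.
apply: (@squeeze_cvgr _ _ _ _ (fun=> 0) (fun m => (1 - w)^-1 * w ^+ m)).
- apply: nearW => m; rewrite mulr_ge0 ?exprn_ge0//=.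
  rewrite -wz -exprM mulnC exprM expr2 mulrA ler_wpM2r ?exprn_ge0//.
  have w2 : 0 < 1 - w by lra.
  rewrite -[leRHS]mulr1 ler_pdivlMl//.
  rewrite [leRHS](_ : 1 = (1 - w) * (\sum_(i < m) w ^+ i) + w ^+ m); last first.
    by rewrite -opprB mulNr -subrX1; lra.
  apply: ler_wpDr; first exact: exprn_ge0.
  apply: (ler_wpM2l (ltW w2)).
  have -> : m%:R * w ^+ m = \sum_(i < m) w ^+ m.
    by rewrite sumr_const card_ord mulr_natl.
  by apply: ler_sum => i _; apply: (ler_wiXn2l w0 (ltW w1)); exact: ltnW.
- exact: cvg_cst.
- rewrite -[X in _ --> X](mulr0 ((1 - w)^-1)).
  by apply: cvgM; [exact: cvg_cst|apply: cvg_expr; rewrite ger0_norm].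
Qed.

(** The polynomial (1 - (y / d ^+ 2) ^+ m) ^+ n in y = s ^+ 2, where d = k t
bounds the interval and n = m k ^+ (2 m): by Bernoulli's inequality it tends to
1 where k s < d and to 0 where k s >= d. *)
Definition thr_poly (d : R) (k m : nat) : {poly R} :=
  (1 - ((d ^- 2) *: 'X) ^+ m) ^+ (m * (k ^ 2) ^ m).

Lemma thr_polyE d k m y :
  (thr_poly d k m).[y] = (1 - (y / d ^+ 2) ^+ m) ^+ (m * (k ^ 2) ^ m).
Proof.
by rewrite /thr_poly !(hornerE, horner_exp) [d ^- 2 * y]mulrC.
Qed.

Lemma thr_poly_bounds d k m s : 0 < d -> 0 <= s <= d ->
  0 <= (thr_poly d k m).[s ^+ 2] <= 1.
Proof.
move=> d0 /andP[s0 sd]; rewrite thr_polyE.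
have h0 : 0 <= s ^+ 2 / d ^+ 2 by rewrite divr_ge0 ?sqr_ge0.
have h1 : s ^+ 2 / d ^+ 2 <= 1.
  by rewrite ler_pdivrMr ?exprn_gt0// mul1r lerXn2r// ?nnegrE// ltW.
have h2 := exprn_ge0 m h0; have h3 : (s ^+ 2 / d ^+ 2) ^+ m <= 1 by exact: exprn_ile1.
by rewrite exprn_ge0 ?exprn_ile1//; lra.
Qed.

(** Put x = (s / d)^2, z = k^2 x and n = m k^(2m), so that n x^m = m z^m. If
z < 1 then (1 - x^m)^n >= 1 - m z^m tends to 1. If z >= 1 then
(1 - x^m)^n (1 + n x^m) <= (1 - x^(2m))^n <= 1 and n x^m >= m. *)
Lemma thr_poly_cvg d k s : (0 < k)%N -> 0 < d -> 0 <= s <= d ->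
  (fun m => (thr_poly d k m).[s ^+ 2]) @ \oo --> (if k%:R * s < d then 1 else 0 : R).
Proof.
move=> k0 d0 hs; have /andP[s0 sd] := hs.
pose x := s ^+ 2 / d ^+ 2; pose z := (k ^ 2)%:R * x.
have x0 : 0 <= x by rewrite divr_ge0 ?sqr_ge0.
have x1 : x <= 1.
  by rewrite ler_pdivrMr ?exprn_gt0// mul1r lerXn2r// ?nnegrE// ltW.
have z0 : 0 <= z by rewrite mulr_ge0.
have zE : z = (k%:R * s / d) ^+ 2 by rewrite /z /x natrX !exprMn exprVn; ring.
have q0 : 0 <= k%:R * s / d by rewrite divr_ge0 ?mulr_ge0// ltW.
have nx m : (m * (k ^ 2) ^ m)%:R * x ^+ m = m%:R * z ^+ m.
  by rewrite natrM -mulrA natrX -exprMn.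
case: ifPn => [ks|]; last rewrite -leNgt => ks.
- have z1 : z < 1.
    rewrite zE expr_lt1// ltr_pdivrMr// mul1r//.
  apply: (@squeeze_cvgr _ _ _ _ (fun m => 1 - m%:R * z ^+ m) (fun=> 1)).
  + apply: nearW => m; have /andP[_ ->] := thr_poly_bounds k m d0 hs.
    rewrite andbT thr_polyE -/x -nx -mulrN; apply: bernoulli.
    by rewrite lerN2 exprn_ile1.
  + rewrite -[X in _ --> X]subr0; apply: cvgB; first exact: cvg_cst.
    by apply: natr_mul_expr_cvg; rewrite z0.
  + exact: cvg_cst.
- have z1 : 1 <= z.
    by rewrite zE expr_ge1// ler_pdivlMr// mul1r.
  apply: (@squeeze_cvgr _ _ _ _ (fun=> 0) harmonic).
  + apply: nearW => m; have /andP[-> _] := thr_poly_bounds k m d0 hs => /=.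
    rewrite thr_polyE -/x; set n := (m * _)%N.
    have y0 := exprn_ge0 m x0; have y1 : x ^+ m <= 1 by exact: exprn_ile1.
    have m0 : 0 < m.+1%:R :> R by [].
    rewrite /harmonic -[leRHS]mul1r ler_pdivlMr// -nat1r.
    apply: (@le_trans _ _ ((1 - x ^+ m) ^+ n * (1 + x ^+ m) ^+ n)).
      rewrite ler_wpM2l ?exprn_ge0 ?subr_ge0//.
      apply: le_trans (bernoulli n (_ : -1 <= x ^+ m)); last by lra.
      rewrite lerD2l nx ler_peMr// exprn_ege1//.
    rewrite -exprMn -subr_sqr expr1n exprn_ile1//.
      by rewrite subr_ge0 exprn_ile1// ?exprn_ge0.
    by rewrite gerBl sqr_ge0.
  + exact: cvg_cst.
  + exact: cvg_harmonic.
Qed.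

End ThresholdPolynomials.

(** * Density of the even polynomials *)

Section EvenPolynomialDensity.
Variables (R : realType) (M : R).
Local Notation borelR := (measurableTypeR R).
Implicit Types (f g : R -> R) (D : set borelR).
Let Z : set borelR := `[0, M]%classic.
Variable mu : {finite_measure set borelR -> \bar R}.
Let I f := (\int[mu]_(s in Z) f s)%R.

Lemma measurable_0M : measurable Z. Proof. exact: measurable_itv. Qed.

Lemma bddon_id : bddon Z id.
Proof.
split; first exact: measurable_id.
exists `|M| => s; rewrite /Z/= in_itv/= => /andP[s0 sM].
by rewrite ger0_norm//; apply: le_trans sM (ler_norm _).
Qed.

Lemma bddon_evenpoly (p : {poly R}) : bddon Z (fun s => p.[s ^+ 2]).
Proof. by apply: bddon_poly; apply: bddonX; exact: bddon_id. Qed.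

Lemma Int_sqr_cvg (f_ : nat -> R -> R) f C : (forall n, bddon Z (f_ n)) ->
  bddon Z f -> (forall n s, Z s -> `|f_ n s| <= C) ->
  (forall s, Z s -> f_ ^~ s @ \oo --> f s) ->
  (fun n => I (fun s => (f s - f_ n s) ^+ 2)) @ \oo --> (0 : R).
Proof.
move=> bf_ bf hC h; have [mf [C' hC']] := bf.
have hd n : bddon Z (fun s => (f s - f_ n s) ^+ 2).
  by apply: bddonX; apply: bddonB.
have E : I (fun=> 0 : R) = 0 by rewrite /I Int_cst ?mul0r//; exact: measurable_0M.
rewrite -[X in _ --> X]E; apply: (@Int_cvg _ _ _ measurable_0M _ _ ((C' + C) ^+ 2)).
- by move=> n; exact: (proj1 (hd n)).
- exact: measurable_cst.
- move=> n s Zs; rewrite normrX lerXn2r ?nnegrE//.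
    by rewrite addr_ge0// (le_trans _ (hC' s Zs), le_trans _ (hC n s Zs)).
  by apply: le_trans (ler_normB _ _) _; rewrite lerD ?hC ?hC'.
- move=> s Zs; have -> : (0 : R) = (f s - f s) ^+ 2 by rewrite subrr expr0n.
  by rewrite expr2; under eq_fun do rewrite expr2; apply: cvgM;
     apply: cvgB; (try exact: cvg_cst); exact: h.
Qed.

(** Membership in the closure in L^2(mu) of the polynomials in s ^+ 2. *)
Definition even_approx f := forall e, 0 < e ->
  exists p : {poly R}, I (fun s => (f s - p.[s ^+ 2]) ^+ 2) <= e.

Lemma sqrD_le (a b : R) : (a + b) ^+ 2 <= 2 * a ^+ 2 + 2 * b ^+ 2.
Proof. have := sqr_ge0 (a - b); rewrite !expr2; lra. Qed.

Lemma Int_sqrD_le f g : bddon Z f -> bddon Z g ->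
  I (fun s => (f s + g s) ^+ 2) <=
  2 * I (fun s => f s ^+ 2) + 2 * I (fun s => g s ^+ 2).
Proof.
move=> hf hg; have mZ := measurable_0M.
have h2 h : bddon Z h -> bddon Z (fun s => 2 * h s ^+ 2).
  by move=> hh; apply: bddonZ; exact: bddonX.
rewrite /I -!IntZ//; try exact: bddonX.
rewrite -IntD//; try exact: h2.
apply: Int_le => //; first by apply: bddonX; exact: bddonD.
  by apply: bddonD; exact: h2.
by move=> s _; exact: sqrD_le.
Qed.

Lemma even_approx_lim f : bddon Z f ->
  (forall e, 0 < e -> exists g, [/\ bddon Z g, even_approx g &
     I (fun s => (f s - g s) ^+ 2) <= e]) -> even_approx f.
Proof.
move=> hf h e e0; have e4 : 0 < e / 4 by rewrite divr_gt0.
have [g [hg /(_ _ e4)[p hp] fg]] := h _ e4.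
exists p.
have -> : (fun s => (f s - p.[s ^+ 2]) ^+ 2) =
    (fun s => ((f s - g s) + (g s - p.[s ^+ 2])) ^+ 2).
  by apply/funext => s; congr (_ ^+ 2); ring.
apply: (le_trans (Int_sqrD_le _ _)); [exact: bddonB| |lra].
by apply: bddonB => //; exact: bddon_evenpoly.
Qed.

Lemma even_approxD f g : bddon Z f -> bddon Z g -> even_approx f -> even_approx g ->
  even_approx (fun s => f s + g s).
Proof.
move=> bf bg hf hg e e0; have e4 : 0 < e / 4 by rewrite divr_gt0.
have [p hp] := hf _ e4; have [q hq] := hg _ e4; exists (p + q).
have -> : (fun s => (f s + g s - (p + q).[s ^+ 2]) ^+ 2) =
    (fun s => ((f s - p.[s ^+ 2]) + (g s - q.[s ^+ 2])) ^+ 2).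
  by apply/funext => s; congr (_ ^+ 2); rewrite hornerD; ring.
apply: (le_trans (Int_sqrD_le _ _)); last lra.
  by apply: bddonB => //; exact: bddon_evenpoly.
by apply: bddonB => //; exact: bddon_evenpoly.
Qed.

Lemma even_approxZ c f : bddon Z f -> even_approx f -> even_approx (fun s => c * f s).
Proof.
move=> bf hf e e0; have c0 : 0 < 1 + c ^+ 2 by rewrite ltr_pwDl// sqr_ge0.
have e1 : 0 < e / (1 + c ^+ 2) by rewrite divr_gt0.
have [p hp] := hf _ e1; exists (c *: p).
have -> : (fun s => (c * f s - (c *: p).[s ^+ 2]) ^+ 2) =
    (fun s => c ^+ 2 * (f s - p.[s ^+ 2]) ^+ 2).
  by apply/funext => s; rewrite hornerZ; ring.
have bp := bddon_evenpoly p.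
rewrite /I IntZ; [|exact: measurable_0M|by apply: bddonX; exact: bddonB].
set J := (\int[mu]_(s in Z) _)%R.
have J0 : 0 <= J by apply: Int_ge0 => s _; exact: sqr_ge0.
rewrite ler_pdivlMr// /I -/J in hp; lra.
Qed.

Lemma even_approx_poly (p : {poly R}) : even_approx (fun s => p.[s ^+ 2]).
Proof.
move=> e e0; exists p; under eq_fun do rewrite subrr expr0n.
by rewrite /I Int_cst ?mul0r ?ltW//; exact: measurable_0M.
Qed.

Lemma even_approx_sum N (c : nat -> R) (F : nat -> R -> R) :
  (forall i, bddon Z (F i)) -> (forall i, even_approx (F i)) ->
  even_approx (fun s => \sum_(i < N) c i * F i s).
Proof.
move=> h hF; elim: N => [|N IH].
  have := even_approx_poly 0; congr even_approx.
  by apply/funext => s; rewrite big_ord0 horner0.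
under eq_fun do rewrite big_ord_recr /=.
have hc i : bddon Z (fun s => c i * F i s) by exact: bddonZ.
by apply: even_approxD => //; [exact: (bddon_sum N hc)|exact: even_approxZ].
Qed.

Lemma in_0M s : Z s = (0 <= s <= M).
Proof. by rewrite /Z /= in_itv. Qed.

(** The threshold polynomials with d a multiple of t that exceeds M. Their
convergence is pointwise and bounded, so it passes to the integrals with respect
to every finite measure on [0, M]. *)
Lemma thr_poly_halfline t : 0 < t ->
  exists2 p_ : nat -> {poly R},
    (forall n s, Z s -> `|(p_ n).[s ^+ 2]| <= 1) &
    (forall s, Z s -> (fun n => (p_ n).[s ^+ 2]) @ \oo --> (\1_(`]-oo, t[%classic) s : R)).
Proof.
move=> t0; pose k := (Num.bound (`|M| / t)).+1; pose d := k%:R * t.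
have d0 : 0 < d by rewrite mulr_gt0.
have Md : M <= d.
  apply: le_trans (ler_norm _) _; rewrite -ler_pdivrMr// /k -natr1.
  have : `|M| / t < (Num.bound (`|M| / t))%:R by rewrite archi_boundP// divr_ge0// ltW.
  by lra.
have sd s : Z s -> 0 <= s <= d.
  by rewrite in_0M => /andP[-> sM]; apply: le_trans sM Md.
exists (thr_poly d k) => [n s /sd h|s /sd h].
  by have /andP[h0 h1] := thr_poly_bounds k n d0 h; rewrite ger0_norm.
have := thr_poly_cvg (ltn0Sn _ : (0 < k)%N) d0 h.
congr (_ --> _); rewrite indicE /d ltr_pM2l//.
case: ifPn => st; first by rewrite mem_set//= in_itv.
by rewrite memNset//= in_itv/=; exact/negP.
Qed.

Lemma even_approx_halfline t : even_approx (\1_(`]-oo, t[%classic : set borelR)).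
Proof.
have mD : measurable (`]-oo, t[%classic : set borelR) by exact: measurable_itv.
have bD := bddon_indic Z mD.
have [t0|t0] := ltP 0 t; last first.
  move=> e e0; exists 0.
  rewrite /I (@Int_eq _ _ _ _ (fun=> 0)) ?Int_cst ?mul0r ?ltW//; first exact: measurable_0M.
  move=> s; rewrite in_0M => /andP[s0 _]; rewrite horner0 subr0 indicE memNset ?expr0n//=.
  by rewrite in_itv/=; apply/negP; rewrite -leNgt; apply: le_trans t0 s0.
have [p_ hb hc] := thr_poly_halfline t0.
have := Int_sqr_cvg (fun n => bddon_evenpoly (p_ n)) bD hb hc.
move=> /cvgrPdist_le h e e0; have [N _ /(_ N (leqnn N)) hN] := h _ e0.
exists (p_ N); apply: le_trans hN; rewrite sub0r normrN; exact: ler_norm.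
Qed.

(** The approximable sets form a Dynkin system that contains the half-lines,
which are stable under intersection and generate the Borel sets. *)
Lemma even_approx_indic D : measurable D -> even_approx (\1_D).
Proof.
rewrite (RGenInftyO.measurableE R) => mD.
have E := RGenInftyO.measurableE R.
apply: (@dynkin_induction _ borelR _ (fun D => even_approx (\1_D)) E _ _ _ _ _ D mD).
- move=> _ _ [a ->] [b ->]; exists (Num.min a b).
  apply/seteqP; split => s; rewrite /= !in_itv/= lt_min; last by move/andP.
  by move=> [-> ->].
- move=> e e0; exists 1; under eq_fun do rewrite indicT hornerC subrr expr0n.
  by rewrite /I Int_cst ?mul0r ?ltW//; exact: measurable_0M.
- by move=> _ [t ->]; exact: even_approx_halfline.
- move=> S mS hS.
  have -> : \1_(~` S) = (fun s => (1 : {poly R}).[s ^+ 2] + (-1) * \1_S s).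
    by apply/funext => s; rewrite hornerC !indicE in_setC;
       case: (_ \in _); rewrite /=; ring.
  have bS := bddon_indic Z mS.
  apply: even_approxD; [exact: bddon_evenpoly|exact: bddonZ|exact: even_approx_poly|exact: even_approxZ].
- move=> F mF tF hF.
  have mU : measurable (\bigcup_k F k) by exact: bigcupT_measurable.
  have bF i : bddon Z (\1_(F i)) by exact: bddon_indic.
  have bs n : bddon Z (fun s => \sum_(i < n) \1_(F i) s).
    exact: (@bddon_sum _ _ _ (fun i => \1_(F i))).
  have := Int_sqr_cvg bs (bddon_indic Z mU) (fun n s _ => sum_indic_le1 tF s n)
    (fun s _ => @sum_indic_cvg R F tF s).
  move=> /cvgrPdist_le h; apply: even_approx_lim; first exact: bddon_indic.
  move=> e e0; have [N _ /(_ N (leqnn N)) hN] := h _ e0.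
  exists (fun s => \sum_(i < N) \1_(F i) s); split => //.
    have := @even_approx_sum N (fun=> 1) (fun i => \1_(F i)) bF hF; congr even_approx.
    by apply/funext => s; apply: eq_bigr => i _; rewrite mul1r.
  by apply: le_trans hN; rewrite sub0r normrN; exact: ler_norm.
Qed.

Lemma even_approx_bddon f : bddon Z f -> even_approx f.
Proof.
move=> bf; apply: even_approx_lim => // e e0.
have m0 : 0 <= fine (mu Z) by exact: fine_ge0.
pose d := Num.sqrt (e / (1 + fine (mu Z))).
have h0 : 0 < e / (1 + fine (mu Z)) by rewrite divr_gt0// ltr_pwDl.
have d0 : 0 < d by rewrite sqrtr_gt0.
have [N [c [D [mD h]]]] := step_approx bf d0.
have bD i : bddon Z (\1_(D i)) by exact: bddon_indic.
have bs : bddon Z (fun s => \sum_(i < N) c i * \1_(D i) s).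
  by apply: (@bddon_sum _ _ _ (fun i s => c i * \1_(D i) s)) => i; exact: bddonZ.
exists (fun s => \sum_(i < N) c i * \1_(D i) s); split => //.
  by apply: (@even_approx_sum N c (fun i => \1_(D i))) => // i; exact: even_approx_indic.
have hd : d ^+ 2 = e / (1 + fine (mu Z)) by rewrite sqr_sqrtr// ltW.
apply: (@le_trans _ _ (d ^+ 2 * fine (mu Z))).
  apply: le_trans (ler_norm _) _; apply: Int_bound; first exact: measurable_0M.
    by apply: bddonX; exact: bddonB.
  move=> s /h hs; rewrite normrX lerXn2r// nnegrE//; exact: ltW.
rewrite hd mulrAC ler_pdivrMr ?ltr_pwDl//; apply: (ler_wpM2l (ltW e0)).
by rewrite lerDr.
Qed.

End EvenPolynomialDensity.

(** * Complex integrands and the weight form *)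

Section ComplexIntegrands.
Variables (R : realType) (M : R).
Local Notation borelR := (measurableTypeR R).
Let Z : set borelR := `[0, M]%classic.
Implicit Types f g : R -> R[i].

(** The complex version of [bddon]. *)
Definition cbdd (Z : set borelR) f :=
  bddon Z (fun s => complex.Re (f s)) /\ bddon Z (fun s => complex.Im (f s)).

Lemma cbdd_real (h : R -> R) : bddon Z h -> cbdd Z (fun s => (h s)%:C).
Proof. by move=> bh; split => //=; exact: bddon_cst. Qed.

Lemma cbdd_cst c : cbdd Z (fun=> c).
Proof. by split; exact: bddon_cst. Qed.

Lemma cbddD f g : cbdd Z f -> cbdd Z g -> cbdd Z (fun s => f s + g s).
Proof.
by move=> [? ?] [? ?]; split; under eq_fun do rewrite ?ReD ?ImD; exact: bddonD.
Qed.

Lemma cbddM f g : cbdd Z f -> cbdd Z g -> cbdd Z (fun s => f s * g s).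
Proof.
move=> [? ?] [? ?]; split; under eq_fun do rewrite ?ReM ?ImM.
  by apply: bddonB; exact: bddonM.
by apply: bddonD; exact: bddonM.
Qed.

Lemma cbddJ f : cbdd Z f -> cbdd Z (fun s => (f s)^*%C).
Proof.
move=> [hr hi]; split; first by under eq_fun do rewrite ReJ.
by under eq_fun do rewrite ImJ -mulN1r; exact: bddonZ.
Qed.

Lemma cbdd_poly f (p : {poly R[i]}) : cbdd Z f -> cbdd Z (fun s => p.[f s]).
Proof.
move=> hf; elim/poly_ind: p => [|p c IH].
  by under eq_fun do rewrite horner0; exact: cbdd_cst.
under eq_fun do rewrite hornerMXaddC.
by apply: cbddD; [exact: cbddM|exact: cbdd_cst].
Qed.

Lemma cbdd_sqn f : cbdd Z f -> bddon Z (fun s => sqn (f s)).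
Proof. by move=> [hr hi]; apply: bddonD; exact: bddonX. Qed.

Variable mu : {finite_measure set borelR -> \bar R}.
Let IC f := cintegral mu Z f.

Lemma IC_lin c f g : cbdd Z f -> cbdd Z g ->
  IC (fun s => c * f s + g s) = c * IC f + IC g.
Proof.
move=> [fr fi] [gr gi]; have mZ := measurable_0M M; apply: eqC; rewrite !ReImE /IC /cintegral /=.
- under eq_Rintegral do rewrite !ReImE.
  rewrite IntD//; last by apply: bddonB; exact: bddonZ.
  by rewrite IntB ?IntZ//; exact: bddonZ.
- under eq_Rintegral do rewrite !ReImE.
  rewrite IntD//; last by apply: bddonD; exact: bddonZ.
  by rewrite IntD ?IntZ//; exact: bddonZ.
Qed.

Lemma IC_real (h : R -> R) : IC (fun s => (h s)%:C) = ((\int[mu]_(s in Z) h s)%R)%:C.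
Proof.
by apply: eqC => //=; rewrite Int_cst ?mul0r//; exact: measurable_0M.
Qed.

Lemma IC_eq f g : (forall s, Z s -> f s = g s) -> IC f = IC g.
Proof.
move=> h; apply: eqC; rewrite /IC /cintegral/=; apply: Int_eq => s Zs; by rewrite h.
Qed.

Lemma ICJ f : cbdd Z f -> IC (fun s => (f s)^*%C) = (IC f)^*%C.
Proof.
move=> [fr fi]; apply: eqC; rewrite !ReImE /IC /cintegral /=.
  by apply: Int_eq => s _; rewrite ReJ.
under eq_Rintegral do rewrite ImJ -mulN1r.
by rewrite IntZ ?mulN1r//; exact: measurable_0M.
Qed.

Lemma Re_IC f : complex.Re (IC f) = (\int[mu]_(s in Z) complex.Re (f s))%R.
Proof. by []. Qed.

Lemma Im_IC f : complex.Im (IC f) = (\int[mu]_(s in Z) complex.Im (f s))%R.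
Proof. by []. Qed.

End ComplexIntegrands.

Section WeightForm.
Variable R : realType.
Implicit Types (p q : {poly R[i]}) (s : R) (w c d : R[i]).

Local Notation conjp p := (map_poly (@conjc R) p).

Definition ev s p : R[i] := (p.[s%:C] + p.[- s%:C]) / 2.
Definition od s p : R[i] := (p.[s%:C] - p.[- s%:C]) / 2.

(** A polynomial is represented at s by the pair of its even and its odd part,
and two pairs are paired through the weight matrix with rows (1, w), (w^*, 1).
In the model w is the value psi(s) of the phase function, and the bound
|w| <= 1 makes the weight nonnegative. *)
Definition wform w s p q : R[i] :=
  ev s p * (ev s q)^*%C + od s p * (od s q)^*%C +
  w * ev s p * (od s q)^*%C + w^*%C * od s p * (ev s q)^*%C.

Lemma ev_lin s c p q : ev s (c *: p + q) = c * ev s p + ev s q.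
Proof. by rewrite /ev !hornerD !hornerZ; ring. Qed.

Lemma od_lin s c p q : od s (c *: p + q) = c * od s p + od s q.
Proof. by rewrite /od !hornerD !hornerZ; ring. Qed.

Lemma wform_linl w s c p p' q :
  wform w s (c *: p + p') q = c * wform w s p q + wform w s p' q.
Proof. by rewrite /wform ev_lin od_lin; ring. Qed.

Lemma wformC w s p q : wform w s q p = (wform w s p q)^*%C.
Proof. by rewrite /wform !(conjcD, conjcM, conjcK); ring. Qed.

Lemma wform_linr w s c p p' q :
  wform w s q (c *: p + p') = c^*%C * wform w s q p + wform w s q p'.
Proof.
by rewrite wformC wform_linl conjcD conjcM -!wformC.
Qed.

(** Completing the square in the weight form. *)
Lemma wform_sqn w s p :
  wform w s p p = (sqn (ev s p + w^*%C * od s p) + (1 - sqn w) * sqn (od s p))%:C.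
Proof.
rewrite /wform; move: (ev s p) (od s p) => [a b] [c d]; case: w => u v.
by apply: eqC; rewrite /sqn /=; ring.
Qed.

Lemma wform_ge0 w s p : sqn w <= 1 -> 0 <= complex.Re (wform w s p p).
Proof.
move=> w1; rewrite wform_sqn /= addr_ge0 ?sqn_ge0// mulr_ge0 ?sqn_ge0//.
by rewrite subr_ge0.
Qed.

Lemma wform_diag w s p : wform w s p p = (complex.Re (wform w s p p))%:C.
Proof. by rewrite wform_sqn. Qed.

Lemma wform_quad w s c d p q :
  wform w s (c *: p + d *: q) (c *: p + d *: q) =
  c * c^*%C * wform w s p p + c * d^*%C * wform w s p q +
  d * c^*%C * wform w s q p + d * d^*%C * wform w s q q.
Proof.
have e1 : ev s (c *: p + d *: q) = c * ev s p + d * ev s q.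
  by rewrite /ev !hornerD !hornerZ; ring.
have e2 : od s (c *: p + d *: q) = c * od s p + d * od s q.
  by rewrite /od !hornerD !hornerZ; ring.
by rewrite /wform e1 e2 !(conjcD, conjcM); ring.
Qed.

(** Expanding the nonnegative form at c p - e q. *)
Lemma Re_wform_le w s p q c e : sqn w <= 1 -> 0 < e -> sqn c <= e ^+ 2 ->
  complex.Re (c * wform w s p q) <=
  e / 2 * (complex.Re (wform w s p p) + complex.Re (wform w s q q)).
Proof.
move=> w1 e0 ce.
have := wform_ge0 s (c *: p + (- e%:C) *: q) w1.
rewrite wform_quad (wformC w s p q).
move: (wform_diag w s p) (wform_diag w s q) => -> ->.
have P0 := wform_ge0 s p w1; have Q0 := wform_ge0 s q w1.
move: (complex.Re (wform w s p p)) (complex.Re (wform w s q q)) P0 Q0 => P Q P0 Q0.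
move: (wform w s p q) => [x y]; case: c ce => u v; rewrite /sqn /= => ce h.
have h1 : (u ^+ 2 + v ^+ 2) * P <= e ^+ 2 * P by rewrite ler_wpM2r.
have h2 : 0 <= (u ^+ 2 + v ^+ 2) * P + e ^+ 2 * Q - 2 * e * (u * x - v * y).
  by apply: le_trans h _; rewrite le_eqVlt; apply/orP; left; apply/eqP; ring.
have h3 : 2 * e * (u * x - v * y) <= 2 * e * (e / 2 * (P + Q)) by lra.
by rewrite ler_pM2l ?mulr_gt0// in h3.
Qed.

(** The weight form may be degenerate when |w| = 1, but a vector that it kills
has parts of equal modulus: ev = - w^* od. This is the quantitative version,
which integrates. *)
Lemma wform_sep w s p : sqn w <= 1 ->
  (sqn (ev s p) - sqn (od s p)) ^+ 2 <=
  complex.Re (wform w s p p) * (4 * sqn (ev s p) + 6 * sqn (od s p)).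
Proof.
move=> w1; rewrite wform_sqn /=; move: (ev s p) (od s p) => f g.
pose z := w^*%C * g.
have zE : sqn z = sqn w * sqn g by rewrite sqnM sqnJ.
have f0 := sqn_ge0 f; have g0 := sqn_ge0 g; have w0 := sqn_ge0 w.
have h1 : (sqn f - sqn z) ^+ 2 <= sqn (f + z) * (2 * sqn f + 2 * sqn z).
  case: (f) (z) => a b [c d]; rewrite /sqn /=.
  rewrite -subr_ge0.
  have -> : (((a + c) ^+ 2 + (b + d) ^+ 2) *
    (2 * (a ^+ 2 + b ^+ 2) + 2 * (c ^+ 2 + d ^+ 2)) -
    (a ^+ 2 + b ^+ 2 - (c ^+ 2 + d ^+ 2)) ^+ 2) =
    ((a + c) ^+ 2 + (b + d) ^+ 2) ^+ 2 +
    (((a + c) * (b - d) - (b + d) * (a - c))) ^+ 2 :> R by ring.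
  by rewrite addr_ge0 ?sqr_ge0.
have sz : sqn z <= sqn g by rewrite zE ler_piMl.
have P0 : 0 <= sqn (f + z) by exact: sqn_ge0.
have Q0 : 0 <= (1 - sqn w) * sqn g by rewrite mulr_ge0// subr_ge0.
have Q1 : (1 - sqn w) * sqn g <= sqn g by rewrite ler_piMl// gerBl.
rewrite -/z; move: h1 P0; set P := sqn (f + z) => h1 P0.
move: Q0 Q1; set Q := (1 - sqn w) * sqn g => Q0 Q1.
have -> : sqn f - sqn g = (sqn f - sqn z) - Q by rewrite /Q zE; ring.
apply: (@le_trans _ _ (2 * (sqn f - sqn z) ^+ 2 + 2 * Q ^+ 2)).
  by rewrite -[X in _ + 2 * X]sqrrN; exact: sqrD_le.
have h2 : Q ^+ 2 <= Q * sqn g by rewrite expr2 ler_wpM2l.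
have h3 : P * sqn z <= P * sqn g by rewrite ler_wpM2l.
have h4 : 0 <= Q * sqn f by rewrite mulr_ge0.
have h5 : 0 <= Q * sqn g by rewrite mulr_ge0.
have h6 : 0 <= P * sqn g by rewrite mulr_ge0.
lra.
Qed.

(** The antilinear operator that acts on the model as T = C J acts on
sequences. It exchanges the even and the odd part, is symmetric for every
weight form, and its square is multiplication by s ^+ 2. *)
Definition Tpoly p : {poly R[i]} := 'X * conjp p.

Lemma horner_conj p s : (conjp p).[s%:C] = (p.[s%:C])^*%C.
Proof. by rewrite -{1}(conjc_real s) horner_map. Qed.

Lemma hornerN_conj p s : (conjp p).[- s%:C] = (p.[- s%:C])^*%C.
Proof. by rewrite -!(rmorphN (real_complex R)) horner_conj. Qed.

Lemma conjc_half z : (z / 2 : R[i])^*%C = z^*%C / 2.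
Proof. by rewrite conjcM conjc_inv conjc_nat. Qed.

Lemma ev_Tpoly p s : ev s (Tpoly p) = s%:C * (od s p)^*%C.
Proof.
rewrite /ev /od /Tpoly !hornerE horner_conj hornerN_conj conjc_half conjcD.
by rewrite (rmorphN (@conjc R)); ring.
Qed.

Lemma od_Tpoly p s : od s (Tpoly p) = s%:C * (ev s p)^*%C.
Proof.
rewrite /ev /od /Tpoly !hornerE horner_conj hornerN_conj conjc_half conjcD.
by ring.
Qed.

Lemma wform_Tpoly w s p q :
  wform w s (Tpoly p) (Tpoly q) = (s ^+ 2)%:C * (wform w s p q)^*%C.
Proof.
rewrite /wform !ev_Tpoly !od_Tpoly !(conjcD, conjcM, conjcK) conjc_real.
by rewrite expr2 realCM; ring.
Qed.

Lemma wform_Tpoly_sym w s p q : wform w s (Tpoly p) q = wform w s (Tpoly q) p.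
Proof. by rewrite /wform !ev_Tpoly !od_Tpoly; ring. Qed.

(** Real polynomials in X^2 act as scalars. *)
Definition evenp (r : {poly R}) : {poly R[i]} :=
  map_poly (real_complex R) (r \Po 'X^2).

Lemma wform_evenp w s r p q :
  wform w s (evenp r * p) q = (r.[s ^+ 2])%:C * wform w s p q.
Proof.
have hE : (evenp r).[s%:C] = (r.[s ^+ 2])%:C.
  by rewrite /evenp horner_map horner_comp hornerXn.
have hN : (evenp r).[- s%:C] = (r.[s ^+ 2])%:C.
  rewrite -(rmorphN (real_complex R)) /evenp horner_map horner_comp hornerXn.
  by rewrite sqrrN.
have e1 : ev s (evenp r * p) = (r.[s ^+ 2])%:C * ev s p.
  by rewrite /ev !hornerM hE hN; ring.
have e2 : od s (evenp r * p) = (r.[s ^+ 2])%:C * od s p.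
  by rewrite /od !hornerM hE hN; ring.
by rewrite /wform e1 e2; ring.
Qed.

(** The difference |ev|^2 - |od|^2 is Re (p(s) p(-s)^* ), a polynomial in s
whose leading coefficient does not vanish. *)
Lemma ev_od_roots p (S : set R) : infinite_set S ->
  (forall s, S s -> sqn (ev s p) = sqn (od s p)) -> p = 0.
Proof.
move=> infS h; apply/eqP; apply: contraT => p0.
pose Q := p * (conjp p \Po (- 'X)); pose Q' := (p \Po (- 'X)) * conjp p.
have QQr s : S s -> (Q + Q').[s%:C] = 0.
  move=> /h; rewrite hornerD !hornerM !horner_comp hornerN hornerX.
  rewrite horner_conj hornerN_conj /ev /od.
  move: (p.[s%:C]) (p.[- s%:C]) => [a b] [c d].
  have E (x y : R) : (x +i* y) / 2 = ((x / 2) +i* (y / 2)) :> R[i].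
    have -> : (2 : R[i]) = (2 : R)%:C by rewrite rmorph_nat.
    by rewrite -fmorphV mulrC; apply: eqC; rewrite !ReImE /= mulrC.
  have -> : (a +i* b : R[i]) + (c +i* d) = (a + c) +i* (b + d) by [].
  have -> : (a +i* b : R[i]) - (c +i* d) = (a - c) +i* (b - d) by [].
  rewrite !E /sqn /= => H; apply: eqC => /=; last by ring.
  have -> : a * c - b * - d + (c * a - d * - b) =
   2 * (((a + c) / 2) ^+ 2 + ((b + d) / 2) ^+ 2 -
     (((a - c) / 2) ^+ 2 + ((b - d) / 2) ^+ 2)) by field.
  by rewrite H subrr mulr0.
have sX : size (- 'X : {poly R[i]}) = 2 by rewrite size_polyN size_polyX.
have lX : lead_coef (- 'X : {poly R[i]}) = -1 by rewrite lead_coefN lead_coefX.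
have sc : size (conjp p) = size p by rewrite size_map_poly.
have c0 : conjp p != 0 by rewrite -size_poly_eq0 sc size_poly_eq0.
have lc : lead_coef (conjp p) = (lead_coef p)^*%C by rewrite lead_coef_map.
have szc q : size (q \Po (- 'X : {poly R[i]})) = size q by rewrite size_comp_poly2.
have nzc q : q != 0 -> q \Po (- 'X : {poly R[i]}) != 0.
  by rewrite -!size_poly_eq0 szc.
have ldc q : lead_coef (q \Po (- 'X : {poly R[i]})) =
    lead_coef q * (-1) ^+ (size q).-1.
  by rewrite lead_coef_comp ?sX// lX.
have sQ : size Q = (size p + size p).-1 by rewrite size_mul ?nzc// szc sc.
have sQ' : size Q' = (size p + size p).-1 by rewrite size_mul ?nzc// szc sc.
have lQ : lead_coef Q = (-1) ^+ (size p).-1 * (sqn (lead_coef p))%:C.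
  by rewrite lead_coefM ldc sc lc mulrA sqnE mulrC.
have lQ' : lead_coef Q' = (-1) ^+ (size p).-1 * (sqn (lead_coef p))%:C.
  by rewrite lead_coefM ldc lc mulrAC sqnE mulrC.
have QQ0 : Q + Q' != 0.
  apply/eqP => /(congr1 (fun q : {poly R[i]} => q`_((size p + size p).-1.-1))).
  rewrite coefD coef0 -{1}sQ -{1}sQ' -!lead_coefE lQ lQ' -mulrDr => /eqP.
  rewrite mulf_eq0 signr_eq0 /= -mulr2n mulrn_eq0 /= => /eqP /(@complexI R).
  by move=> /sqn_eq0 /eqP; rewrite lead_coef_eq0 (negbTE p0).
have [B Bs Bsz] := infinite_set_fset (size (Q + Q')) infS.
have au : uniq [seq s%:C | s <- finmap.enum_fset B].
  by rewrite map_inj_uniq ?finmap.fset_uniq//; exact: (@complexI R).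
have ar : all (root (Q + Q')) [seq s%:C | s <- finmap.enum_fset B].
  by apply/allP => _ /mapP[s sB ->]; apply/rootP; apply: QQr; exact: Bs.
by have := max_poly_roots QQ0 ar au; rewrite size_map ltnNge Bsz.
Qed.

End WeightForm.

(** * Orthonormal polynomials for the weight form *)

Section Lanczos.
Variables (R : realType) (M : R).
Local Notation borelR := (measurableTypeR R).
Let Z : set borelR := `[0, M]%classic.
Variable nu : {finite_measure set borelR -> \bar R}.
Variable psi : R -> R[i].
Hypothesis cpsi : cbdd Z psi.
Hypothesis psi_le1 : forall s, sqn (psi s) <= 1.
Hypothesis nuZ1 : fine (nu Z) = 1.
Variable S : set R.
Hypothesis infS : infinite_set S.
Hypothesis suppS : forall s (U : set borelR), S s -> open (U : set R) -> U s ->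
  0 < fine (nu (U `&` Z)).
Implicit Types (p q : {poly R[i]}) (phi chi : R -> R[i]).
Let IC (f : R -> R[i]) := cintegral nu Z f.
Let I (f : R -> R) := (\int[nu]_(s in Z) f s)%R.
Let mZ := measurable_0M M.

Lemma cbdd_eval p : cbdd Z (fun s => p.[s%:C]).
Proof. by apply: cbdd_poly; apply: cbdd_real; exact: bddon_id. Qed.

Lemma ev_poly p s : ev s p = (2^-1 *: (p + (p \Po - 'X))).[s%:C].
Proof.
by rewrite hornerZ hornerD horner_comp hornerN hornerX /ev mulrC.
Qed.

Lemma od_poly p s : od s p = (2^-1 *: (p - (p \Po - 'X))).[s%:C].
Proof.
by rewrite hornerZ hornerD hornerN horner_comp hornerN hornerX /od mulrC.
Qed.

Lemma cbdd_ev p : cbdd Z (fun s => ev s p).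
Proof. by under eq_fun do rewrite ev_poly; exact: cbdd_eval. Qed.

Lemma cbdd_od p : cbdd Z (fun s => od s p).
Proof. by under eq_fun do rewrite od_poly; exact: cbdd_eval. Qed.

Lemma cbdd_wform p q : cbdd Z (fun s => wform (psi s) s p q).
Proof.
have [h1 h2 h3 h4] : [/\ cbdd Z (fun s => ev s p), cbdd Z (fun s => od s p),
  cbdd Z (fun s => (ev s q)^*%C) & cbdd Z (fun s => (od s q)^*%C)].
  by split; [exact: cbdd_ev|exact: cbdd_od|apply: cbddJ; exact: cbdd_ev|
     apply: cbddJ; exact: cbdd_od].
have h5 := cbddJ cpsi.
by rewrite /wform; do !apply: cbddD; (try by apply: cbddM); apply: cbddM => //;
   apply: cbddM.
Qed.

(** The form of multiplication by phi(s) on the model space; phi = 1 gives the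
inner product [ip]. *)
Definition Phi phi p q := IC (fun s => phi s * wform (psi s) s p q).

Lemma cbdd_Phi phi p q : cbdd Z phi ->
  cbdd Z (fun s => phi s * wform (psi s) s p q).
Proof. by move=> hp; apply: cbddM => //; exact: cbdd_wform. Qed.

Lemma Phi_linl phi c p p' q : cbdd Z phi ->
  Phi phi (c *: p + p') q = c * Phi phi p q + Phi phi p' q.
Proof.
move=> hp; rewrite /Phi /IC -IC_lin//; [|exact: cbdd_Phi..].
by apply: IC_eq => s _; rewrite wform_linl; ring.
Qed.

Lemma PhiC phi p q : cbdd Z phi ->
  Phi phi q p = (Phi (fun s => (phi s)^*%C) p q)^*%C.
Proof.
move=> hp; rewrite /Phi /IC -ICJ; last by apply: cbdd_Phi; exact: cbddJ.
by apply: IC_eq => s _; rewrite wformC conjcM conjcK.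
Qed.

Lemma Phi_linr phi c p p' q : cbdd Z phi ->
  Phi phi q (c *: p + p') = c^*%C * Phi phi q p + Phi phi q p'.
Proof.
move=> hp; rewrite /Phi /IC -IC_lin//; [|exact: cbdd_Phi..].
by apply: IC_eq => s _; rewrite wform_linr; ring.
Qed.

Lemma Phi_0l phi q : cbdd Z phi -> Phi phi 0 q = 0.
Proof.
move=> hp; have := Phi_linl (-1) 0 0 q hp.
by rewrite scaler0 addr0 mulN1r addNr.
Qed.

Lemma Phi_0r phi q : cbdd Z phi -> Phi phi q 0 = 0.
Proof.
move=> hp; have := Phi_linr (-1) 0 0 q hp.
have -> : (-1 : R[i])^*%C = -1 by apply: eqC => /=; rewrite ?oppr0.
by rewrite scaler0 addr0 mulN1r addNr.
Qed.

Lemma Phi_suml phi N (c : nat -> R[i]) (p : nat -> {poly R[i]}) q : cbdd Z phi ->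
  Phi phi (\sum_(k < N) c k *: p k) q = \sum_(k < N) c k * Phi phi (p k) q.
Proof.
move=> hp; elim: N => [|N IH]; first by rewrite !big_ord0 Phi_0l.
by rewrite !big_ord_recr/= addrC Phi_linl// IH addrC.
Qed.

Lemma Phi_sumr phi N (c : nat -> R[i]) (p : nat -> {poly R[i]}) q : cbdd Z phi ->
  Phi phi q (\sum_(k < N) c k *: p k) = \sum_(k < N) (c k)^*%C * Phi phi q (p k).
Proof.
move=> hp; elim: N => [|N IH]; first by rewrite !big_ord0 Phi_0r.
by rewrite !big_ord_recr/= addrC Phi_linr// IH addrC.
Qed.

Lemma Phi_lin_phi c phi chi p q : cbdd Z phi -> cbdd Z chi ->
  Phi (fun s => c * phi s + chi s) p q = c * Phi phi p q + Phi chi p q.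
Proof.
move=> h1 h2; rewrite /Phi /IC -IC_lin//; [|exact: cbdd_Phi..].
by apply: IC_eq => s _; ring.
Qed.

Lemma cbdd_one : cbdd Z (fun=> 1 : R[i]). Proof. exact: cbdd_cst. Qed.

Definition ip p q := Phi (fun=> 1) p q.

Lemma ipE p q : ip p q = IC (fun s => wform (psi s) s p q).
Proof. by apply: IC_eq => s _; rewrite mul1r. Qed.

Lemma ipC p q : ip q p = (ip p q)^*%C.
Proof.
rewrite !ipE /IC -ICJ; last exact: cbdd_wform.
by apply: IC_eq => s _; rewrite wformC.
Qed.

Lemma ip_diag p : ip p p = (I (fun s => complex.Re (wform (psi s) s p p)))%:C.
Proof. by rewrite ipE -[RHS]IC_real; apply: IC_eq => s _; exact: wform_diag. Qed.

Lemma cont_eval p : continuous (fun s : R => complex.Re p.[s%:C]) /\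
  continuous (fun s : R => complex.Im p.[s%:C]).
Proof.
elim/poly_ind: p => [|p c [hr hi]].
  by split=> s; under eq_fun do rewrite horner0; exact: cvg_cst.
split=> s; under eq_fun do rewrite hornerMXaddC mulrC !ReImE.
  apply: cvgD; last exact: cvg_cst.
  by apply: cvgM; [exact: cvg_id|exact: hr].
apply: cvgD; last exact: cvg_cst.
by apply: cvgM; [exact: cvg_id|exact: hi].
Qed.

(** If <p, p> = 0 then |ev|^2 - |od|^2 vanishes in L^2(nu) by [wform_sep], hence
by continuity on S, and p = 0 because S is infinite. *)
Lemma ip_gt0 p : p != 0 -> 0 < complex.Re (ip p p).
Proof.
apply: contraNT; rewrite -leNgt ip_diag /= => le0; apply/eqP.
pose h s := sqn (ev s p) - sqn (od s p).
have [bev [C1 hC1]] := cbdd_sqn (cbdd_ev p).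
have [bod [C2 hC2]] := cbdd_sqn (cbdd_od p).
have bh : bddon Z (fun s => h s ^+ 2).
  by apply: bddonX; apply: bddonB; apply: cbdd_sqn; [exact: cbdd_ev|exact: cbdd_od].
have [bw _] := cbdd_wform p p.
pose C := 4 * `|C1| + 6 * `|C2|.
have C0 : 0 <= C by rewrite addr_ge0// mulr_ge0.
have Ih : I (fun s => h s ^+ 2) <= 0.
  apply: (@le_trans _ _ (I (fun s => C * complex.Re (wform (psi s) s p p)))).
    apply: Int_le => //; first exact: bddonZ.
    move=> s Zs; apply: le_trans (wform_sep s p (psi_le1 s)) _.
    rewrite mulrC ler_wpM2r//; first exact: wform_ge0.
    have := hC1 s Zs; have := hC2 s Zs.
    rewrite !ger0_norm ?sqn_ge0// => h2 h1.
    by have := ler_norm C1; have := ler_norm C2; rewrite /C; lra.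
  by rewrite /I IntZ// mulr_ge0_le0.
apply: (ev_od_roots infS) => s0 Ss0; apply/eqP; rewrite -subr_eq0 -/(h s0).
apply: contraT => h0.
have hc : continuous (fun s => h s ^+ 2).
  have sc q : continuous (fun s : R => sqn q.[s%:C]).
    by move=> s; have [cr ci] := cont_eval q; apply: cvgD; apply: cvgM;
       (try exact: cr); exact: ci.
  move=> s; apply: cvgM; apply: cvgB;
    by (under eq_fun do rewrite ?ev_poly ?od_poly); rewrite ?ev_poly ?od_poly; exact: sc.
pose d := h s0 ^+ 2 / 2.
have d0 : 0 < h s0 ^+ 2 by rewrite lt_neqAle sqr_ge0 eq_sym sqrf_eq0 h0.
pose U : set borelR := [set s | d < h s ^+ 2].
have oU : open (U : set R).
  by rewrite (_ : U = (fun s => h s ^+ 2) @^-1` [set x | d < x])//;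
     apply: open_comp => //; exact: open_gt.
have mU : measurable U by exact: open_measurable.
have Us0 : U s0 by rewrite /U/= /d; lra.
have := suppS Ss0 oU Us0.
have : I (fun s => d * \1_U s) <= I (fun s => h s ^+ 2).
  apply: Int_le => //; first by apply: bddonZ; exact: bddon_indic.
  move=> s _; rewrite indicE; case: (boolP (s \in U)) => [/set_mem /ltW|_].
    by rewrite mulr1.
  by rewrite mulr0 sqr_ge0.
rewrite /I IntZ//; last exact: bddon_indic.
rewrite Int_indic// => h1 h2; have : 0 < d * fine (nu (U `&` Z)).
  by rewrite mulr_gt0// /d divr_gt0.
by rewrite /I in Ih; lra.
Qed.

Lemma ip_Tpoly_sym p q : ip (Tpoly p) q = ip (Tpoly q) p.
Proof. by rewrite !ipE; apply: IC_eq => s _; rewrite wform_Tpoly_sym. Qed.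

Lemma ip_linl c p p' q : ip (c *: p + p') q = c * ip p q + ip p' q.
Proof. exact: Phi_linl cbdd_one. Qed.

Lemma ip_Zl c p q : ip (c *: p) q = c * ip p q.
Proof. by rewrite -[c *: p]addr0 ip_linl [ip 0 q](Phi_0l _ cbdd_one) addr0. Qed.

Lemma ip_Zr c p q : ip q (c *: p) = c^*%C * ip q p.
Proof. by rewrite ipC ip_Zl conjcM -ipC. Qed.

(** The Lanczos recursion T e_n = a_n e_{n+1} + (b_n)^* e_n + a_{n-1} e_{n-1}.
Antilinearity of T leaves the phase of each e_n to choice; dividing by the norm
of the residue makes a_n positive. A state holds a_{n-1}, e_{n-1} and e_n, where
a_{-1} = 0 and e_{-1} = 0. *)
Definition residue (t : R * {poly R[i]} * {poly R[i]}) :=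
  Tpoly t.2 + - ip (Tpoly t.2) t.2 *: t.2 + - t.1.1%:C *: t.1.2.
Definition nextw t := Num.sqrt (complex.Re (ip (residue t) (residue t))).
Definition lanczos n : R * {poly R[i]} * {poly R[i]} :=
  iter n (fun t => (nextw t, t.2, (nextw t)^-1%:C *: residue t)) (0, 0, 1).

Definition ap n := (lanczos n).1.1.
Definition em n := (lanczos n).1.2.
Definition e_ n := (lanczos n).2.
Definition a_ n := nextw (lanczos n).
Definition b_ n := (ip (Tpoly (e_ n)) (e_ n))^*%C.

Lemma apS n : ap n.+1 = a_ n. Proof. by []. Qed.
Lemma emS n : em n.+1 = e_ n. Proof. by []. Qed.
Lemma eS n : e_ n.+1 = (a_ n)^-1%:C *: residue (lanczos n). Proof. by []. Qed.

Lemma size_Tpoly p : p != 0 -> size (Tpoly p) = (size p).+1.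
Proof.
by move=> p0; rewrite /Tpoly mulrC size_mulX ?size_map_poly// map_poly_eq0.
Qed.

Lemma size_e n : [/\ size (e_ n) = n.+1, (size (em n) <= n)%N, 0 < a_ n &
  size (residue (lanczos n)) = n.+2].
Proof.
suff H m : size (e_ m) = m.+1 -> (size (em m) <= m)%N ->
    0 < a_ m /\ size (residue (lanczos m)) = m.+2.
  have {}H m : size (e_ m) = m.+1 -> (size (em m) <= m)%N ->
      [/\ size (e_ m) = m.+1, (size (em m) <= m)%N, 0 < a_ m &
          size (residue (lanczos m)) = m.+2].
    by move=> h1 h2; have [h3 h4] := H m h1 h2.
  elim: n => [|n [h1 h2 h3 h4]]; apply: H; rewrite ?emS ?h1 ?size_poly1 ?size_poly0//.
  rewrite eS size_scale ?h4// -(rmorph0 (real_complex R)).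
  by apply/eqP => /(@complexI R)/eqP; rewrite invr_eq0 gt_eqF.
move=> h1 h2.
have e0 : e_ m != 0 by rewrite -size_poly_eq0 h1.
have sz : size (residue (lanczos m)) = m.+2.
  rewrite /residue -addrA size_polyDl size_Tpoly ?h1//.
  rewrite ltnS; apply: leq_trans (size_polyD _ _) _; rewrite geq_max.
  rewrite (leq_trans (size_scale_leq _ _)) ?h1//=.
  by rewrite (leq_trans (size_scale_leq _ _))// (leq_trans h2).
split => //; rewrite sqrtr_gt0; apply: ip_gt0.
by rewrite -size_poly_eq0 sz.
Qed.

Lemma a_gt0 n : 0 < a_ n. Proof. by have [] := size_e n. Qed.

Lemma a_neq0 n : (a_ n)%:C != 0.
Proof. by rewrite eq_complex /= negb_and gt_eqF ?a_gt0. Qed.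

Lemma e_rec n : Tpoly (e_ n) =
  (a_ n)%:C *: e_ n.+1 + ((b_ n)^*%C *: e_ n + (ap n)%:C *: em n).
Proof.
rewrite eS scalerA.
have -> : (a_ n)%:C * (a_ n)^-1%:C = 1.
  by rewrite -realCM mulfV// gt_eqF// a_gt0.
rewrite scale1r /residue /b_ conjcK -/(e_ n) -/(ap n) -/(em n) !scaleNr.
by rewrite -!addrA addrCA [X in _ = _ + X]addrCA; ring.
Qed.

Lemma ev_e0 s : ev s (e_ 0) = 1.
Proof. by rewrite /ev /e_ /= !hornerC; field. Qed.

Lemma od_e0 s : od s (e_ 0) = 0.
Proof. by rewrite /od /e_ /= !hornerC subrr mul0r. Qed.

Lemma ip00 : ip (e_ 0) (e_ 0) = 1.
Proof.
rewrite ip_diag; have -> : (fun s => complex.Re (wform (psi s) s (e_ 0) (e_ 0))) =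
    (fun=> 1).
  apply/funext => s.
  by rewrite wform_sqn ev_e0 od_e0 mulr0 addr0 sqn0 mulr0 addr0 /sqn /=; ring.
by rewrite /I Int_cst// mul1r nuZ1.
Qed.

Lemma ip_rec n q : ip (Tpoly (e_ n)) q =
  (a_ n)%:C * ip (e_ n.+1) q + ((b_ n)^*%C * ip (e_ n) q +
  (ap n)%:C * ip (em n) q).
Proof.
by rewrite e_rec (ip_linl _ (e_ n.+1)) (ip_linl _ (e_ n)) (ip_Zl _ (em n)).
Qed.

(** Orthogonality to e_j for j + 1 < n comes for free: T is symmetric and
T e_j lies in the span of e_0, ..., e_{j+1}. *)
Lemma e_ortho i j : ip (e_ i) (e_ j) = (i == j)%:R.
Proof.
suff H n : forall i j, (i <= n)%N -> (j <= n)%N -> ip (e_ i) (e_ j) = (i == j)%:R.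
  by apply: (H (maxn i j)); rewrite ?leq_maxl ?leq_maxr.
elim: n => {i j} [|n IH] i j.
  by rewrite !leqn0 => /eqP -> /eqP ->; rewrite ip00.
have em_e m k : (m <= n)%N -> (k <= n)%N ->
    (ap m)%:C * ip (em m) (e_ k) = if m == k.+1 then (a_ k)%:C else 0.
  case: m => [|m] mn kn; first by rewrite !mul0r.
  rewrite emS apS IH// ?eqSS; last exact: ltnW.
  by case: eqP => [->|_]; rewrite ?mulr1 ?mulr0.
have key k : (k <= n)%N -> ip (e_ n.+1) (e_ k) = 0.
  move=> kn; apply: (mulfI (a_neq0 n)); rewrite mulr0.
  have -> : (a_ n)%:C * ip (e_ n.+1) (e_ k) = ip (Tpoly (e_ n)) (e_ k) -
      ((b_ n)^*%C * ip (e_ n) (e_ k) + (ap n)%:C * ip (em n) (e_ k)).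
    by rewrite ip_rec addrK.
  rewrite (IH n k)// em_e//; have [<-|nk] := eqVneq n k.
    by rewrite {1}/b_ conjcK ltn_eqF// mulr1 addr0 subrr.
  have {}kn' : (k < n)%N by rewrite ltn_neqAle eq_sym nk.
  rewrite mulr0 add0r ip_Tpoly_sym ip_rec (IH k n)// (ltn_eqF kn') mulr0 add0r.
  rewrite em_e// (ltn_eqF (leqW kn' : (k < n.+1)%N)) addr0 IH// eq_sym.
  by case: eqP => [_|_]; rewrite ?mulr1 ?mulr0 subrr.
have nn : ip (e_ n.+1) (e_ n.+1) = 1.
  rewrite eS ip_Zl ip_Zr conjc_real mulrA -realCM -expr2.
  rewrite [ip (residue _) _](_ : _ = ((a_ n) ^+ 2)%:C); last first.
    rewrite /a_ /nextw sqr_sqrtr; first by rewrite {1}ip_diag ip_diag.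
    have [_ _ _ sz] := size_e n; apply: ltW; apply: ip_gt0.
    by rewrite -size_poly_eq0 sz.
  by rewrite -realCM exprVn mulVf// expf_neq0// gt_eqF// a_gt0.
rewrite leq_eqVlt [(j <= _)%N]leq_eqVlt !ltnS.
move=> /orP[/eqP ->|ile] /orP[/eqP ->|jle]; first by rewrite nn eqxx.
- by rewrite key// gtn_eqF.
- by rewrite ipC key// conjc0 ltn_eqF.
- exact: IH.
Qed.

(** The matrix of multiplication by phi(s) in the basis e_n. *)
Definition symbol_mx phi j k := Phi phi (e_ k) (e_ j).

Lemma normp_sum N (x : nat -> R[i]) :
  let p := \sum_(k < N) x k *: e_ k in
  ip p p = (\sum_(k < N) sqn (x k))%:C.
Proof.
move=> p; rewrite /ip /p (Phi_suml _ _ _ _ cbdd_one) realC_sum.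
apply: eq_bigr => k _; rewrite (Phi_sumr _ _ _ _ cbdd_one).
rewrite (bigD1 k)//= big1 ?addr0; last first.
  move=> j jk; rewrite -/(ip _ _) e_ortho eq_sym.
  by rewrite (negbTE (jk : j != k :> nat)) mulr0.
by rewrite -/(ip _ _) e_ortho eqxx mulr1 sqnE.
Qed.

Lemma symbol_mx_form phi n N (x y : nat -> R[i]) : cbdd Z phi ->
  \sum_(j < n) \sum_(k < N) symbol_mx phi j k * x k * (y j)^*%C =
  Phi phi (\sum_(k < N) x k *: e_ k) (\sum_(j < n) y j *: e_ j).
Proof.
move=> hp; rewrite Phi_sumr//; apply: eq_bigr => j _.
rewrite Phi_suml// mulr_sumr; apply: eq_bigr => k _; rewrite /symbol_mx; ring.
Qed.

Lemma Phi_re_le phi p q d : cbdd Z phi -> 0 < d ->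
  (forall s, Z s -> sqn (phi s) <= d ^+ 2) ->
  complex.Re (Phi phi p q) <=
  d / 2 * (complex.Re (ip p p) + complex.Re (ip q q)).
Proof.
move=> hp d0 hd; rewrite !ipE /Phi !Re_IC.
have [bp _] := cbdd_wform p p; have [bq _] := cbdd_wform q q.
rewrite -IntD// -IntZ//; last exact: bddonD.
apply: Int_le => //; first exact: (proj1 (cbdd_Phi p q hp)).
  by apply: bddonZ; exact: bddonD.
by move=> s Zs; apply: Re_wform_le; rewrite ?hd.
Qed.

Lemma form_bounded_symbol_mx phi d : cbdd Z phi -> 0 < d ->
  (forall s, Z s -> sqn (phi s) <= d ^+ 2) -> form_bounded (d / 2) (symbol_mx phi).
Proof.
move=> hp d0 hd n N x y; rewrite symbol_mx_form//.
by apply: le_trans (Phi_re_le _ _ hp d0 hd) _; rewrite !normp_sum.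
Qed.

Lemma symbol_mx_adj phi j k : cbdd Z phi ->
  (symbol_mx phi k j)^*%C = symbol_mx (fun s => (phi s)^*%C) j k.
Proof.
move=> hp; rewrite /symbol_mx (PhiC _ _ hp) conjcK//.
Qed.

Lemma symbol_mx_lin c phi chi j k : cbdd Z phi -> cbdd Z chi ->
  symbol_mx (fun s => c * phi s + chi s) j k = c * symbol_mx phi j k + symbol_mx chi j k.
Proof. exact: Phi_lin_phi. Qed.

Lemma symbol_mx_1 j k : symbol_mx (fun=> 1) j k = (j == k)%:R.
Proof. by rewrite /symbol_mx -/(ip _ _) e_ortho eq_sym. Qed.

(** The e_n have all degrees, so they span the polynomials, and orthonormality
gives the coefficients. *)
Lemma span_e n p : (size p <= n)%N ->
  p = \sum_(i < n) ip p (e_ i) *: e_ i.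
Proof.
move=> sp; suff [c pE] : exists c : nat -> R[i], p = \sum_(i < n) c i *: e_ i.
  rewrite {1}pE; apply: eq_bigr => i _; congr (_ *: _).
  rewrite pE /ip (Phi_suml _ _ _ _ cbdd_one) (bigD1 i)//= big1 ?addr0.
    by rewrite -/(ip _ _) e_ortho eqxx mulr1.
  move=> j ji; rewrite -/(ip _ _) e_ortho.
  by rewrite (negbTE (ji : j != i :> nat)) mulr0.
elim: n p sp => [|n IH] p sp.
  exists (fun=> 0); rewrite big_ord0; apply/eqP.
  by rewrite -size_poly_eq0 -leqn0.
have [se _ _ _] := size_e n.
have ln : (e_ n)`_n != 0.
  have : lead_coef (e_ n) != 0 by rewrite lead_coef_eq0 -size_poly_eq0 se.
  by rewrite lead_coefE se.
pose d := p`_n / (e_ n)`_n.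
have [|c hc] := IH (p - d *: e_ n).
  apply/leq_sizeP => j; rewrite leq_eqVlt => /predU1P[<-|nj].
    by rewrite coefB coefZ divfK// subrr.
  rewrite coefB coefZ (nth_default _ (leq_trans sp nj)).
  by rewrite [(e_ n)`_j]nth_default ?se// mulr0 subr0.
exists (fun i => if i == n then d else c i).
rewrite big_ord_recr/= eqxx -[p in LHS](subrK (d *: e_ n)) hc; congr (_ + _).
by apply: eq_bigr => i _; rewrite ltn_eqF.
Qed.

(** A Bessel inequality, integrated from the pointwise one with coefficients
phi(s) and -x_i. *)
Lemma Bessel phi k n : cbdd Z phi ->
  \sum_(i < n) sqn (symbol_mx phi i k) <=
  complex.Re (Phi (fun s => (sqn (phi s))%:C) (e_ k) (e_ k)).
Proof.
move=> hp; pose x i := symbol_mx phi i k.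
pose q := \sum_(i < n) x i *: e_ i.
have cs : cbdd Z (fun s => (sqn (phi s))%:C) by apply: cbdd_real; exact: cbdd_sqn.
have qq : ip q q = (\sum_(i < n) sqn (x i))%:C by exact: normp_sum.
have pq : Phi phi (e_ k) q = (\sum_(i < n) sqn (x i))%:C.
  rewrite /q Phi_sumr// realC_sum; apply: eq_bigr => i _.
  by rewrite -/(symbol_mx _ _ _) -/(x i) mulrC sqnE.
have [bq _] := cbdd_wform q q; have [be _] := cbdd_Phi (e_ k) (e_ k) cs.
have [bpq _] := cbdd_Phi (e_ k) q hp.
have : 0 <= I (fun s => complex.Re ((sqn (phi s))%:C * wform (psi s) s (e_ k) (e_ k))
    + (complex.Re (wform (psi s) s q q) +
       (- 2) * complex.Re (phi s * wform (psi s) s (e_ k) q))).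
  apply: Int_ge0 => s _.
  have := wform_ge0 s (phi s *: e_ k + (-1) *: q) (psi_le1 s).
  rewrite wform_quad (wformC _ _ (e_ k) q) sqnE.
  have -> : (-1 : R[i])^*%C = -1 by apply: eqC => /=; rewrite ?oppr0.
  move: (wform _ _ _ _) (wform _ _ _ _) (wform _ _ _ _) (phi s) => v z t [u w].
  by rewrite !ReImE /= => h; apply: le_trans h _; rewrite le_eqVlt;
     apply/orP; left; apply/eqP; ring.
rewrite /I IntD//; last by apply: bddonD => //; exact: bddonZ.
rewrite IntD//; last exact: bddonZ.
rewrite IntZ//.
have -> : (\int[nu]_(s in Z) complex.Re (wform (psi s) s q q))%R =
    \sum_(i < n) sqn (x i) by rewrite -[RHS]/(complex.Re (_%:C)) -qq ipE.
have -> : (\int[nu]_(s in Z) complex.Re (phi s * wform (psi s) s (e_ k) q))%R =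
    \sum_(i < n) sqn (x i) by rewrite -[RHS]/(complex.Re (_%:C)) -pq.
by rewrite -[complex.Re (Phi _ _ _)]/(_%R) /Phi Re_IC; lra.
Qed.

Lemma Int_AMGM f g d : bddon Z f -> bddon Z g -> 0 < d ->
  I (fun s => f s ^+ 2) <= d ^+ 2 ->
  `|I (fun s => f s * g s)| <= d / 2 * (1 + I (fun s => g s ^+ 2)).
Proof.
move=> bf bg d0 hf.
have bff : bddon Z (fun s => d^-1 / 2 * f s ^+ 2) by apply: bddonZ; exact: bddonX.
have bgg : bddon Z (fun s => d / 2 * g s ^+ 2) by apply: bddonZ; exact: bddonX.
have bfg : bddon Z (fun s => f s * g s) by exact: bddonM.
have H : d^-1 / 2 * I (fun s => f s ^+ 2) + d / 2 * I (fun s => g s ^+ 2) <=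
    d / 2 * (1 + I (fun s => g s ^+ 2)).
  have : d^-1 / 2 * I (fun s => f s ^+ 2) <= d^-1 / 2 * d ^+ 2.
    by rewrite ler_wpM2l// divr_ge0// invr_ge0 ltW.
  have -> : d^-1 / 2 * d ^+ 2 = d / 2 by field; rewrite gt_eqF.
  by lra.
have dd : d^-1 * d = 1 by rewrite mulVf// gt_eqF.
have pt s : `|f s * g s| <= d^-1 / 2 * f s ^+ 2 + d / 2 * g s ^+ 2.
  have e1 : d^-1 * (f s - d * g s) ^+ 2 =
     d^-1 * f s ^+ 2 - 2 * (d^-1 * d) * f s * g s + (d^-1 * d) * d * g s ^+ 2.
    ring.
  have e2 : d^-1 * (f s + d * g s) ^+ 2 =
     d^-1 * f s ^+ 2 + 2 * (d^-1 * d) * f s * g s + (d^-1 * d) * d * g s ^+ 2.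
    ring.
  have h1 : 0 <= d^-1 * (f s - d * g s) ^+ 2.
    by rewrite mulr_ge0 ?sqr_ge0// invr_ge0 ltW.
  have h2 : 0 <= d^-1 * (f s + d * g s) ^+ 2.
    by rewrite mulr_ge0 ?sqr_ge0// invr_ge0 ltW.
  rewrite e1 dd in h1; rewrite e2 dd in h2.
  by rewrite ler_norml; apply/andP; split; lra.
apply: le_trans H; rewrite /I -!IntZ//; try exact: bddonX.
rewrite -IntD// ler_norml; apply/andP; split.
  rewrite -[X in X <= _]mulN1r -IntZ//; last exact: bddonD.
  apply: Int_le => //; first by apply: bddonZ; exact: bddonD.
  by move=> s _; have := pt s; rewrite ler_norml mulN1r => /andP[].
apply: Int_le => //; first exact: bddonD.
by move=> s _; have := pt s; rewrite ler_norml => /andP[].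
Qed.

Lemma ReIm_mul_le (z w : R[i]) d : 0 < d ->
  `|complex.Re (z * w)| <= (d * sqn z + d^-1 * sqn w) / 2 /\
  `|complex.Im (z * w)| <= (d * sqn z + d^-1 * sqn w) / 2.
Proof.
move=> d0.
have dd : d^-1 * d = 1 by rewrite mulVf// gt_eqF.
have E (x : R) : `|d * x| <= (sqn (d%:C * z) + sqn w) / 2 ->
    `|x| <= (d * sqn z + d^-1 * sqn w) / 2.
  rewrite sqnM sqnR normrM gtr0_norm// => h.
  have h' : d^-1 * (d * `|x|) <= d^-1 * ((d ^+ 2 * sqn z + sqn w) / 2).
    by rewrite ler_wpM2l// invr_ge0 ltW.
  rewrite mulrA dd mul1r in h'; apply: le_trans h' _; rewrite le_eqVlt.
  apply/orP; left; apply/eqP.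
  have -> : d^-1 * ((d ^+ 2 * sqn z + sqn w) / 2) =
    ((d^-1 * d) * d * sqn z + d^-1 * sqn w) / 2 by ring.
  by rewrite dd mul1r.
by split; apply: E; rewrite -?ReMr -?ImMr mulrA; [exact: Re_le_sqn|exact: Im_le_sqn].
Qed.

Lemma symbol_mx_evenp (r : {poly R}) i k :
  symbol_mx (fun s => (r.[s ^+ 2])%:C) i k = ip (evenp r * e_ k) (e_ i).
Proof.
by rewrite ipE /symbol_mx /Phi; apply: IC_eq => s _; rewrite wform_evenp.
Qed.

(** The matrix product of multiplication operators: exact at finite n when the
right factor is a polynomial in s ^+ 2, whose matrix is banded. *)
Lemma symbol_mx_mul_evenp phi (r : {poly R}) j k n : cbdd Z phi ->
  (size (evenp r * e_ k)%R <= n)%N ->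
  \sum_(i < n) symbol_mx phi j i * symbol_mx (fun s => (r.[s ^+ 2])%:C) i k =
  symbol_mx (fun s => phi s * (r.[s ^+ 2])%:C) j k.
Proof.
move=> hp sn; have /esym := span_e sn.
under eq_bigr do rewrite -symbol_mx_evenp; move=> E.
transitivity (Phi phi (evenp r * e_ k) (e_ j)).
  rewrite -E (Phi_suml n (fun i => symbol_mx (fun s => (r.[s ^+ 2])%:C) i k) e_ _ hp).
  by apply: eq_bigr => i _; rewrite /symbol_mx; ring.
by rewrite /symbol_mx /Phi; apply: IC_eq => s _; rewrite wform_evenp; ring.
Qed.

(** The matrix of a product is the product of the matrices. The sum is exact for
large n when g is a polynomial r in s ^+ 2. In general g = h + r with h small in
L^2(nu), and by the Bessel and Cauchy-Schwarz inequalities both h phi and the sum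
over the entries of h are at most e, uniformly in n. This is the one place
where the density of the even polynomials is needed: it says that the e_n are
complete in the model space. *)
Lemma Parseval phi (g : R -> R) j k : cbdd Z phi -> bddon Z g ->
  (fun n => \sum_(i < n) symbol_mx phi j i * symbol_mx (fun s => (g s)%:C) i k : (R[i])^o) @ \oo
  --> (symbol_mx (fun s => phi s * (g s)%:C) j k : (R[i])^o).
Proof.
move=> hp bg.
pose Bj := complex.Re (Phi (fun s => (sqn ((phi s)^*%C))%:C) (e_ j) (e_ j)).
have [[_ [W hW]] _] := cbdd_wform (e_ k) (e_ k).
pose v s := phi s * wform (psi s) s (e_ k) (e_ j).
have [bvr bvi] : cbdd Z v by exact: cbdd_Phi.
pose Vr := I (fun s => complex.Re (v s) ^+ 2).
pose Vi := I (fun s => complex.Im (v s) ^+ 2).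
have Vr0 : 0 <= Vr by apply: Int_ge0 => s _; exact: sqr_ge0.
have Vi0 : 0 <= Vi by apply: Int_ge0 => s _; exact: sqr_ge0.
have bess n : \sum_(i < n) sqn (symbol_mx phi j i) <= Bj.
  apply: le_trans (Bessel j n (cbddJ hp)); apply: ler_sum => i _.
  by rewrite -symbol_mx_adj// sqnJ.
have Bj0 : 0 <= Bj by have := bess 0%N; rewrite big_ord0.
pose C := (1 + Vr + Vi + Bj + `|W|) / 2.
have C0 : 0 < C by rewrite /C; have := normr_ge0 W; lra.
suff H e : 0 < e -> \forall n \near \oo, forall z : R[i],
    z = symbol_mx (fun s => phi s * (g s)%:C) j k -
        \sum_(i < n) symbol_mx phi j i * symbol_mx (fun s => (g s)%:C) i k ->
    `|complex.Re z| <= e /\ `|complex.Im z| <= e.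
  apply/cvgC; split; apply/cvgrPdist_le => e /H; apply: filterS => n /(_ _ erefl);
    by rewrite !ReImE => -[].
move=> e0; pose d := e / C; have d0 : 0 < d by rewrite divr_gt0.
have [r hr] := even_approx_bddon nu bg (exprn_gt0 2 d0).
pose h s := g s - r.[s ^+ 2].
have br : bddon Z (fun s => r.[s ^+ 2]) by exact: bddon_evenpoly.
have bh : bddon Z h by exact: bddonB.
exists (size (evenp r * e_ k)%R) => // n /= sn z ->.
have gE : (fun s => (g s)%:C) = (fun s => 1 * (h s)%:C + (r.[s ^+ 2])%:C).
  by apply/funext => s; rewrite mul1r /h -realCD subrK.
have E1 i : symbol_mx (fun s => (g s)%:C) i k = symbol_mx (fun s => (h s)%:C) i k +
    symbol_mx (fun s => (r.[s ^+ 2])%:C) i k.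
  by rewrite gE symbol_mx_lin ?mul1r//; exact: cbdd_real.
have E2 : symbol_mx (fun s => phi s * (g s)%:C) j k = symbol_mx (fun s => phi s * (h s)%:C) j k +
    symbol_mx (fun s => phi s * (r.[s ^+ 2])%:C) j k.
  rewrite -[X in _ = X + _]mul1r -symbol_mx_lin; try (apply: cbddM => //; exact: cbdd_real).
  congr (symbol_mx _ j k); apply/funext => s.
  by rewrite mul1r -mulrDr /h -realCD subrK.
have -> : symbol_mx (fun s => phi s * (g s)%:C) j k -
    \sum_(i < n) symbol_mx phi j i * symbol_mx (fun s => (g s)%:C) i k =
    symbol_mx (fun s => phi s * (h s)%:C) j k -
    \sum_(i < n) symbol_mx phi j i * symbol_mx (fun s => (h s)%:C) i k.
  under eq_bigr do rewrite E1 mulrDr.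
  rewrite big_split /= (symbol_mx_mul_evenp j hp sn) E2; ring.
have FE : symbol_mx (fun s => phi s * (h s)%:C) j k = IC (fun s => (h s)%:C * v s).
  by apply: IC_eq => s _; rewrite /v; ring.
have FR : `|complex.Re (symbol_mx (fun s => phi s * (h s)%:C) j k)| <= d / 2 * (1 + Vr).
  rewrite FE Re_IC (_ : (\int[nu]_(s in Z) _)%R = I (fun s => h s * complex.Re (v s))).
    exact: Int_AMGM.
  by apply: Int_eq => s _; rewrite ReMr.
have FI : `|complex.Im (symbol_mx (fun s => phi s * (h s)%:C) j k)| <= d / 2 * (1 + Vi).
  rewrite FE Im_IC (_ : (\int[nu]_(s in Z) _)%R = I (fun s => h s * complex.Im (v s))).
    exact: Int_AMGM.
  by apply: Int_eq => s _; rewrite ImMr.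
have chs : cbdd Z (fun s => (sqn (h s)%:C)%:C).
  by apply: cbdd_real; apply: cbdd_sqn; exact: cbdd_real.
have SH : \sum_(i < n) sqn (symbol_mx (fun s => (h s)%:C) i k) <= `|W| * d ^+ 2.
  apply: le_trans (Bessel k n (cbdd_real bh)) _; rewrite /Phi Re_IC.
  apply: (@le_trans _ _ (I (fun s => `|W| * h s ^+ 2))).
    apply: Int_le => //.
    - exact: (proj1 (cbdd_Phi _ _ chs)).
    - by apply: bddonZ; exact: bddonX.
    - move=> s Zs; rewrite sqnR ReMr mulrC ler_wpM2r ?sqr_ge0//.
      by apply: le_trans (le_trans (ler_norm _) (hW s Zs)) (ler_norm _).
  by rewrite /I IntZ//; [rewrite ler_wpM2l|exact: bddonX].
have SP := bess n.
have tot : (d * \sum_(i < n) sqn (symbol_mx phi j i) +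
    d^-1 * \sum_(i < n) sqn (symbol_mx (fun s => (h s)%:C) i k)) / 2 <= d / 2 * (Bj + `|W|).
  have h1 : d * \sum_(i < n) sqn (symbol_mx phi j i) <= d * Bj by rewrite ler_pM2l.
  have h2 : d^-1 * \sum_(i < n) sqn (symbol_mx (fun s => (h s)%:C) i k) <=
      d^-1 * (`|W| * d ^+ 2) by rewrite ler_wpM2l// invr_ge0 ltW.
  have h3 : d^-1 * (`|W| * d ^+ 2) = d * `|W| by field; rewrite gt_eqF.
  by lra.
have eE : e = d * C by rewrite /d divfK// gt_eqF.
have [SR SI] : `|complex.Re (\sum_(i < n) symbol_mx phi j i * symbol_mx (fun s => (h s)%:C) i k)|
    <= d / 2 * (Bj + `|W|) /\
    `|complex.Im (\sum_(i < n) symbol_mx phi j i * symbol_mx (fun s => (h s)%:C) i k)|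
    <= d / 2 * (Bj + `|W|).
  split; apply: le_trans tot; rewrite ?Re_sum ?Im_sum;
    apply: le_trans (ler_norm_sum _ _ _) _;
    rewrite !mulr_sumr -big_split /= mulr_suml; apply: ler_sum => i _;
    by have [h1 h2] := ReIm_mul_le (symbol_mx phi j i) (symbol_mx (fun s => (h s)%:C) i k) d0.
have dVr : 0 <= d * Vr by rewrite mulr_ge0// ltW.
have dVi : 0 <= d * Vi by rewrite mulr_ge0// ltW.
by rewrite !ReImE eE /C; split; apply: le_trans (ler_normB _ _) _; lra.
Qed.

Lemma ip_Tpoly p q : ip (Tpoly p) (Tpoly q) =
  Phi (fun s => ((s ^+ 2)%:C)) q p.
Proof.
by rewrite ipE /Phi; apply: IC_eq => s _; rewrite wform_Tpoly -wformC.
Qed.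

Lemma e_neq0 n : e_ n != 0.
Proof. by have [se _ _ _] := size_e n; rewrite -size_poly_eq0 se. Qed.

Lemma size_Tpoly_e n : size (Tpoly (e_ n)) = n.+2.
Proof. by have [se _ _ _] := size_e n; rewrite size_Tpoly ?e_neq0// se. Qed.

Lemma ip_TTpoly_sum j k : ip (Tpoly (e_ j)) (Tpoly (e_ k)) =
  \sum_(i < j.+2) ip (Tpoly (e_ j)) (e_ i) * (ip (Tpoly (e_ k)) (e_ i))^*%C.
Proof.
transitivity (ip (\sum_(i < j.+2) ip (Tpoly (e_ j)) (e_ i) *: e_ i) (Tpoly (e_ k))).
  by rewrite -span_e// size_Tpoly_e.
rewrite /ip (Phi_suml _ (fun i => ip (Tpoly (e_ j)) (e_ i)) e_ _ cbdd_one).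
by apply: eq_bigr => i _; rewrite -!/(ip _ _) (ipC (Tpoly (e_ k))).
Qed.

(** T is represented by the conjugate of the Jacobi matrix, in accordance with
T = C J. *)
Lemma jacobiE i k : ip (Tpoly (e_ k)) (e_ i) = (jacobi a_ b_ i k)^*%C.
Proof.
rewrite ip_rec !e_ortho /jacobi.
have -> : (ap k)%:C * ip (em k) (e_ i) = if k == i.+1 then (a_ i)%:C else 0.
  case: k => [|k]; first by rewrite mul0r.
  rewrite emS apS e_ortho eqSS.
  by case: eqP => [->|_]; rewrite ?mulr1 ?mulr0.
have [->|ki] := eqVneq k i.
  by rewrite gtn_eqF// mulr0 add0r mulr1 ltn_eqF// addr0.
rewrite mulr0 add0r [i == _]eq_sym.
have [->|ki'] := eqVneq k i.+1.
  by rewrite gtn_eqF// mulr0 add0r conjc_real.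
rewrite addr0; case: eqP => _; rewrite ?mulr1 ?mulr0 ?conjc_real ?conjc0//.
Qed.

(** The entries are coefficients of T e_n, whose norm is at most M since T^2 is
multiplication by s ^+ 2. *)
Lemma e_bound i n : (i < n.+2)%N ->
  sqn (ip (Tpoly (e_ n)) (e_ i)) <= M ^+ 2.
Proof.
move=> ni; apply: (@le_trans _ _ (complex.Re (ip (Tpoly (e_ n)) (Tpoly (e_ n))))).
  rewrite ip_TTpoly_sum; under eq_bigr do rewrite sqnE.
  rewrite -realC_sum (bigD1 (Ordinal ni))//= lerDl.
  by apply: sumr_ge0 => j _; exact: sqn_ge0.
have [bw _] := cbdd_wform (e_ n) (e_ n).
have bs : bddon Z (fun s => s ^+ 2) by apply: bddonX; exact: bddon_id.
rewrite ip_Tpoly /Phi Re_IC.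
apply: (@le_trans _ _ (I (fun s => M ^+ 2 *
    complex.Re (wform (psi s) s (e_ n) (e_ n))))).
  apply: Int_le => //; first exact: (proj1 (cbdd_Phi _ _ (cbdd_real bs))).
    exact: bddonZ.
  move=> s; rewrite in_0M => /andP[s0 sM]; rewrite ReMr ler_wpM2r ?wform_ge0//.
  by rewrite lerXn2r// nnegrE// (le_trans s0).
rewrite /I IntZ//.
have -> : (\int[nu]_(s in Z) complex.Re (wform (psi s) s (e_ n) (e_ n)))%R = 1.
  by have := e_ortho n n; rewrite ip_diag eqxx => /(congr1 (@complex.Re R)).
by rewrite mulr1.
Qed.

Lemma bounded_ab : bounded_jacobi a_ b_.
Proof.
exists (`|M| + `|M|) => j.
have nE (z : R[i]) : sqn z <= M ^+ 2 -> `|z| <= `|M|%:C.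
  by move=> h; rewrite normc_def lecR -sqrtr_sqr ler_wsqrtr.
rewrite realCD; apply: lerD; apply: nE.
  have := @e_bound j.+1 j (leqnn _); rewrite jacobiE /jacobi sqnJ.
  by rewrite ltn_eqF// ltn_eqF 1?ltnW// eqxx.
have := @e_bound j j (ltnW (leqnn _)).
by rewrite jacobiE /jacobi sqnJ eqxx.
Qed.

End Lanczos.



(** * Jacobi operators *)

Section JacobiOperators.
Variable R : realType.
Implicit Types (a : nat -> R) (b x : nat -> R[i]).

Lemma jacobi_opE a b x j : jacobi_op a b x j =
  (if j is j'.+1 then (a j')%:C * x j' else 0) + b j * x j + (a j)%:C * x j.+1.
Proof.
have d n : jacobi a b n n = b n by rewrite /jacobi eqxx.
have u n : jacobi a b n n.+1 = (a n)%:C by rewrite /jacobi gtn_eqF// eqxx.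
rewrite /jacobi_op !big_ord_recr/= d u; case: j => [|j]; first by rewrite big_ord0.
rewrite big_ord_recr/= big1 ?add0r.
  by rewrite {1}/jacobi ltn_eqF// ltn_eqF 1?ltnW// eqxx.
move=> i _; have ij := ltn_ord i.
rewrite /jacobi ltn_eqF 1?ltnW// ltn_eqF; last by rewrite ltnW// ltnW.
by rewrite eqSS gtn_eqF// mul0r.
Qed.

Lemma jacobi_op_lin a b c x y : jacobi_op a b (fun n => c * x n + y n) =
  fun n => c * jacobi_op a b x n + jacobi_op a b y n.
Proof.
apply/funext => n; rewrite /jacobi_op mulr_sumr -big_split /=.
by apply: eq_bigr => i _; ring.
Qed.

Lemma bounded_sqn a b : bounded_jacobi a b ->
  exists2 K : R, 0 <= K & forall j, sqn (a j)%:C <= K /\ sqn (b j) <= K.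
Proof.
move=> [K hK]; exists (K ^+ 2); first exact: sqr_ge0.
have H (z : R[i]) : `|z| <= K%:C -> sqn z <= K ^+ 2.
  rewrite normc_def lecR -/(sqn z) => h.
  by rewrite -(sqr_sqrtr (sqn_ge0 z)) lerXn2r ?nnegrE ?sqrtr_ge0// (le_trans _ h).
move=> j; split; apply: H; apply: le_trans (hK j); rewrite ?lerDl ?lerDr//.
Qed.

Lemma bop_jacobi a b : bounded_jacobi a b -> bounded_op (jacobi_op a b).
Proof.
move=> /bounded_sqn[K K0 hK].
have H x : l2 x -> l2 (jacobi_op a b x) /\ l2sq (jacobi_op a b x) <= 10 * K * l2sq x.
  move=> hx.
  pose u j := if j is j'.+1 then (a j')%:C * x j' else 0.
  pose v j := b j * x j; pose w j := (a j)%:C * x j.+1.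
  have -> : jacobi_op a b x = (fun n => (u n + v n) + w n).
    by apply/funext => j; rewrite jacobi_opE.
  have x0 := l2sq_ge0 hx.
  have [lv nv] : l2 v /\ l2sq v <= K * l2sq x.
    apply: l2_le => // j; rewrite sqnM ler_wpM2r ?sqn_ge0//.
    exact: (proj2 (hK j)).
  have hw n : \sum_(j < n) sqn (w j) <= K * l2sq x.
    apply: (@le_trans _ _ (K * \sum_(j < n.+1) sqn (x j))); last first.
      by rewrite ler_wpM2l// sum_le_l2sq.
    rewrite big_ord_recl mulrDr; apply: ler_wpDl; first by rewrite mulr_ge0 ?sqn_ge0.
    rewrite mulr_sumr; apply: ler_sum => i _; rewrite sqnM ler_wpM2r ?sqn_ge0//.
    exact: (proj1 (hK i)).
  have hu n : \sum_(j < n) sqn (u j) <= K * l2sq x.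
    case: n => [|n]; first by rewrite big_ord0 mulr_ge0.
    rewrite big_ord_recl /= sqn0 add0r.
    apply: (@le_trans _ _ (K * \sum_(j < n) sqn (x j))); last first.
      by rewrite ler_wpM2l// sum_le_l2sq.
    rewrite mulr_sumr; apply: ler_sum => i _; rewrite /= sqnM ler_wpM2r ?sqn_ge0//.
    exact: (proj1 (hK i)).
  have lu := l2_bound hu; have lw := l2_bound hw.
  have nu := l2sq_le hu; have nw := l2sq_le hw.
  have [luv nuv] := l2D_l2sq lu lv; have [luvw nuvw] := l2D_l2sq luv lw.
  by split => //; apply: le_trans nuvw _; lra.
apply: (@bop_build _ _ (10 * K)) => [x hx|c x y _ _|x hx].
- exact: (proj1 (H x hx)).
- exact: jacobi_op_lin.
- exact: (proj2 (H x hx)).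
Qed.

Lemma jacobi_delta a b j k : jacobi_op a b (delta R k) j = jacobi a b j k.
Proof.
rewrite /jacobi_op (sum_delta (jacobi a b j)); case: ltnP => // jk.
have h1 : (k == j) = false by rewrite gtn_eqF// ltnW.
have h2 : (k == j.+1) = false by rewrite gtn_eqF.
have h3 : (j == k.+1) = false by rewrite ltn_eqF// ltnS ltnW// ltnW.
by rewrite /jacobi h1 h2 h3.
Qed.

Definition conjs b : nat -> R[i] := fun j => (b j)^*%C.

Lemma jacobi_adj a b j k : jacobi a (conjs b) k j = (jacobi a b j k)^*%C.
Proof.
rewrite /jacobi eq_sym; case: (eqVneq k j) => [->//|kj].
case: (eqVneq j k.+1) => [->|jk].
  by rewrite ltn_eqF 1?ltnW// conjc_real.
by case: eqP => _; rewrite ?conjc_real ?conjc0.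
Qed.

Lemma bounded_conjs a b : bounded_jacobi a b -> bounded_jacobi a (conjs b).
Proof. by move=> [K hK]; exists K => j; rewrite normcJ. Qed.

(** A Jacobi matrix is complex symmetric, so that conjugating the diagonal gives
the adjoint. *)
Lemma adjoint_jacobi a b : bounded_jacobi a b ->
  is_adjoint (jacobi_op a b) (jacobi_op a (conjs b)).
Proof.
move=> hb; split; first exact/bop_jacobi/bounded_conjs.
apply: adjoint_entries; [exact/bop_jacobi/bounded_conjs|exact: bop_jacobi|].
by move=> j k; rewrite !jacobi_delta jacobi_adj.
Qed.

Lemma adjoint_unique (T S S' : (nat -> R[i]) -> nat -> R[i]) y : bounded_op T ->
  is_adjoint T S -> is_adjoint T S' -> l2 y -> S y = S' y.
Proof.
move=> hT [hS h] [hS' h'] hy; apply/funext => j; have dl := @l2_delta R.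
rewrite -(conjcK (S y j)) -(conjcK (S' y j)).
rewrite -(inner_deltal j (bop_l2 hS hy)) -(inner_deltal j (bop_l2 hS' hy)).
by rewrite -h// -h'.
Qed.

End JacobiOperators.

(** * From a symbol calculus to a spectral resolution *)

Section SpectralMeasure.
Variable R : realType.
Local Notation borelR := (measurableTypeR R).
Variables (E : set borelR -> (nat -> R[i]) -> nat -> R[i]) (x : nat -> R[i]).
Hypotheses (hE : is_pvm E) (hx : l2 x).

Lemma pvm_quad D : measurable D -> inner (E D x) x = (l2sq (E D x))%:C.
Proof.
move=> mD; have hD := bop_l2 (pvm_bounded hE mD) hx.
rewrite -{1}[D]setIid (pvm_setI hE mD mD hx).
by have [_ ->] := pvm_selfadjoint hE mD; rewrite ?inner_self.
Qed.

(* The maximum with 0 matters on non-measurable sets only. *)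
Definition pvm_measure (D : set borelR) : \bar R :=
  (Num.max 0 (complex.Re (inner (E D x) x)))%:E.

Lemma pvm_measureE D : measurable D -> pvm_measure D = (l2sq (E D x))%:E.
Proof.
move=> mD; rewrite /pvm_measure pvm_quad//= max_r// l2sq_ge0//.
exact: (bop_l2 (pvm_bounded hE mD)).
Qed.

Let pvm_measure0 : pvm_measure set0 = 0%E.
Proof.
by rewrite /pvm_measure (pvm_set0 hE hx) inner0l//= maxxx.
Qed.

Let pvm_measure_ge0 D : (0 <= pvm_measure D)%E.
Proof. by rewrite lee_fin le_max lexx. Qed.

Let pvm_measure_sigma_additive : semi_sigma_additive pvm_measure.
Proof.
move=> A mA tA mUA.
have /cvgC[hr _] := pvm_sigma_additive hE mA tA hx hx.
rewrite {2}/pvm_measure max_r; last first.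
  by rewrite pvm_quad//= l2sq_ge0//; exact: (bop_l2 (pvm_bounded hE mUA)).
have -> : (fun n => (\sum_(0 <= i < n) pvm_measure (A i))%E) =
  (fun n => (complex.Re (\sum_(k < n) inner (E (A k) x) x))%:E).
  apply/funext => n; rewrite big_mkord Re_sum -sumEFin; apply: eq_bigr => i _.
  by rewrite pvm_measureE// pvm_quad.
by apply: cvg_EFin hr; exact: nearW.
Qed.

HB.instance Definition _ := isMeasure.Build _ _ _
  pvm_measure pvm_measure0 pvm_measure_ge0 pvm_measure_sigma_additive.

Let pvm_measure_fin : fin_num_fun pvm_measure. Proof. by []. Qed.

HB.instance Definition _ := @Measure_isFinite.Build _ _ _
  pvm_measure pvm_measure_fin.

(** The spectral measure of the vector x. *)
Lemma pvm_measure_exists : exists mu : {finite_measure set borelR -> \bar R},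
  forall D, measurable D -> inner (E D x) x = (fine (mu D))%:C.
Proof.
exists pvm_measure => D mD; transitivity ((fine (pvm_measure D))%:C) => //.
by rewrite pvm_measureE// pvm_quad.
Qed.

End SpectralMeasure.

Lemma eq_le_eps (R : realType) (u v C : R) :
  (forall e, 0 < e -> `|u - v| <= C * e) -> u = v.
Proof.
move=> h; apply/eqP; rewrite -subr_eq0 -normr_eq0; apply: contraT => n0.
have d0 : 0 < `|u - v| by rewrite lt_neqAle eq_sym n0 normr_ge0.
have c0 : 0 < `|C| + 1 by rewrite ltr_pwDr.
have := h (`|u - v| / (`|C| + 1) / 2).
have e0 : 0 < `|u - v| / (`|C| + 1) / 2 by rewrite !divr_gt0.
move=> /(_ e0) h1.
set d := `|u - v| in d0 e0 h1 *; set e := d / (`|C| + 1) / 2 in e0 h1.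
have dE : d = 2 * (`|C| + 1) * e by rewrite /e; field; rewrite gt_eqF.
have : C * e <= `|C| * e by rewrite ler_wpM2r ?ler_norm// ltW.
have : 0 <= `|C| * e by rewrite mulr_ge0// ltW.
lra.
Qed.

(** A matrix-valued symbol calculus with the properties below is the functional
calculus of a projection-valued measure: the indicators give the projections,
and the operator of a symbol is its spectral integral. Separating this from the
model space keeps polynomials out of the operator theory. *)
Section MatrixSpectralFamily.
Variables (R : realType) (M : R).
Local Notation borelR := (measurableTypeR R).
Let Z : set borelR := `[0, M]%classic.
Variable F : (R -> R[i]) -> nat -> nat -> R[i].
Implicit Types (phi chi : R -> R[i]) (f g : R -> R) (x y : nat -> R[i]).
Hypothesis F_eq : forall phi chi, (forall s, Z s -> phi s = chi s) ->
  F phi = F chi.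
Hypothesis F_lin : forall c phi chi j k, cbdd Z phi -> cbdd Z chi ->
  F (fun s => c * phi s + chi s) j k = c * F phi j k + F chi j k.
Hypothesis F_adj : forall phi j k, cbdd Z phi ->
  (F phi k j)^*%C = F (fun s => (phi s)^*%C) j k.
Hypothesis F_1 : forall j k, F (fun=> 1) j k = (j == k)%:R.
Hypothesis F_mb : forall phi d, cbdd Z phi -> 0 < d ->
  (forall s, Z s -> sqn (phi s) <= d ^+ 2) -> form_bounded (d / 2) (F phi).
Hypothesis F_pos : forall g, bddon Z g -> (forall s, Z s -> 0 <= g s) ->
  forall N x, 0 <= \sum_(j < N) \sum_(k < N)
    F (fun s => (g s)%:C) j k * x k * (x j)^*%C.
Hypothesis F_mul : forall phi g j k, cbdd Z phi -> bddon Z g ->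
  (fun n => \sum_(i < n) F phi j i * F (fun s => (g s)%:C) i k : (R[i])^o) @ \oo
  --> (F (fun s => phi s * (g s)%:C) j k : (R[i])^o).
Hypothesis F_cvg : forall (g_ : nat -> R -> R) g j k,
  (forall n, bddon Z (g_ n)) -> bddon Z g ->
  (forall n s, Z s -> `|g_ n s| <= 1) ->
  (forall s, Z s -> g_ ^~ s @ \oo --> g s) ->
  (fun n => F (fun s => (g_ n s)%:C) j k : (R[i])^o) @ \oo -->
  (F (fun s => (g s)%:C) j k : (R[i])^o).

Definition symbol_op phi := matop (F phi).

Lemma F_form_bounded phi : cbdd Z phi -> exists2 K, 0 <= K & form_bounded K (F phi).
Proof.
move=> hp; have [_ [C hC]] := cbdd_sqn hp.
have c0 : 0 < 1 + `|C| by rewrite ltr_pwDl.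
exists ((1 + `|C|) / 2); first by rewrite divr_ge0// ltW.
apply: F_mb => // s Zs; have := hC s Zs; rewrite ger0_norm ?sqn_ge0// => h.
have := ler_norm C; have : 0 <= `|C| * `|C| by [].
by rewrite expr2; lra.
Qed.

Lemma bop_symbol_op phi : cbdd Z phi -> bounded_op (symbol_op phi).
Proof. by move=> /F_form_bounded[K K0 hK]; exact: bop_matop hK. Qed.

Lemma symbol_op_delta phi j k : cbdd Z phi -> symbol_op phi (delta R k) j = F phi j k.
Proof. by move=> /F_form_bounded[K K0 hK]; exact: matop_delta hK. Qed.

Lemma symbol_op_lin c phi chi x : cbdd Z phi -> cbdd Z chi -> l2 x ->
  symbol_op (fun s => c * phi s + chi s) x = fun n => c * symbol_op phi x n + symbol_op chi x n.
Proof.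
move=> hp hc hx; have hl : cbdd Z (fun s => c * phi s + chi s).
  by apply: cbddD => //; apply: cbddM => //; exact: cbdd_cst.
apply: (@bop_ext _ (symbol_op _) (fun x n => c * symbol_op phi x n + symbol_op chi x n)) => //.
- exact: bop_symbol_op.
- by apply: bop_lin; exact: bop_symbol_op.
- by move=> j k; rewrite !symbol_op_delta// F_lin.
Qed.

Lemma symbol_op_adj phi x y : cbdd Z phi -> l2 x -> l2 y ->
  inner (symbol_op phi x) y = inner x (symbol_op (fun s => (phi s)^*%C) y).
Proof.
move=> hp; apply: adjoint_entries; try exact: bop_symbol_op.
  by apply: bop_symbol_op; exact: cbddJ.
by move=> j k; rewrite !symbol_op_delta// ?F_adj//; exact: cbddJ.
Qed.

Lemma symbol_op_mul phi g x : cbdd Z phi -> bddon Z g -> l2 x ->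
  symbol_op phi (symbol_op (fun s => (g s)%:C) x) = symbol_op (fun s => phi s * (g s)%:C) x.
Proof.
move=> hp hg hx; have hg' := cbdd_real hg.
have [K K0 hK] := F_form_bounded hp; have [L L0 hL] := F_form_bounded hg'.
have [N N0 hN] := F_form_bounded (cbddM hp hg').
by apply: (matop_comp K0 L0 N0 hK hL hN) hx => j k; exact: F_mul.
Qed.

Lemma symbol_op_1 x : l2 x -> symbol_op (fun=> 1) x = x.
Proof.
move=> hx; have c1 := cbdd_cst M (1 : R[i]).
apply: (@bop_ext _ (symbol_op _) (fun x => x)) => //; first exact: bop_symbol_op.
  exact: bop_id.
by move=> j k; rewrite symbol_op_delta// F_1.
Qed.

Lemma symbol_op_eq phi chi : (forall s, Z s -> phi s = chi s) -> symbol_op phi = symbol_op chi.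
Proof. by move=> h; rewrite /symbol_op (F_eq h). Qed.

Lemma symbol_op_0 x : l2 x -> symbol_op (fun=> 0) x = fun=> 0.
Proof.
move=> hx; have c0 := cbdd_cst M (0 : R[i]).
have := symbol_op_lin (-1) c0 c0 hx.
have -> : (fun s : R => -1 * 0 + 0 : R[i]) = (fun=> 0).
  by apply/funext => s; rewrite mulr0 addr0.
by move=> {1}->; apply/funext => n; rewrite mulN1r addNr.
Qed.

Lemma symbol_op_ge0 g x : bddon Z g -> (forall s, Z s -> 0 <= g s) -> l2 x ->
  0 <= inner (symbol_op (fun s => (g s)%:C) x) x.
Proof.
move=> hg g0 hx; have [K K0 hK] := F_form_bounded (cbdd_real hg).
by apply: (matop_ge0 K0 hK) hx => N y; exact: F_pos.
Qed.

Lemma symbol_op_real g x : bddon Z g -> l2 x ->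
  complex.Im (inner (symbol_op (fun s => (g s)%:C) x) x) = 0.
Proof.
move=> hg hx; have hc := cbdd_real hg; have hO := bop_l2 (bop_symbol_op hc) hx.
have : inner (symbol_op (fun s => (g s)%:C) x) x =
    (inner (symbol_op (fun s => (g s)%:C) x) x)^*%C.
  rewrite -innerC// {1}symbol_op_adj//; congr (inner x (symbol_op _ x)).
  by apply/funext => s; rewrite conjc_real.
by move=> /(congr1 (@complex.Im R)); rewrite ImJ; lra.
Qed.

(** e - g and e + g are nonnegative symbols. *)
Lemma symbol_op_bound g x e : bddon Z g -> (forall s, Z s -> `|g s| <= e) -> l2 x ->
  `|complex.Re (inner (symbol_op (fun s => (g s)%:C) x) x)| <= l2sq x * e.
Proof.
move=> hg ge hx; have hc := cbdd_real hg; have hO := bop_l2 (bop_symbol_op hc) hx.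
have c1 := cbdd_cst M (1 : R[i]).
have H (c : R) : `|c| = 1 ->
    0 <= c * complex.Re (inner (symbol_op (fun s => (g s)%:C) x) x) + e * l2sq x.
  move=> c11; have he : cbdd Z (fun s => e%:C * 1 : R[i]).
    exact: (cbddM (cbdd_cst _ _) c1).
  have : 0 <= inner (symbol_op (fun s => (c * g s + e)%:C) x) x.
    apply: symbol_op_ge0 => //; first by apply: bddonD; [exact: bddonZ|exact: bddon_cst].
    move=> s /ge; rewrite -[`|g s|]mul1r -c11 -normrM ler_norml => /andP[h _].
    by lra.
  have -> : (fun s => (c * g s + e)%:C) = (fun s => c%:C * (g s)%:C + (fun=> e%:C) s).
    by apply/funext => s; rewrite realCD realCM.
  have hee := cbdd_cst M (e%:C : R[i]).
  rewrite symbol_op_lin// inner_lin//; last exact: (bop_l2 (bop_symbol_op hee)).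
  have -> : symbol_op (fun=> e%:C) x = fun n => e%:C * x n.
    have -> : (fun=> e%:C : R[i]) = (fun s : R => e%:C * 1 + 0).
      by apply/funext => s; rewrite mulr1 addr0.
    rewrite symbol_op_lin//; last exact: cbdd_cst.
    by rewrite symbol_op_1// symbol_op_0//; apply/funext => n; rewrite addr0.
  rewrite innerZl// inner_self// geC0 => /andP[+ _].
  by rewrite !ReImE /= mul0r subr0.
have h1 := H 1 (normr1 _); have h2 := H (-1) (normrN1 _).
rewrite mul1r in h1; rewrite mulN1r in h2.
by rewrite ler_norml; apply/andP; split; lra.
Qed.

Definition symbol_pvm (D : set borelR) := symbol_op (fun s => (\1_D s)%:C).

Lemma bddon1 (D : set borelR) : measurable D -> bddon Z (\1_D).
Proof. exact: bddon_indic. Qed.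

Lemma cbdd1 (D : set borelR) : measurable D -> cbdd Z (fun s => (\1_D s)%:C).
Proof. by move=> mD; apply: cbdd_real; exact: bddon1. Qed.

Lemma symbol_op_sum_inner (D_ : nat -> set borelR) n x y :
  (forall i, measurable (D_ i)) -> l2 x -> l2 y ->
  \sum_(k < n) inner (symbol_pvm (D_ k) x) y =
  inner (symbol_op (fun s => (\sum_(k < n) \1_(D_ k) s)%:C) x) y.
Proof.
move=> mD hx hy; elim: n => [|n IH].
  rewrite big_ord0 (_ : (fun _ => _) = (fun=> 0)) ?symbol_op_0 ?inner0l//.
  by apply/funext => s; rewrite big_ord0.
have bs : bddon Z (fun s => \sum_(k < n) \1_(D_ k) s).
  by apply: (@bddon_sum _ _ _ (fun k => \1_(D_ k))) => i; exact: bddon1.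
have -> : (fun s => (\sum_(k < n.+1) \1_(D_ k) s)%:C : R[i]) =
    (fun s => 1 * (\1_(D_ n) s)%:C + (\sum_(k < n) \1_(D_ k) s)%:C).
  by apply/funext => s; rewrite big_ord_recr/= mul1r realCD addrC.
have hs := cbdd_real bs; have h1 := cbdd1 (mD n).
rewrite symbol_op_lin// inner_lin//; [|exact: (bop_l2 (bop_symbol_op h1))|exact: (bop_l2 (bop_symbol_op hs))].
by rewrite big_ord_recr/= IH mul1r addrC.
Qed.

(** Countable additivity is weak convergence of the operators of the partial
sums of indicators, which are bounded by 1, so convergence of the entries is
enough. *)
Lemma symbol_pvm_pvm : is_pvm symbol_pvm.
Proof.
split=> [D mD|D mD|x hx|x hx|D D' mD mD' x hx|D_ mD tD x y hx hy].
- exact/bop_symbol_op/cbdd1.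
- split; first exact/bop_symbol_op/cbdd1.
  move=> x y hx hy; rewrite symbol_op_adj//; last exact: cbdd1.
  by congr (inner x (symbol_op _ y)); apply/funext => s; rewrite conjc_real.
- rewrite -(symbol_op_0 hx); congr (symbol_op _ x); apply/funext => s.
  by rewrite indicE in_set0.
- rewrite -[RHS](symbol_op_1 hx); congr (symbol_op _ x); apply/funext => s.
  by rewrite indicE in_setT.
- rewrite /symbol_pvm symbol_op_mul//; [|exact: cbdd1|exact: bddon1].
  by congr (symbol_op _ x); apply/funext => s; rewrite indicI/= realCM.
- have mU : measurable (\bigcup_k D_ k) by exact: bigcupT_measurable.
  under eq_fun do rewrite symbol_op_sum_inner//.
  have bs n : bddon Z (fun s => \sum_(k < n) \1_(D_ k) s).
    by apply: (@bddon_sum _ _ _ (fun k => \1_(D_ k))) => i; exact: bddon1.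
  have mb n : form_bounded (1 / 2) (F (fun s => (\sum_(k < n) \1_(D_ k) s)%:C)).
    apply: F_mb => //; first exact: cbdd_real.
    move=> s _; rewrite sqnR -real_normK ?num_real//.
    by rewrite lerXn2r ?nnegrE// sum_indic_le1.
  have h0 : (0 : R) <= 1 / 2 by rewrite divr_ge0.
  apply: (@bop_weak_cvg _ (2 * (1 / 2) * (2 * (1 / 2) + 1))
    (fun n => symbol_op (fun s => (\sum_(k < n) \1_(D_ k) s)%:C))) => //.
  + by move=> n; apply/bop_symbol_op/cbdd_real.
  + by move=> n z hz; exact: (proj2 (matop_l2sq h0 (mb n) hz)).
  + exact/bop_symbol_op/cbdd1.
  + move=> j k; rewrite /symbol_pvm symbol_op_delta; last exact: cbdd1.
    under eq_fun do rewrite (symbol_op_delta _ _ (cbdd_real (bs _))).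
    apply: F_cvg => //; first exact: bddon1.
      by move=> n s _; exact: sum_indic_le1.
    by move=> s _; exact: sum_indic_cvg.
Qed.

(** For real symbols both sides are approximated by step functions, on which
they agree by the definition of the measure; complex symbols are split into
real and imaginary part. *)
Lemma symbol_op_integral phi : cbdd Z phi -> is_op_integral symbol_pvm phi (symbol_op phi).
Proof.
move=> hp; split=> [|x hx]; first exact: bop_symbol_op.
have [mu hmu] := pvm_measure_exists symbol_pvm_pvm hx.
exists mu; have mZ : measurable Z by exact: measurable_0M.
have fmu D : measurable D -> fine (mu (D `&` Z)) = fine (mu D).
  move=> mD; apply: (@complexI R); rewrite -!hmu//; last exact: measurableI.
  congr (inner (_ x) x); apply: symbol_op_eq => s Zs; congr (_%:C).
  by rewrite indicI/= [X in _ * X]indicE mem_set// mulr1.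
have mu0 : mu (setT `\` Z) = 0%E.
  have mc : measurable (setT `\` Z) by exact: measurableD.
  rewrite -[LHS]fineK ?fin_num_measure// -(fmu _ mc).
  by rewrite setDE setTI setICl measure0.
have muZ : fine (mu Z) = l2sq x.
  rewrite -[Z]setTI (fmu _ measurableT); apply: (@complexI R).
  by rewrite -hmu// (pvm_setT symbol_pvm_pvm hx) inner_self.
have H g : bddon Z g -> mu.-integrable setT (EFin \o g) /\
    inner (symbol_op (fun s => (g s)%:C) x) x = ((\int[mu]_(s in setT) g s)%R)%:C.
  move=> bg; have [ig ->] := Int_setT mZ measurableT (@subsetT _ Z) mu0 bg.
  split => //; apply: eqC; last by rewrite symbol_op_real.
  apply: (@eq_le_eps _ _ _ (2 * l2sq x)) => e e0.
  have [N [c [D [mD h]]]] := step_approx bg e0.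
  pose h0 s := \sum_(i < N) c i * \1_(D i) s.
  have bi i : bddon Z (fun s => c i * \1_(D i) s) by apply: bddonZ; exact: bddon1.
  have bh0 : bddon Z h0 by exact: (bddon_sum N bi).
  have h1 := Int_step mu mZ bg mD h.
  rewrite muZ in h1.
  have h2 := symbol_op_bound (bddonB bg bh0) h hx.
  have E1 : inner (symbol_op (fun s => (h0 s)%:C) x) x =
      (\sum_(i < N) c i * fine (mu (D i `&` Z)))%:C.
    rewrite /h0 {bh0 h h1 h2 h0}; elim: N => [|N IH].
      rewrite (_ : (fun _ => _) = (fun=> 0)); last first.
        by apply/funext => s; rewrite big_ord0.
      by rewrite symbol_op_0// inner0l// big_ord0.
    have bs := bddon_sum N bi.
    rewrite (_ : (fun _ => _) = (fun s => (c N)%:C * (\1_(D N) s)%:C +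
        (\sum_(i < N) c i * \1_(D i) s)%:C)); last first.
      apply/funext => s; rewrite big_ord_recr/= realCD.
      by rewrite realCM addrC.
    have h1 := cbdd1 (mD N); have h2 := cbdd_real bs.
    rewrite symbol_op_lin// inner_lin//; [|exact: (bop_l2 (bop_symbol_op h1))|
      exact: (bop_l2 (bop_symbol_op h2))].
    rewrite IH big_ord_recr/= realCD realCM addrC.
    by rewrite (fmu _ (mD N)) -hmu.
  have E2 : inner (symbol_op (fun s => (g s)%:C) x) x =
      inner (symbol_op (fun s => (g s - h0 s)%:C) x) x + inner (symbol_op (fun s => (h0 s)%:C) x) x.
    have c1 := cbdd_real (bddonB bg bh0); have c2 := cbdd_real bh0.
    rewrite -[X in X + _]mul1r -inner_lin//; [|exact: (bop_l2 (bop_symbol_op c1))|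
      exact: (bop_l2 (bop_symbol_op c2))].
    rewrite -symbol_op_lin//; congr (inner (symbol_op _ x) x); apply/funext => s.
    by rewrite mul1r -realCD subrK.
  rewrite E2 E1 ReD /=.
  rewrite -/(h0 _) in h1 h2.
  have := ler_normD (complex.Re (inner (symbol_op (fun s => (g s - h0 s)%:C) x) x))
    (- (\int[mu]_(s in Z) g s - \sum_(i < N) c i * fine (mu (D i `&` Z)))).
  rewrite normrN opprB addrA => /le_trans; apply.
  rewrite [e * _]mulrC in h1; lra.
have [hr hi] := hp; have [ir Er] := H _ hr; have [ii Ei] := H _ hi.
split => //.
have -> : phi = (fun s => 'i%C * (complex.Im (phi s))%:C + (complex.Re (phi s))%:C).
  by apply/funext => s; rewrite addrC -complexE.
have cr := cbdd_real hr; have ci := cbdd_real hi.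
rewrite symbol_op_lin// inner_lin//; [|exact: (bop_l2 (bop_symbol_op ci))|exact: (bop_l2 (bop_symbol_op cr))].
rewrite Er Ei /cintegral.
apply: eqC; rewrite !ReImE /=.
  rewrite mul0r mulr0 subr0 add0r; congr (Rintegral mu setT _).
  by apply/funext => s /=; ring.
rewrite mulr0 mul1r add0r addr0; congr (Rintegral mu setT _).
by apply/funext => s /=; ring.
Qed.

Lemma symbol_op_fun phi : cbdd Z phi -> is_fun_of_op (symbol_op (fun s => s%:C)) phi (symbol_op phi).
Proof.
move=> hp; exists symbol_pvm; split; first exact: symbol_pvm_pvm.
  by apply: symbol_op_integral; apply: cbdd_real; exact: bddon_id.
exact: symbol_op_integral.
Qed.

End MatrixSpectralFamily.

(** * Surjectivity *)

Section Support.
Variable R : realType.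
Local Notation borelR := (measurableTypeR R).
Variable nu : {measure set borelR -> \bar R}.

(** The complement of the support is covered by the countably many intervals
with rational endpoints and measure zero. *)
Lemma negligible_msupportC : nu.-negligible (~` msupport nu).
Proof.
pose G (n : nat) : set borelR := if (unpickle n : option (rat * rat)) is Some (p, q)
  then (if nu (`]ratr p, ratr q[%classic : set borelR) == 0%E
        then `]ratr p, ratr q[%classic else set0) else set0.
have nG n : nu.-negligible (G n).
  rewrite /G; case: (unpickle n) => [[p q]|]; last exact: negligible_set0.
  case: eqP => [h|_]; last exact: negligible_set0.
  by exists `]ratr p, ratr q[%classic; split => //; exact: measurable_itv.
apply: negligibleS (negligible_bigcup nG) => s /existsNP[U /not_implyP[oU]].
move=> /not_implyP[Us /negP]; rewrite -leNgt => nuU0.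
have mU : measurable (U : set borelR) by exact: open_measurable.
have /nbhs_ballP[e /= e0 he] : nbhs s U by exact: open_nbhs_nbhs.
have [p /itvP hp] := @rat_in_itvoo R (s - e) s (ltac:(by rewrite gtrBl)).
have [q /itvP hq] := @rat_in_itvoo R s (s + e) (ltac:(by rewrite ltrDl)).
have sub : (`]ratr p, ratr q[%classic : set borelR) `<=` U.
  have hp1 : s - e < ratr p by rewrite hp.
  have hq1 : ratr q < s + e by rewrite hq.
  move=> t /=; rewrite in_itv/= => /andP[pt tq]; apply: he.
  by rewrite /ball/= ltr_norml; apply/andP; split; lra.
exists (pickle (p, q)); first exact: I.
rewrite /G pickleK.
have -> : nu (`]ratr p, ratr q[%classic : set borelR) = 0%E.
  apply/eqP; rewrite eq_le measure_ge0 andbT; apply: le_trans nuU0.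
  by apply: le_measure => //; rewrite inE//; exact: measurable_itv.
by rewrite eqxx /= in_itv/= hp hq.
Qed.

Lemma msupportC_null (Z : set borelR) : measurable Z -> msupport nu `<=` Z ->
  nu (~` Z) = 0%E.
Proof.
move=> mZ sZ; have [N [mN N0 hN]] := negligible_msupportC.
apply/eqP; rewrite eq_le measure_ge0 andbT -N0.
apply: le_measure; rewrite ?inE//; first exact: measurableC.
by apply: subset_trans hN; exact: subsetC.
Qed.

End Support.

Lemma continuous_ReIm (R : realType) (f : R -> (R[i])^o) : continuous f ->
  continuous (fun s => complex.Re (f s)) /\ continuous (fun s => complex.Im (f s)).
Proof.
move=> cf.
suff H (g : R[i] -> R) : (forall z, g z ^+ 2 <= sqn z) ->
    {morph g : x y / x - y} -> continuous (fun s => g (f s)).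
  by split; apply: H => [z|z w]; rewrite ?ReImE ?lerDl ?lerDr ?sqr_ge0.
move=> gle gB s; apply/cvgrPdist_lt => e e0.
have /cvgrPdist_lt/(_ e%:C) := cf s; rewrite ltcR => /(_ e0).
apply: filterS => t; rewrite normc_def ltcR; apply: le_lt_trans.
by rewrite -gB -sqrtr_sqr ler_wsqrtr// gle.
Qed.

Section Surjectivity.
Variable R : realType.
Local Notation borelR := (measurableTypeR R).
Variables (nu : probability borelR R) (psi0 : R -> R[i]).
Hypothesis supp0 : msupport nu `<=` `[0, +oo[.
Hypothesis suppb : bounded_set (msupport nu).
Hypothesis suppinf : infinite_set (msupport nu).
Hypothesis psiL : Linfty nu psi0.
Hypothesis psi_ae : {ae nu, forall s : R, 0 <= s -> `|psi0 s| <= 1}.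
Hypothesis psi00 : psi0 0 = 1.

Lemma supp_bound : exists M : R, msupport nu `<=` `[0, M].
Proof.
have [M [_ hM]] := suppb; exists (M + 1) => s hs.
have := supp0 hs; rewrite /= !in_itv/= andbT => -> /=.
by have := hM (M + 1) (ltac:(by rewrite ltrDl)) s hs; move/(le_trans (ler_norm _)).
Qed.

Lemma psi0_measurable : measurable_fun setT ((fun s => complex.Re (psi0 s)) : borelR -> borelR)
  /\ measurable_fun setT ((fun s => complex.Im (psi0 s)) : borelR -> borelR).
Proof.
by have [h1 h2] := psiL; split; [move: h1|move: h2];
   move=> /sub_Lfun_mfun; rewrite inE.
Qed.

(** The set of good points; setting the phase function to 0 elsewhere gives a
representative whose weight matrix is nonnegative at every point. *)
Definition unit_set : set borelR := [set s | sqn (psi0 s) <= 1].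
Definition psi s : R[i] := (\1_unit_set s)%:C * psi0 s.

Lemma unit_setM : measurable unit_set.
Proof.
have [mr mi] := psi0_measurable.
have ms : measurable_fun setT ((fun s => sqn (psi0 s)) : borelR -> borelR).
  by apply: measurable_funD; under eq_fun do rewrite expr2; exact: measurable_funM.
rewrite -[unit_set]setTI /unit_set.
have := ms measurableT `]-oo, 1]%classic (measurable_itv _).
by rewrite set_itvE.
Qed.

Lemma psi_le1 s : sqn (psi s) <= 1.
Proof.
rewrite /psi sqnM sqnR indicE; case: (boolP (s \in unit_set)) => [/set_mem|_].
  by rewrite expr1n mul1r.
by rewrite expr0n mul0r.
Qed.

Lemma psi_cbdd Z : cbdd Z psi.
Proof.
have [mr mi] := psi0_measurable; have mu := measurable_realfun.measurable_indic.
have b (f : R[i] -> R) : (forall z, f z ^+ 2 <= sqn z) ->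
    measurable_fun setT ((fun s => f (psi s)) : borelR -> borelR) ->
    bddon Z (fun s => f (psi s)).
  move=> fs mf; split => //; exists 1 => s _.
  have := le_trans (fs (psi s)) (psi_le1 s).
  by rewrite -(real_normK (num_real _)) expr_le1.
split; apply: b => [z|]; rewrite ?lerDl ?lerDr ?sqr_ge0//.
  under eq_fun do rewrite ReMr.
  by apply: measurable_funM => //; apply: mu; exact: unit_setM.
under eq_fun do rewrite ImMr.
by apply: measurable_funM => //; apply: mu; exact: unit_setM.
Qed.

Lemma psi_psi0 s : `|psi0 s| <= 1 -> psi s = psi0 s.
Proof.
rewrite normc_def -[1]/(1%:C) lecR => h; rewrite /psi indicE mem_set ?mul1r//.
by rewrite /unit_set/= -[leLHS]sqr_sqrtr ?sqn_ge0// expr_le1 ?sqrtr_ge0.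
Qed.

Section Model.
Variable M : R.
Hypothesis suppM : msupport nu `<=` `[0, M].
Let Z : set borelR := `[0, M]%classic.
Let mZ : measurable Z. Proof. exact: measurable_0M. Qed.

Let nuZC : nu (~` Z) = 0%E. Proof. exact: msupportC_null. Qed.

Let nuI (U : set borelR) : measurable U -> nu (U `&` Z) = nu U.
Proof.
move=> mU; have -> : nu U = (nu (U `&` Z) + nu (U `&` ~` Z))%E.
  rewrite -[in LHS](setIT U) -(setUv Z) setIUr; apply: measureU.
  - exact: measurableI.
  - by apply: measurableI => //; exact: measurableC.
  - by rewrite setIACA setICr setI0.
have -> : nu (U `&` ~` Z) = 0%E; last by rewrite adde0.
apply/eqP; rewrite eq_le measure_ge0 andbT -nuZC.
by apply: measureIr => //; exact: measurableC.
Qed.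

Let nuZ1 : fine (nu Z) = 1.
Proof. by rewrite -[Z]setTI nuI// probability_setT. Qed.

Let suppS s (U : set borelR) : msupport nu s -> open (U : set R) -> U s ->
  0 < fine (nu (U `&` Z)).
Proof.
move=> hs oU Us; have mU : measurable U by exact: open_measurable.
rewrite nuI// fine_gt0// hs//=.
by rewrite ltey_eq fin_num_measure.
Qed.

Local Notation e_ := (e_ M nu psi).
Local Notation a_ := (a_ M nu psi).
Local Notation b_ := (b_ M nu psi).
Local Notation F := (symbol_mx M nu psi).
Local Notation Phi := (Phi M nu psi).
Local Notation symbol_op := (symbol_op F).
Let cpsi := psi_cbdd Z.

Let F_eq (phi chi : R -> R[i]) : (forall s, Z s -> phi s = chi s) -> F phi = F chi.
Proof.
by move=> h; apply/funext => j; apply/funext => k; apply: IC_eq => s /h ->.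
Qed.

Let F_pos g : bddon Z g -> (forall s, Z s -> 0 <= g s) ->
  forall N (x : nat -> R[i]), 0 <= \sum_(j < N) \sum_(k < N)
    F (fun s => (g s)%:C) j k * x k * (x j)^*%C.
Proof.
move=> bg g0 N x.
rewrite (@symbol_mx_form R M nu psi cpsi (fun s => (g s)%:C) N N x x); last exact: cbdd_real.
set p := \sum_(k < N) _.
rewrite /Phi (_ : (fun s => _) = (fun s =>
    (g s * complex.Re (wform (psi s) s p p))%:C)); last first.
  by apply/funext => s; rewrite realCM -wform_diag.
rewrite IC_real lecR; apply: Int_ge0 => s Zs.
by rewrite mulr_ge0 ?g0// wform_ge0// psi_le1.
Qed.

Let F_cvg (g_ : nat -> R -> R) g j k :
  (forall n, bddon Z (g_ n)) -> bddon Z g ->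
  (forall n s, Z s -> `|g_ n s| <= 1) ->
  (forall s, Z s -> g_ ^~ s @ \oo --> g s) ->
  (fun n => F (fun s => (g_ n s)%:C) j k : (R[i])^o) @ \oo -->
  (F (fun s => (g s)%:C) j k : (R[i])^o).
Proof.
move=> bg_ bg h1 hc.
have [bwr bwi] := cbdd_wform cpsi (e_ k) (e_ j).
have H w : bddon Z w -> (fun n => (\int[nu]_(s in Z) (g_ n s * w s))%R) @ \oo -->
    ((\int[nu]_(s in Z) (g s * w s))%R : R).
  move=> bw; have [_ [C hC]] := bw.
  apply: (@Int_cvg _ _ _ mZ _ _ C).
  - by move=> n; exact: (proj1 (bddonM (bg_ n) bw)).
  - exact: (proj1 (bddonM bg bw)).
  - move=> n s Zs; rewrite normrM -[C]mul1r.
    by rewrite ler_pM// ?h1 ?hC.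
  - by move=> s Zs; apply: cvgM; [exact: hc|exact: cvg_cst].
apply/cvgC; rewrite /F /Phi; split; rewrite ?Re_IC ?Im_IC.
  have := H _ bwr.
  have E f : (\int[nu]_(s in Z) complex.Re ((f s)%:C * wform (psi s) s (e_ k) (e_ j)))%R
     = (\int[nu]_(s in Z) (f s * complex.Re (wform (psi s) s (e_ k) (e_ j))))%R.
    by apply: Int_eq => s _; rewrite ReMr.
  by rewrite E; apply: cvg_trans; apply: near_eq_cvg; apply: nearW => n; rewrite /= -E.
have := H _ bwi.
have E f : (\int[nu]_(s in Z) complex.Im ((f s)%:C * wform (psi s) s (e_ k) (e_ j)))%R
   = (\int[nu]_(s in Z) (f s * complex.Im (wform (psi s) s (e_ k) (e_ j))))%R.
  by apply: Int_eq => s _; rewrite ImMr.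
by rewrite E; apply: cvg_trans; apply: near_eq_cvg; apply: nearW => n; rewrite /= -E.
Qed.

Let F_lin := symbol_mx_lin nu cpsi.
Let F_adj := symbol_mx_adj nu cpsi.
Let F_1 := symbol_mx_1 cpsi psi_le1 nuZ1 suppinf suppS.
Let F_mb := form_bounded_symbol_mx cpsi psi_le1 nuZ1 suppinf suppS.
Let F_mul := Parseval cpsi psi_le1 nuZ1 suppinf suppS.

Let cid : cbdd Z (fun s => s%:C).
Proof. by apply: cbdd_real; exact: bddon_id. Qed.

Let symbol_op_fun' phi : cbdd Z phi -> is_fun_of_op (symbol_op (fun s => s%:C)) phi (symbol_op phi).
Proof. exact: (symbol_op_fun F_eq F_lin F_adj F_1 F_mb F_pos F_mul F_cvg). Qed.

Let jb := bounded_ab cpsi psi_le1 nuZ1 suppinf suppS.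

(** T^2 is multiplication by s ^+ 2 in the model, so J^* J is represented by
the symbol s ^+ 2, whose positive square root has the symbol s. *)
Lemma model_abs : is_abs (jacobi_op a_ b_) (symbol_op (fun s => s%:C)).
Proof.
have bA := bop_symbol_op F_mb cid.
split.
  split => // x hx; apply: (symbol_op_ge0 F_mb F_pos) hx; first exact: bddon_id.
  by move=> s; rewrite in_0M => /andP[].
have adj := adjoint_jacobi jb; exists (jacobi_op a_ (conjs b_)); split => // x hx.
apply: (@bop_ext _ (fun x => symbol_op (fun s => s%:C) (symbol_op (fun s => s%:C) x))
   (fun x => jacobi_op a_ (conjs b_) (jacobi_op a_ b_ x))) => //.
- exact: bop_comp.
- by apply: bop_comp; [exact: (proj1 adj)|exact: bop_jacobi].
move=> j k; have bi := bddon_id M.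
have -> : symbol_op (fun s => s%:C) (symbol_op (fun s => s%:C) (delta R k)) j =
    Phi (fun s => (s ^+ 2)%:C) (e_ k) (e_ j).
  rewrite (symbol_op_mul F_mb F_mul cid bi (l2_delta k)).
  rewrite (symbol_op_delta F_mb); last exact: (cbddM cid cid).
  by apply: IC_eq => s _; rewrite expr2 realCM.
rewrite -ip_Tpoly// (ip_TTpoly_sum cpsi psi_le1 nuZ1 suppinf suppS) {1}/jacobi_op.
apply: eq_bigr => i _; rewrite jacobi_delta jacobi_adj.
by rewrite !(jacobiE cpsi psi_le1 nuZ1 suppinf suppS) conjcK.
Qed.

(** The vector delta_0 is the constant polynomial e_0, with even part 1 and odd
part 0, so its weight is 1 and its spectral measure is nu. The first row of J is
the expansion of T e_0, with even part 0 and odd part s, and the off-diagonal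
weight pairs it with f e_0 to give s f(s) psi(s). *)
Lemma model_spectral_data : spectral_data a_ b_ nu psi0.
Proof.
have mD0 : measurable (`[0, +oo[%classic : set borelR) by exact: measurable_itv.
exists (symbol_op (fun s => s%:C)); split; first exact: model_abs.
- move=> D mD; have cD : cbdd Z (fun s => (\1_D s)%:C).
    by apply: cbdd_real; exact: bddon_indic.
  exists (symbol_op (fun s => (\1_D s)%:C)); split; first exact: symbol_op_fun'.
  rewrite inner_delta; last exact: (bop_l2 (bop_symbol_op F_mb cD) (l2_delta 0)).
  rewrite (symbol_op_delta F_mb)// /F /Phi -(nuI mD) -(Int_indic nu mZ mD) -IC_real.
  apply: IC_eq => s _; rewrite wform_sqn ev_e0 od_e0.
  by rewrite mulr0 addr0 sqn0 mulr0 addr0 /sqn /= expr1n expr0n addr0 mulr1.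
split => // f cf.
have cff : cbdd Z f.
  have K : compact (`[0, M] : set R) by exact: segment_compact.
  have B (g : R -> R) : continuous g -> bddon Z g.
    move=> cg; split; first exact: continuous_measurable_fun.
    have [C [_ hC]] := compact_bounded (continuous_compact
       (continuous_subspaceT cg) K).
    exists (C + 1) => s Zs; apply: (hC (C + 1)); first by rewrite ltrDl.
    by exists s.
  by have [cr ci] := continuous_ReIm cf; split; exact: B.
exists (symbol_op f); split; first exact: symbol_op_fun'.
have hO := bop_l2 (bop_symbol_op F_mb cff) (l2_delta 0).
have hJ := bop_l2 (bop_jacobi jb) hO.
rewrite inner_delta// jacobi_opE add0r !(symbol_op_delta F_mb)// /F.
transitivity (Phi f (e_ 0) (Tpoly (e_ 0))).
  rewrite (e_rec cpsi psi_le1 suppinf suppS) (Phi_linr nu cpsi)//.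
  have -> : (ap M nu psi 0)%:C *: em M nu psi 0 = 0 by rewrite scale0r.
  rewrite (Phi_linr nu cpsi)// (Phi_0r nu cpsi)// addr0 conjcK conjc_real.
  by rewrite addrC.
have cg : cbdd Z (fun s => s%:C * f s * psi s) by do 2 apply: cbddM => //.
transitivity (cintegral nu Z (fun s => s%:C * f s * psi s)).
  apply: IC_eq => s _; rewrite /wform ev_Tpoly od_Tpoly ev_e0 od_e0.
  by rewrite !(conjcM, conjc0, conjc1, conjc_real); ring.
have sub : Z `<=` `[0, +oo[ by move=> s; rewrite /Z /= !in_itv/= andbT => /andP[].
have nD : nu (`[0, +oo[ `\` Z) = 0%E.
  apply/eqP; rewrite eq_le measure_ge0 andbT -nuZC; apply: le_measure.
  - by rewrite inE; exact: measurableD.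
  - by rewrite inE; exact: measurableC.
  - by move=> s [_].
have [mr mi] := psi0_measurable.
have [fmr fmi] : measurable_fun setT ((fun s => complex.Re (f s)) : borelR -> borelR)
    /\ measurable_fun setT ((fun s => complex.Im (f s)) : borelR -> borelR).
  by split; [exact: (proj1 (proj1 cff))|exact: (proj1 (proj2 cff))].
have E (g : R[i] -> R) : bddon Z (fun s => g (s%:C * f s * psi s)) ->
    measurable_fun setT ((fun s => g (s%:C * f s * psi0 s)) : borelR -> borelR) ->
    (\int[nu]_(s in Z) g (s%:C * f s * psi s))%R =
    (\int[nu]_(s in `[0, +oo[) g (s%:C * f s * psi0 s))%R.
  move=> bg mg; have [_ <-] := Int_setT mZ mD0 sub nD bg.
  rewrite /Rintegral; congr fine; apply: ae_eq_integral => //.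
  - by apply/measurable_EFinP; exact: measurable_funS (proj1 bg).
  - by apply/measurable_EFinP; exact: measurable_funS mg.
  have [N [mN N0 hN]] := psi_ae; exists N; split => // s /= hs.
  apply: hN => /= h; apply: hs; rewrite /= in_itv/= andbT => s0.
  by rewrite psi_psi0// h.
have [bgr bgi] := cg.
apply: eqC; rewrite /cintegral /=; apply: E => //.
  under eq_fun do rewrite -mulrA ReMr ReM.
  apply: measurable_funM => //; apply: measurable_funB; exact: measurable_funM.
under eq_fun do rewrite -mulrA ImMr ImM.
apply: measurable_funM => //; apply: measurable_funD; exact: measurable_funM.
Qed.

Lemma model_surjective : exists (a : nat -> R) (b : nat -> R[i]),
  [/\ forall j, 0 < a j, bounded_jacobi a b & spectral_data a b nu psi0].
Proof.
exists a_, b_; split; [|exact: jb|exact: model_spectral_data].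
exact: (a_gt0 cpsi psi_le1 suppinf suppS).
Qed.

End Model.

Lemma surjectivity : exists (a : nat -> R) (b : nat -> R[i]),
  [/\ forall j, 0 < a j, bounded_jacobi a b & spectral_data a b nu psi0].
Proof. by have [M suppM] := supp_bound; exact: model_surjective suppM. Qed.

End Surjectivity.

(** * Powers of an operator through its resolution *)

Lemma realCB (R : realType) (c d : R) : (c - d)%:C = c%:C - d%:C :> R[i].
Proof. exact: (rmorphB (real_complex R)). Qed.

(** For a resolution E of the positive operator A, known only through quadratic
forms, the operator with the symbol s ^+ n is A^n, for every n. Since the
function of an operator is defined by an arbitrary resolution, this replaces
the uniqueness of the resolution in the uniqueness proof. *)
Section SpectralResolution.
Variable R : realType.
Local Notation borelR := (measurableTypeR R).
Implicit Types (x y z : nat -> R[i]) (D : set borelR) (f g : R -> R).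

Lemma pos_integral_null (m : {finite_measure set borelR -> \bar R}) D f :
  measurable D -> m.-integrable setT (EFin \o f) -> (forall s, D s -> 0 < f s) ->
  m (~` D) = 0%E -> (\int[m]_(s in setT) f s)%R <= 0 -> m D = 0%E.
Proof.
move=> mD intf fpos mC le0.
have mDC := measurableC mD.
have iD : m.-integrable D (EFin \o f) by apply: integrableS intf.
have E : (\int[m]_(s in setT) (f s)%:E)%E = (\int[m]_(s in D) (f s)%:E)%E.
  rewrite (negligible_integral mDC measurableT intf mC).
  by rewrite setTD setCK.
have I0 : (\int[m]_(s in D) `|(f s)%:E|)%E = 0%E.
  have -> : (\int[m]_(s in D) `|(f s)%:E|)%E = (\int[m]_(s in D) (f s)%:E)%E.
    by apply: eq_integral => s /set_mem /fpos s0; rewrite gee0_abs// lee_fin ltW.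
  apply/eqP; rewrite eq_le; apply/andP; split; last first.
    by apply: integral_ge0 => s /fpos s0; rewrite lee_fin ltW.
  rewrite -E; move: le0; rewrite /Rintegral -lee_fin fineK//.
  exact: integrable_fin_num.
have mf := measurable_int m iD.
have /(_ I0) [N [mN N0 hN]] := proj1 (ae_eq_integral_abs m mD mf).
apply/eqP; rewrite eq_le measure_ge0 andbT -N0; apply: le_measure; rewrite ?inE//.
move=> s Ds; apply: hN => /= /(_ Ds) => /eqP.
by rewrite eqe gt_eqF// fpos.
Qed.

Variable E : set borelR -> (nat -> R[i]) -> nat -> R[i].
Hypothesis hE : is_pvm E.

Definition smeas x (mu : {finite_measure set borelR -> \bar R}) :=
  forall D, measurable D -> inner (E D x) x = (fine (mu D))%:C.

Lemma smeas_total x mu : l2 x -> smeas x mu -> fine (mu setT) = l2sq x.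
Proof.
move=> hx hm; apply: (@complexI R); rewrite -(hm _ measurableT).
by rewrite (pvm_setT hE hx) inner_self.
Qed.

Lemma smeas_eq x mu mu' D : smeas x mu -> smeas x mu' -> measurable D -> mu D = mu' D.
Proof.
move=> h h' mD; rewrite -[LHS]fineK ?fin_num_measure// -[RHS]fineK ?fin_num_measure//.
by congr (_%:E); apply: (@complexI R); rewrite -h// -h'.
Qed.

Let lE D x : measurable D -> l2 x -> l2 (E D x).
Proof. by move=> mD; exact: (bop_l2 (pvm_bounded hE mD)). Qed.

Lemma pvm_inner D D' x : measurable D -> measurable D' -> l2 x ->
  inner (E D' (E D x)) (E D x) = inner (E (D' `&` D) x) x.
Proof.
move=> mD mD' hx; have [_ adj] := pvm_selfadjoint hE mD.
have mI := measurableI _ _ mD' mD.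
rewrite -(pvm_setI hE mD' mD hx) -adj//; last exact: lE.
by rewrite -(pvm_setI hE mD mI hx) setICA setIid.
Qed.

Lemma smeas_restrict D x mu mu' D' : measurable D -> measurable D' -> l2 x ->
  smeas x mu -> smeas (E D x) mu' -> fine (mu' D') = fine (mu (D' `&` D)).
Proof.
move=> mD mD' hx hm hm'; apply: (@complexI R).
rewrite -hm'// -hm ?pvm_inner//; exact: measurableI.
Qed.

Variable A : (nat -> R[i]) -> nat -> R[i].
Hypothesis hA : positive_op A.
Hypothesis hEA : is_op_integral E (fun s => s%:C) A.
Variable M : R.
Hypothesis A_le : forall x, l2 x -> complex.Re (inner (A x) x) <= M * l2sq x.
Let Z : set borelR := `[0, M]%classic.
Let mZ : measurable Z. Proof. exact: measurable_0M. Qed.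

Lemma pvm_null D x (f : R -> R) : measurable D -> l2 x ->
  (forall s, D s -> 0 < f s) ->
  (forall mu y, l2 y -> smeas y mu ->
    mu.-integrable setT (EFin \o (fun s : borelR => s : R)) ->
    inner (A y) y = ((\int[mu]_(s in setT) s)%R)%:C ->
    mu.-integrable setT (EFin \o f) /\ (\int[mu]_(s in setT) f s)%R <= 0) ->
  forall mu, smeas x mu -> mu D = 0%E.
Proof.
move=> mD hx fpos hf mu hmu; have hy := lE mD hx.
have [_ /(_ _ hy)[m [hm im _ Am]]] := hEA.
have rm : smeas (E D x) m by [].
have Am' : inner (A (E D x)) (E D x) = ((\int[m]_(s in setT) s)%R)%:C.
  rewrite Am /cintegral; apply: eqC => //=.
  by rewrite Rintegral_cst// mul0r.
have [intf le0] := hf m _ hy rm im Am'.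
have rD D' : measurable D' -> fine (m D') = fine (mu (D' `&` D)).
  by move=> mD'; exact: (smeas_restrict mD mD' hx hmu rm).
have mC : m (~` D) = 0%E.
  rewrite -[LHS]fineK ?fin_num_measure//; last exact: measurableC.
  by rewrite rD ?setICl ?measure0//; exact: measurableC.
have := pos_integral_null mD intf fpos mC le0.
move/(congr1 fine); rewrite rD// setIid => h.
by rewrite -[LHS]fineK ?fin_num_measure// h.
Qed.

(** The vector E D x with D = (M, oo) or D = (-oo, 0) has its spectral measure
in D, where the bounds on the form of A contradict a positive mass. *)
Lemma smeas_concentrated x mu : l2 x -> smeas x mu -> mu (setT `\` Z) = 0%E.
Proof.
move=> hx hmu.
pose U : set borelR := `]M, +oo[%classic; pose L : set borelR := `]-oo, 0[%classic.
have mU : measurable U by exact: measurable_itv.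
have mL : measurable L by exact: measurable_itv.
have hU : mu U = 0%E.
  apply: (pvm_null mU hx (f := fun s => s - M)) hmu => [s|m y hy hm im Am].
    by rewrite /U /= in_itv/= andbT subr_gt0.
  have ic : m.-integrable setT (EFin \o (fun=> M) : borelR -> \bar R).
    by apply: finite_measure_integrable_cst.
  split.
    rewrite (_ : _ \o _ = (EFin \o (fun s : borelR => s : R)) \- (EFin \o (fun=> M)))%E//.
    exact: integrableB.
  rewrite RintegralB// Rintegral_cst// (smeas_total hy hm) subr_le0.
  by have := A_le hy; rewrite Am.
have hL : mu L = 0%E.
  apply: (pvm_null mL hx (f := fun s => - s)) hmu => [s|m y hy hm im Am].
    by rewrite /L /= in_itv/= oppr_gt0.
  split.
    rewrite (_ : _ \o _ = (\- (EFin \o (fun s : borelR => s : R)))%E)//.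
    exact: integrableN.
  under eq_Rintegral do rewrite -mulN1r.
  rewrite RintegralZl// mulN1r oppr_le0.
  have [_ /(_ _ hy)] := hA; rewrite Am geC0 => /andP[+ _].
  by [].
have -> : setT `\` Z = L `|` U.
  apply/seteqP; split => s; rewrite /Z /L /U /= !in_itv/= andbT.
    move=> [_ /negP]; rewrite negb_and -!ltNge => /orP[]; by [left|right].
  by move=> [h|h]; split => //; apply/negP; rewrite negb_and -!ltNge h ?orbT.
apply/eqP; rewrite eq_le measure_ge0 andbT.
apply: (@le_trans _ _ (mu L + mu U)%E).
  exact: measureU2.
by rewrite hL hU adde0.
Qed.

Lemma smeas_Z x mu D : l2 x -> smeas x mu -> measurable D ->
  fine (mu (D `&` Z)) = fine (mu D).
Proof.
move=> hx hm mD; have n0 := smeas_concentrated hx hm; congr fine.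
have mC : measurable (D `&` (setT `\` Z)).
  by apply: measurableI => //; exact: measurableD.
have -> : mu D = (mu (D `&` Z) + mu (D `&` ~` Z))%E.
  rewrite -[in LHS](setIT D) -(setUv Z) setIUr; apply: measureU.
  - exact: measurableI.
  - by rewrite setTD in mC.
  - by rewrite setIACA setICr setI0.
have -> : mu (D `&` ~` Z) = 0%E; last by rewrite adde0.
apply/eqP; rewrite eq_le measure_ge0 andbT -n0 setTD.
by apply: measureIr => //; exact: measurableC.
Qed.

Lemma smeas_Z_total x mu : l2 x -> smeas x mu -> fine (mu Z) = l2sq x.
Proof.
move=> hx hr; rewrite -(smeas_total hx hr) -(smeas_Z hx hr measurableT).
by rewrite setTI.
Qed.

Definition quad_integral f (B : (nat -> R[i]) -> nat -> R[i]) := bounded_op B /\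
  forall x mu, l2 x -> smeas x mu -> inner (B x) x = ((\int[mu]_(s in Z) f s)%R)%:C.

Lemma op_integral_quad_integral f B : bddon Z f ->
  is_op_integral E (fun s => (f s)%:C) B -> quad_integral f B.
Proof.
move=> bf [bB h]; split => // x mu hx hm.
have [m [hm' _ _ ->]] := h x hx.
have rm : smeas x m by [].
rewrite /cintegral; apply: eqC => /=; last by rewrite Rintegral_cst// mul0r.
have [_ ->] := Int_setT mZ measurableT (@subsetT _ Z) (smeas_concentrated hx rm) bf.
rewrite /Rintegral; congr fine; apply: eq_measure_integral => D mD _.
exact: smeas_eq rm hm mD.
Qed.

Lemma quad_integral_ext f B B' x : quad_integral f B -> quad_integral f B' -> l2 x -> B x = B' x.
Proof.
move=> [bB h] [bB' h']; apply: polar_ext => // y hy.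
have [mu hm] := pvm_measure_exists hE hy.
by rewrite (h y mu)// (h' y mu).
Qed.

(** The spectral measure of u + c v, where u = E D x and v = x - u, does not
depend on the phase c, since E D' u and v are orthogonal. *)
Lemma smeas_phase x mu D c d : l2 x -> smeas x mu -> measurable D ->
  c * c^*%C = 1 -> d * d^*%C = 1 ->
  smeas (fun n => c * (x n - E D x n) + d * E D x n) mu.
Proof.
move=> hx hm mD c1 d1 D' mD'; rewrite -hm//.
have hu := lE mD hx; have hv := l2B hx hu; have bD' := pvm_bounded hE mD'.
set u := E D x in hu hv *; set v := fun n => x n - u n in hv *.
have hdu := l2Z d hu.
have [hEu hEv] := (lE mD' hu, lE mD' hv).
have xE : x = fun n => 1 * v n + u n by apply/funext => n; rewrite mul1r subrK.
have [_ adjD] := pvm_selfadjoint hE mD; have [_ adjD'] := pvm_selfadjoint hE mD'.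
have Duv : inner (E D' u) v = 0.
  have vE : v = fun n => (-1) * u n + x n.
    by apply/funext => n; rewrite mulN1r addrC.
  have J1 : (-1 : R[i])^*%C = -1 by apply: eqC => /=; rewrite ?oppr0.
  have h1 : inner (E D' u) u = inner (E (D' `&` D) x) x by exact: pvm_inner.
  have h2 : inner (E D' u) x = inner (E (D' `&` D) x) x.
    by rewrite (pvm_setI hE mD' mD hx).
  by rewrite vE inner_linr// J1 mulN1r h1 h2 addNr.
have Dvu : inner (E D' v) u = 0 by rewrite adjD'// (innerC hEu hv) Duv conjc0.
have Q a b : inner (E D' (fun n => a * v n + b * u n)) (fun n => a * v n + b * u n) =
    a * a^*%C * inner (E D' v) v + b * b^*%C * inner (E D' u) u.
  have hbu := l2Z b hu.
  have Eb : E D' (fun n => b * u n) = fun n => b * E D' u n.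
    have := bop_linear bD' b hu (@l2_0 R).
    have -> : (fun n => b * u n + 0) = (fun n => b * u n).
      by apply/funext => n; rewrite addr0.
    move=> ->; have := bop_linear bD' (-1) (@l2_0 R) (@l2_0 R).
    have -> : (fun n : nat => -1 * 0 + 0 : R[i]) = (fun=> 0).
      by apply/funext => n; rewrite mulr0 addr0.
    move=> ->; apply/funext => n; by rewrite mulN1r addNr addr0.
  have hbE := l2Z b hEu.
  rewrite (bop_linear bD')// Eb inner_lin//; last exact: l2_lin.
  rewrite !inner_linr// !(innerZl b)// !(innerZr b)// Duv Dvu.
  by rewrite !mulr0 add0r addr0; ring.
rewrite Q c1 d1 [in RHS]xE.
have := Q 1 1; rewrite conjc1 mulr1 => <-.
have -> // : (fun n => 1 * v n + 1 * u n) = (fun n => 1 * v n + u n).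
by apply/funext => n; rewrite [1 * u n]mul1r.
Qed.

(** By polarization, because the quadratic form of B does not see the relative
phase of E D x and x - E D x. *)
Lemma quad_integral_cross f B x D : quad_integral f B -> measurable D -> l2 x ->
  inner (B (fun n => x n - E D x n)) (E D x) = 0.
Proof.
move=> [bB h] mD hx; have [mu hm] := pvm_measure_exists hE hx.
have hu := lE mD hx; have hv := l2B hx hu.
have n4 : (4 : R[i]) != 0 by rewrite pnatr_eq0.
apply: (mulfI n4); rewrite mulr0 polarization//.
have H c : c * c^*%C = 1 ->
    inner (B (fun n => c * E D x n + (x n - E D x n)))
          (fun n => c * E D x n + (x n - E D x n)) =
    ((\int[mu]_(s in Z) f s)%R)%:C.
  move=> c1; have := @smeas_phase x mu D 1 c hx hm mD.
  rewrite conjc1 mulr1 => /(_ erefl c1) hr.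
  have e : (fun n => c * E D x n + (x n - E D x n)) =
      (fun n => 1 * (x n - E D x n) + c * E D x n).
    by apply/funext => n; rewrite mul1r addrC.
  by rewrite e; apply: h => //; apply: l2D; exact: l2Z.
have J1 : (-1 : R[i])^*%C = -1 by apply: eqC => /=; rewrite ?oppr0.
have Ji : ('i%C : R[i])^*%C = - 'i%C by apply: eqC => /=; rewrite ?oppr0.
have JNi : (- 'i%C : R[i])^*%C = 'i%C by apply: eqC => /=; rewrite ?oppr0 ?opprK.
have i2 : 'i%C * 'i%C = -1 :> R[i] by rewrite -expr2 sqr_i.
rewrite !H ?conjc1 ?mulr1 ?J1 ?Ji ?JNi ?mulrN ?mulNr ?mulr1 ?opprK ?i2 ?opprK//.
by rewrite subrr add0r subrr.
Qed.

(** By the previous lemma <B x, E D x> is <B u, u> for u = E D x, whose spectral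
measure is the restriction to D of that of x. *)
Lemma quad_integral_inner f B x D mu : quad_integral f B -> bddon Z f -> measurable D -> l2 x ->
  smeas x mu -> inner (B x) (E D x) = ((\int[mu]_(s in Z) (f s * \1_D s))%R)%:C.
Proof.
move=> hB bf mD hx hm; have [bB h] := hB.
have hu := lE mD hx; have hv := l2B hx hu.
have [m hm'] := pvm_measure_exists hE hu.
have Bx : B x = fun n => 1 * B (fun n => x n - E D x n) n + B (E D x) n.
  rewrite -(bop_linear bB)//; congr B; apply/funext => n.
  by rewrite mul1r subrK.
rewrite Bx inner_lin//; try exact: (bop_l2 bB).
rewrite (quad_integral_cross hB)// mulr0 add0r (h _ m)//; congr (_%:C).
have b1 := bddon_indic Z mD; have bf1 := bddonM bf b1.
apply: (@eq_le_eps _ _ _ (l2sq (E D x) + l2sq x)) => e e0.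
have [N [c [Ds [mDs hs]]]] := step_approx bf e0.
have h1 := Int_step m mZ bf mDs hs.
have mDI i : measurable (Ds i `&` D) by exact: measurableI.
have hs' s : Z s -> `|f s * \1_D s - \sum_(i < N) c i * \1_(Ds i `&` D) s| <= e.
  move=> Zs; have -> : \sum_(i < N) c i * \1_(Ds i `&` D) s =
      (\sum_(i < N) c i * \1_(Ds i) s) * \1_D s :> R.
    by rewrite mulr_suml; apply: eq_bigr => i _; rewrite indicI/= mulrA.
  rewrite -mulrBl normrM indicE; case: (s \in D).
    by rewrite normr1 mulr1; exact: hs.
  by rewrite normr0 mulr0 ltW.
have h2 := Int_step mu mZ bf1 mDI hs'.
rewrite (smeas_Z_total hu hm') in h1; rewrite (smeas_Z_total hx hm) in h2.
have E2 : \sum_(i < N) c i * fine (m (Ds i `&` Z)) =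
    \sum_(i < N) c i * fine (mu (Ds i `&` D `&` Z)).
  apply: eq_bigr => i _; congr (_ * _).
  rewrite (smeas_Z hu hm' (mDs i)) (smeas_Z hx hm (mDI i)).
  exact: (smeas_restrict mD (mDs i) hx hm hm').
rewrite E2 in h1.
set X := \sum_(i < N) _ in h1 h2.
have := ler_distD X (\int[m]_(s in Z) f s)%R (\int[mu]_(s in Z) (f s * \1_D s))%R.
move=> /le_trans; apply; rewrite [`|X - _|]distrC mulrDl.
by rewrite ![_ * e]mulrC lerD.
Qed.

Lemma quad_integral_A : quad_integral (fun s => s) A.
Proof. by apply: op_integral_quad_integral => //; exact: bddon_id. Qed.

(** A is within e of a step operator, in the quadratic form and therefore, by
polarization, in the sesquilinear form. *)
Lemma A_step e N (c : nat -> R) (Ds : nat -> set borelR) y z : 0 < e ->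
  (forall i, measurable (Ds i)) ->
  (forall s, Z s -> `|s - \sum_(i < N) c i * \1_(Ds i) s| <= e) ->
  l2 y -> l2 z ->
  let d := inner (A y) z - \sum_(i < N) (c i)%:C * inner (E (Ds i) y) z in
  `|complex.Re d| <= (l2sq y + l2sq z) * e /\ `|complex.Im d| <= (l2sq y + l2sq z) * e.
Proof.
move=> e0 mDs hs hy hz d; have bA := proj1 hA.
pose q a := inner (A (fun n => a * z n + y n)) (fun n => a * z n + y n) -
  \sum_(i < N) (c i)%:C *
    inner (E (Ds i) (fun n => a * z n + y n)) (fun n => a * z n + y n).
have dq : 4 * d = q 1 - q (-1) + 'i%C * q 'i%C - 'i%C * q (- 'i%C).
  rewrite /d /q mulrBr polarization// mulr_sumr.
  have -> : \sum_(i < N) 4 * ((c i)%:C * inner (E (Ds i) y) z) =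
    \sum_(i < N) (c i)%:C * (4 * inner (E (Ds i) y) z).
    by apply: eq_bigr => i _; ring.
  under eq_bigr do rewrite (polarization (pvm_bounded hE (mDs _)) hy hz).
  have gen (k u v w t : nat -> R[i]) :
    \sum_(i < N) k i * (u i - v i + 'i%C * w i - 'i%C * t i) =
    \sum_(i < N) k i * u i - \sum_(i < N) k i * v i +
    'i%C * (\sum_(i < N) k i * w i) - 'i%C * \sum_(i < N) k i * t i.
    elim: (N) => [|n IH]; first by rewrite !big_ord0; ring.
    by rewrite !big_ord_recr/= IH; ring.
  pose Q a i := inner (E (Ds i) (fun n => a * z n + y n)) (fun n => a * z n + y n).
  rewrite (gen (fun i => (c i)%:C) (Q 1) (Q (-1)) (Q 'i%C) (Q (- 'i%C))).
  by rewrite /Q; ring.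
have qr a : sqn a = 1 -> exists2 r : R, q a = r%:C & `|r| <= (2 * l2sq y + 2 * l2sq z) * e.
  move=> a1; have hw := l2_lin a hz hy.
  have [mu hm] := pvm_measure_exists hE hw.
  exists ((\int[mu]_(s in Z) s)%R - \sum_(i < N) c i * fine (mu (Ds i `&` Z))).
    rewrite /q (proj2 quad_integral_A _ mu)// realCB realC_sum; congr (_ - _).
    by apply: eq_bigr => i _; rewrite (smeas_Z hw hm (mDs i)) realCM -hm.
  have h1 := Int_step mu mZ (bddon_id M) mDs hs.
  apply: le_trans h1 _; rewrite mulrC; apply: ler_wpM2r; first exact: ltW.
  rewrite (smeas_Z_total hw hm).
  have := proj2 (l2D_l2sq (l2Z a hz) hy); rewrite l2sqZ// a1 mul1r.
  by move=> /le_trans; apply; rewrite addrC.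
have s1 : sqn (1 : R[i]) = 1 by rewrite /sqn /=; ring.
have sN1 : sqn (-1 : R[i]) = 1 by rewrite sqnN.
have si : sqn ('i%C : R[i]) = 1 by rewrite /sqn /=; ring.
have sNi : sqn (- 'i%C : R[i]) = 1 by rewrite sqnN.
have [r1 E1 L1] := qr _ s1; have [r2 E2 L2] := qr _ sN1.
have [r3 E3 L3] := qr _ si; have [r4 E4 L4] := qr _ sNi.
rewrite E1 E2 E3 E4 in dq.
have dR : 4 * complex.Re d = r1 - r2.
  have := congr1 (@complex.Re R) dq; rewrite !ReImE /= => h; lra.
have dI : 4 * complex.Im d = r3 - r4.
  have := congr1 (@complex.Im R) dq; rewrite !ReImE /= => h; lra.
rewrite !ler_norml in L1 L2 L3 L4 *.
move: L1 L2 L3 L4 => /andP[? ?] /andP[? ?] /andP[? ?] /andP[? ?].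
by split; apply/andP; split; lra.
Qed.

(** A is a limit of sums of c_i E (D_i), and <E (D_i) B x, x> = <B x, E (D_i) x>
is the integral of f over D_i. *)
Lemma quad_integral_mulA f B : quad_integral f B -> bddon Z f ->
  quad_integral (fun s => s * f s) (fun x => A (B x)).
Proof.
move=> hB bf; have [bB h] := hB; have bA := proj1 hA.
split=> [|x mu hx hm]; first exact: bop_comp.
have hBx := bop_l2 bB hx; have bid := bddon_id M.
have [_ [C hC]] := bf.
suff H e : 0 < e -> exists t : R,
    `|complex.Re (inner (A (B x)) x) - t| <= (l2sq (B x) + l2sq x) * e /\
    `|complex.Im (inner (A (B x)) x)| <= (l2sq (B x) + l2sq x) * e /\
    `|(\int[mu]_(s in Z) (s * f s))%R - t| <= (`|C| * fine (mu Z)) * e.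
  apply: eqC => /=.
    apply: (@eq_le_eps _ _ _ (l2sq (B x) + l2sq x + `|C| * fine (mu Z))) => e e0.
    have [t [h1 [_ h2]]] := H e e0.
    apply: le_trans (ler_distD t _ _) _; rewrite [`|t - _|]distrC mulrDl.
    exact: lerD.
  apply: (@eq_le_eps _ _ _ (l2sq (B x) + l2sq x)) => e e0.
  by have [t [_ [h1 _]]] := H e e0; rewrite subr0.
move=> e0; have [N [c [Ds [mDs hs]]]] := step_approx bid e0.
have [hr hi] := A_step e0 mDs hs hBx hx.
have b1 i : bddon Z (fun s => c i * (f s * \1_(Ds i) s)).
  by apply: bddonZ; apply: bddonM => //; exact: bddon_indic.
have E1 i : inner (E (Ds i) (B x)) x =
    ((\int[mu]_(s in Z) (f s * \1_(Ds i) s))%R)%:C.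
  have [_ adj] := pvm_selfadjoint hE (mDs i).
  by rewrite adj// (quad_integral_inner hB bf (mDs i) hx hm).
pose t := (\int[mu]_(s in Z) (\sum_(i < N) c i * (f s * \1_(Ds i) s)))%R.
have E2 : \sum_(i < N) (c i)%:C * inner (E (Ds i) (B x)) x = t%:C.
  rewrite /t (Int_sum mu mZ N b1) realC_sum; apply: eq_bigr => i _.
  rewrite E1 IntZ ?realCM//; apply: bddonM => //; exact: bddon_indic.
rewrite E2 !ReImE /= oppr0 addr0 in hr hi.
exists t; split => //; split => //.
have bt : bddon Z (fun s => \sum_(i < N) c i * (f s * \1_(Ds i) s)).
  exact: (bddon_sum N b1).
have bsf := bddonM bid bf.
rewrite /t -IntB// mulrAC; apply: Int_bound => //; first exact: bddonB.
move=> s Zs.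
have -> : s * f s - \sum_(i < N) c i * (f s * \1_(Ds i) s) =
    f s * (s - \sum_(i < N) c i * \1_(Ds i) s).
  by rewrite mulrBr mulr_sumr mulrC; congr (_ - _); apply: eq_bigr => i _; ring.
rewrite normrM; apply: ler_pM => //; last exact: hs.
exact: le_trans (hC s Zs) (ler_norm _).
Qed.

Lemma quad_integral_pow n : quad_integral (fun s => s ^+ n) (iter n A).
Proof.
elim: n => [|n IH].
  split=> [|x mu hx hm]; first exact: bop_id.
  rewrite /= (inner_self hx); congr (_%:C).
  rewrite (_ : (fun s : R => s ^+ 0) = fun=> 1)// Int_cst// mul1r.
  by rewrite (smeas_Z_total hx hm).
have := quad_integral_mulA IH (bddonX n (bddon_id M)).
congr quad_integral; first by apply/funext => s; rewrite exprS.
Qed.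

End SpectralResolution.


(** * Recovery of the matrix from the moments *)

Lemma continuous_realC (R : realType) (f : R -> R) : continuous f ->
  continuous (fun s => ((f s)%:C : (R[i])^o)).
Proof.
move=> cf s; apply/cvgrPdist_lt => e; rewrite ltcE /= => /andP[/eqP ie re].
have /cvgrPdist_lt/(_ _ re) := cf s; apply: filterS => t h.
rewrite -realCB normc_def /= expr0n addr0 sqrtr_sqr ltcE /= ie eqxx.
exact: h.
Qed.

Section Moments.
Variable R : realType.
Local Notation borelR := (measurableTypeR R).
Variables (a : nat -> R) (b : nat -> R[i]) (nu : probability borelR R).
Variables (A : (nat -> R[i]) -> nat -> R[i]).
Hypothesis hA : positive_op A.
Hypothesis hnu : forall D : set borelR, measurable D ->
  exists B, is_fun_of_op A (fun s => (\1_D s)%:C) B /\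
    (fine (nu D))%:C = inner (B (delta R 0)) (delta R 0).
Local Notation d0 := (delta R 0).
Let ld0 : l2 d0 := l2_delta 0.

Lemma quad_le : exists M : R, forall x, l2 x ->
  complex.Re (inner (A x) x) <= M * l2sq x.
Proof.
have [K K0 hK] := bop_l2sq (proj1 hA); exists ((K + 1) / 2) => x hx.
apply: le_trans (ler_norm _) _.
apply: le_trans (Re_inner_le (bop_l2 (proj1 hA) hx) hx) _.
by have := hK x hx; lra.
Qed.

Lemma bounded_smeas_moments M E (mu : {finite_measure set borelR -> \bar R}) n :
  (forall x, l2 x -> complex.Re (inner (A x) x) <= M * l2sq x) ->
  is_pvm E -> is_op_integral E (fun s => s%:C) A -> smeas E d0 mu ->
  inner (iter n A d0) d0 = ((\int[mu]_(s in `[0, M]) s ^+ n)%R)%:C.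
Proof.
move=> A_le hE hEA hm; have [_ h] := quad_integral_pow hE hA hEA A_le n.
exact: h ld0 hm.
Qed.

Lemma even_integral M E E' (mu mu' : {finite_measure set borelR -> \bar R}) p :
  (forall x, l2 x -> complex.Re (inner (A x) x) <= M * l2sq x) ->
  is_pvm E -> is_op_integral E (fun s => s%:C) A -> smeas E d0 mu ->
  is_pvm E' -> is_op_integral E' (fun s => s%:C) A -> smeas E' d0 mu' ->
  (\int[mu]_(s in `[0, M]) p.[s ^+ 2])%R = (\int[mu']_(s in `[0, M]) p.[s ^+ 2])%R.
Proof.
move=> A_le hE hEA hm hE' hEA' hm'; have mZ := measurable_0M M.
have H (m : {finite_measure set borelR -> \bar R}) :
    (\int[m]_(s in `[0, M]) p.[s ^+ 2])%R =
    \sum_(i < size p) p`_i * (\int[m]_(s in `[0, M]) s ^+ (2 * i))%R.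
  have bi i : bddon `[0, M] (fun s => p`_i * s ^+ (2 * i)).
    by apply: bddonZ; apply: bddonX; exact: bddon_id.
  rewrite (_ : (fun s => _) = (fun s => \sum_(i < size p) p`_i * s ^+ (2 * i))).
    rewrite (Int_sum m mZ _ bi); apply: eq_bigr => i _.
    by rewrite IntZ//; apply: bddonX; exact: bddon_id.
  by apply/funext => s; rewrite horner_coef; apply: eq_bigr => i _; rewrite exprM.
rewrite !H; apply: eq_bigr => i _; congr (_ * _); apply: (@complexI R).
rewrite -(bounded_smeas_moments _ A_le hE hEA hm).
by rewrite -(bounded_smeas_moments _ A_le hE' hEA' hm').
Qed.

(** Half-lines are limits of polynomials in s ^+ 2, so that nu is the spectral
measure of d0 for every resolution of A. *)
Lemma nu_smeas E (mu : {finite_measure set borelR -> \bar R}) D :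
  is_pvm E -> is_op_integral E (fun s => s%:C) A -> smeas E d0 mu ->
  measurable D -> nu D = mu D.
Proof.
move=> hE hEA hm; have [M A_le] := quad_le; have mZ := measurable_0M M.
have H t : nu (`]-oo, t[%classic : set borelR) = mu (`]-oo, t[%classic : set borelR).
  set L : set borelR := `]-oo, t[%classic.
  have mL : measurable L by exact: measurable_itv.
  have bL := bddon_indic `[0, M] mL.
  have [B [[E' [hE' hEA' hB]] nuB]] := hnu mL.
  have [mu' hm'] := pvm_measure_exists hE' ld0.
  have [_ hB'] := op_integral_quad_integral hE' hA hEA' A_le bL hB.
  suff e : (\int[mu']_(s in `[0, M]) \1_L s)%R = (\int[mu]_(s in `[0, M]) \1_L s)%R.
    have : fine (nu L) = fine (mu L).
      apply: (@complexI R); rewrite nuB (hB' _ _ ld0 hm') e Int_indic//.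
      by rewrite (smeas_Z hE hA hEA A_le ld0 hm mL).
    move=> h; rewrite -[LHS]fineK ?fin_num_measure//.
    by rewrite -[RHS]fineK ?fin_num_measure// h.
  have [t0|t0] := ltP 0 t; last first.
    have z (m : {finite_measure set borelR -> \bar R}) :
        (\int[m]_(s in `[0, M]) \1_L s)%R = 0.
      rewrite (@Int_eq _ _ m _ (fun=> 0)) ?Int_cst ?mul0r//.
      move=> s; rewrite /= in_itv/= => /andP[s0 _]; rewrite indicE memNset// /L/= in_itv/=.
      by apply/negP; rewrite -leNgt; apply: le_trans t0 s0.
    by rewrite !z.
  have [p_ hb hc] := thr_poly_halfline M t0.
  have cv (m : {finite_measure set borelR -> \bar R}) :
      (fun n => (\int[m]_(s in `[0, M]) (p_ n).[s ^+ 2])%R) @ \oo -->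
      ((\int[m]_(s in `[0, M]) \1_L s)%R : R).
    apply: (@Int_cvg _ _ m mZ (fun n s => (p_ n).[s ^+ 2]) (\1_L) 1) => //.
    by move=> n; exact: (proj1 (bddon_evenpoly M (p_ n))).
  have c1 := cv mu'; have c2 := cv mu.
  rewrite -(cvg_lim (@Rhausdorff R) c1) -(cvg_lim (@Rhausdorff R) c2).
  congr (lim (_ @ \oo)); apply/funext => n.
  exact: (even_integral _ A_le hE' hEA' hm' hE hEA hm).
move=> mD; apply: (@measure_unique _ R borelR (@RGenInftyO.G R)
   (fun n => `]-oo, n%:R[%classic) _ _ _ _ nu mu _ _ D mD).
- exact: RGenInftyO.measurableE.
- move=> _ _ [u ->] [v ->]; exists (Num.min u v).
  apply/seteqP; split => s; rewrite /= !in_itv/= lt_min; last by move/andP.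
  by move=> [-> ->].
- by move=> n; exists n%:R.
- apply/seteqP; split => // s _; exists (Num.bound `|s|) => //=.
  by rewrite in_itv/= (le_lt_trans (ler_norm _))// archi_boundP.
- by move=> _ [t ->]; exact: H.
- by move=> k; rewrite ltey_eq fin_num_measure//; exact: measurable_itv.
Qed.

Lemma even_moments n : (exists f B, is_fun_of_op A f B) ->
  inner (iter n A d0) d0 = ((\int[nu]_(s in setT) s ^+ n)%R)%:C.
Proof.
move=> [_ [_ [E [hE hEA _]]]]; have [mu hm] := pvm_measure_exists hE ld0.
have [M A_le] := quad_le; rewrite (bounded_smeas_moments _ A_le hE hEA hm).
have bX : bddon `[0, M] (fun s => s ^+ n) by apply: bddonX; exact: bddon_id.
have [_ <-] := Int_setT (measurable_0M M) measurableT (@subsetT _ _)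
   (smeas_concentrated hE hA hEA A_le ld0 hm) bX.
congr (_%:C); rewrite /Rintegral; congr fine; apply: eq_measure_integral => D mD _.
by apply/esym; exact: nu_smeas hE hEA hm mD.
Qed.

(** Whatever resolution defines the function s ^+ n of A, it sends delta_0 to
A^n delta_0. *)
Lemma fun_pow n B : is_fun_of_op A (fun s => (s ^+ n)%:C) B ->
  B d0 = iter n A d0.
Proof.
move=> [E [hE hEA hB]]; have [M A_le] := quad_le.
have bX : bddon `[0, M] (fun s => s ^+ n) by apply: bddonX; exact: bddon_id.
exact: (quad_integral_ext hE (op_integral_quad_integral hE hA hEA A_le bX hB) (quad_integral_pow hE hA hEA A_le n) ld0).
Qed.

End Moments.

Section AntilinearPowers.
Variable R : realType.
Variables (a : nat -> R) (b : nat -> R[i]).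
Hypothesis a_gt0 : forall j, 0 < a j.
Hypothesis hb : bounded_jacobi a b.
Local Notation J := (jacobi_op a b).
Local Notation S := (jacobi_op a (conjs b)).
Implicit Types x y : nat -> R[i].

(** T = C J, where C is complex conjugation: T is antilinear and symmetric, and
T^2 = J^* J because J is a symmetric matrix. *)
Definition Tseq x : nat -> R[i] := fun j => (J x j)^*%C.
Definition Tpow k := iter k Tseq (delta R 0).

Lemma jacobi_op_conj x : S (fun j => (x j)^*%C) = Tseq x.
Proof.
apply/funext => j; rewrite /Tseq !jacobi_opE !(conjcD, conjcM) !conjc_real.
by case: j => [|j]; rewrite ?conjc0 ?conjcM ?conjc_real.
Qed.

Lemma Tseq_sqr x : Tseq (Tseq x) = S (J x).
Proof.
rewrite -[J x in RHS](_ : (fun j => (Tseq x j)^*%C) = _); last first.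
  by apply/funext => j; rewrite /Tseq conjcK.
by rewrite jacobi_op_conj.
Qed.

Lemma l2_Tseq x : l2 x -> l2 (Tseq x).
Proof. by move=> hx; apply: l2_conj; exact: (bop_l2 (bop_jacobi hb)). Qed.

Lemma l2_Tpow k : l2 (Tpow k).
Proof. by elim: k => [|k IH]; [exact: l2_delta|exact: l2_Tseq]. Qed.

Lemma inner_conj x y : l2 x -> l2 y ->
  inner (fun j => (x j)^*%C) (fun j => (y j)^*%C) = (inner x y)^*%C.
Proof.
move=> hx hy; rewrite -innerC//; apply: inner_eq; [exact: l2_conj..|].
apply: cvg_trans (inner_cvg hy hx); apply: near_eq_cvg; apply: nearW => n.
by apply: eq_bigr => i _; rewrite conjcK mulrC.
Qed.

Lemma Tseq_sym x y : l2 x -> l2 y -> inner (Tseq x) y = inner (Tseq y) x.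
Proof.
move=> hx hy; have hxc := l2_conj hx.
have [_ adj] := adjoint_jacobi (bounded_conjs hb).
have bb : conjs (conjs b) = b by apply/funext => j; rewrite /conjs conjcK.
rewrite bb in adj; rewrite -jacobi_op_conj adj//.
have -> : J y = fun j => (Tseq y j)^*%C by apply/funext => j; rewrite /Tseq conjcK.
have hTy := l2_Tseq hy; by rewrite inner_conj// -innerC.
Qed.

Lemma Tpow_supp k j : (k < j)%N -> Tpow k j = 0.
Proof.
elim: k j => [|k IH] j kj; first by rewrite /Tpow /= /delta gtn_eqF.
rewrite /Tpow iterS -/(Tpow k) /Tseq jacobi_opE.
case: j kj => // j kj; rewrite (IH j)// (IH j.+1) ?(IH j.+2) ?mulr0 ?addr0 ?conjc0//.
- by rewrite ltnW// ltnW.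
- by rewrite ltnW.
Qed.

Lemma Tpow_diagS k : Tpow k.+1 k.+1 = (a k)%:C * (Tpow k k)^*%C.
Proof.
rewrite {1}/Tpow iterS -/(Tpow k) /Tseq jacobi_opE.
by rewrite (@Tpow_supp k k.+1)// (@Tpow_supp k k.+2)// !mulr0 !addr0 conjcM conjc_real.
Qed.

Lemma Tpow_diag k : exists2 r : R, 0 < r & Tpow k k = r%:C.
Proof.
elim: k => [|k [r r0 E]]; first by exists 1 => //; rewrite /Tpow /= /delta eqxx.
by exists (a k * r); rewrite ?mulr_gt0// Tpow_diagS E conjc_real realCM.
Qed.

Lemma Tpow_subdiag k : Tpow k.+1 k =
  ((if k is k'.+1 then (a k')%:C * Tpow k k' else 0) + b k * Tpow k k)^*%C.
Proof.
rewrite {1}/Tpow iterS -/(Tpow k) /Tseq jacobi_opE.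
by rewrite (Tpow_supp (ltnSn k)) mulr0 addr0.
Qed.

Lemma inner_Tpow k l : inner (Tpow k) (Tpow l) =
  \sum_(j < l.+1) Tpow k j * (Tpow l j)^*%C.
Proof.
apply: inner_eq; [exact: l2_Tpow..|].
apply: cvg_near_cst; exists l.+1 => // n /= ln.
rewrite -(subnK ln) addnC big_split_ord /= [X in _ + X]big1 ?addr0// => i _.
by rewrite [Tpow l _]Tpow_supp ?conjc0 ?mulr0// ltn_addr.
Qed.

Lemma gram_step k l : inner (Tpow k) (Tpow l.+1) =
  (inner (Tpow k.+1) (Tpow l))^*%C.
Proof.
have hk := @l2_Tpow k; have hl := @l2_Tpow l.
rewrite -[Tpow l.+1]/(Tseq (Tpow l)) -[Tpow k.+1]/(Tseq (Tpow k)).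
by rewrite (innerC (l2_Tseq hl) hk) Tseq_sym.
Qed.

End AntilinearPowers.
Arguments Tpow {R} a b k : simpl never.

Section Recovery.
Variable R : realType.
Variables (a a' : nat -> R) (b b' : nat -> R[i]).
Hypotheses (a_gt0 : forall j, 0 < a j) (a_gt0' : forall j, 0 < a' j).
Hypotheses (hb : bounded_jacobi a b) (hb' : bounded_jacobi a' b').
Local Notation t := (Tpow a b).
Local Notation t' := (Tpow a' b').
Hypothesis mom : forall k, inner (t k) (delta R 0) = inner (t' k) (delta R 0).

(** Symmetry of T moves all powers to one side: the Gram matrix has the entries
<T^m delta_0, delta_0>, up to conjugation. *)
Lemma gram_eq k l : inner (t k) (t l) = inner (t' k) (t' l).
Proof.
elim: l k => [|l IH] k; first exact: mom.
by rewrite (gram_step hb) (gram_step hb') IH.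
Qed.

(** The vectors T^k delta_0 are the rows of a triangular matrix with positive
diagonal, which is the Cholesky factor of the Gram matrix and hence determined
by it. *)
Lemma Tpow_eq k : t k = t' k.
Proof.
suff H n : forall i, (i <= n)%N -> t i = t' i by exact: (H k).
elim: n => [|n IH] i; first by rewrite leqn0 => /eqP ->.
rewrite leq_eqVlt => /predU1P[->|]; last exact: IH.
have below j : (j <= n)%N -> t n.+1 j = t' n.+1 j.
  suff : forall m j, (j <= m)%N -> (j <= n)%N -> t n.+1 j = t' n.+1 j.
    by move=> h jn; exact: (h j).
  elim=> [|m IHm] {}j jm jn.
    move: jm; rewrite leqn0 => /eqP ->.
    have h := mom n.+1; rewrite (inner_delta 0 (@l2_Tpow _ a b hb n.+1)) in h.
    by rewrite (inner_delta 0 (@l2_Tpow _ a' b' hb' n.+1)) in h.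
  move: jm; rewrite leq_eqVlt => /predU1P[jE|]; last by move=> h; apply: IHm.
  have := gram_eq n.+1 j; rewrite !inner_Tpow// !big_ord_recr /= -(IH j)//.
  have -> : \sum_(i < j) t n.+1 i * (t j i)^*%C =
      \sum_(i < j) t' n.+1 i * (t j i)^*%C.
    apply: eq_bigr => -[l lj] _ /=; rewrite IHm//; first by rewrite -ltnS -jE.
    exact: ltnW (leq_trans lj jn).
  move=> /addrI; have [r r0 ->] := Tpow_diag b a_gt0 j.
  apply: mulIf; rewrite conjc_real eq_complex /= negb_and gt_eqF//.
apply/funext => j; have [jn|nj|->] := ltngtP j n.+1.
- exact: below.
- by rewrite !Tpow_supp.
have := gram_eq n.+1 n.+1; rewrite !inner_Tpow//.
rewrite big_ord_recr [X in _ = X -> _]big_ord_recr /=.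
have -> : \sum_(i < n.+1) t n.+1 i * (t n.+1 i)^*%C =
    \sum_(i < n.+1) t' n.+1 i * (t' n.+1 i)^*%C.
  by apply: eq_bigr => -[l ln] _ /=; rewrite below.
move=> /addrI; have [r r0 ->] := Tpow_diag b a_gt0 n.+1.
have [r' r0' ->] := Tpow_diag b' a_gt0' n.+1.
rewrite !conjc_real -!realCM => /(@complexI R) /eqP.
rewrite -!expr2 eqrXn2 ?ltW// => /eqP -> //.
Qed.

(** The entries a_k and b_k are read off from the diagonal and the subdiagonal
of the triangular matrix of the vectors T^k delta_0. *)
Lemma jacobi_eq : jacobi a b = jacobi a' b'.
Proof.
have n0 k : t k k != 0.
  by have [r r0 ->] := Tpow_diag b a_gt0 k; rewrite eq_complex /= negb_and gt_eqF.
have n0' k : (t k k)^*%C != 0 by rewrite conjc_eq0.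
have aE : a = a'.
  apply/funext => k; apply: (@complexI R); apply: (mulIf (n0' k)).
  by rewrite -Tpow_diagS [in RHS]Tpow_eq -Tpow_diagS Tpow_eq.
have bE : b = b'.
  apply/funext => k; apply: (mulIf (n0 k)).
  have := Tpow_subdiag a b k; have := Tpow_subdiag a' b' k.
  case: k => [|k]; rewrite -!Tpow_eq -?aE => -> /(can_inj (@conjcK R)) /addrI.
    by [].
  by [].
by rewrite aE bE.
Qed.

End Recovery.

(** * Uniqueness and the theorem *)

Section SpectralDataMoments.
Variable R : realType.
Local Notation borelR := (measurableTypeR R).
Variables (a : nat -> R) (b : nat -> R[i]) (nu : probability borelR R).
Variable psi : R -> R[i].
Hypothesis hb : bounded_jacobi a b.
Hypothesis hdata : spectral_data a b nu psi.
Local Notation d0 := (delta R 0).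

Definition odd_moment (m : probability borelR R) (phi : R -> R[i]) n :=
  cintegral m `[0, +oo[%classic (fun s => s%:C * (s ^+ n)%:C * phi s).

(** T^(2n) delta_0 = |J|^(2n) delta_0, which gives the even moments of nu; one
more application of T = C J gives the conjugate of the integral that defines
psi, at f(s) = s^(2n). *)
Lemma Tpow_moments n :
  inner (Tpow a b n.*2) d0 = ((\int[nu]_(s in setT) s ^+ n.*2)%R)%:C /\
  inner (Tpow a b n.*2.+1) d0 = (odd_moment nu psi n.*2)^*%C.
Proof.
have [A [[hA [S [hS AA]]] hnu [_ _ _ hf]]] := hdata; have ld0 := @l2_delta R 0.
have bJ := bop_jacobi hb.
have lt k : l2 (Tpow a b k) by exact: l2_Tpow.
have tE k : Tpow a b k.*2 = iter k.*2 A d0.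
  elim: k => [//|k IH]; rewrite doubleS /= -IH AA//.
  rewrite -[LHS]/(Tseq a b (Tseq a b (Tpow a b k.*2))) Tseq_sqr.
  by rewrite (adjoint_unique bJ hS (adjoint_jacobi hb))//; exact: (bop_l2 bJ).
have cX k : continuous (fun s : R => ((s ^+ k)%:C : (R[i])^o)).
  by apply: continuous_realC => s; exact: exprn_continuous.
split.
  rewrite tE; apply: (even_moments hA hnu).
  by have [B [hB _]] := hf _ (cX 0%N); exists (fun s => (s ^+ 0)%:C), B.
have [B [hB hJB]] := hf _ (cX n.*2).
rewrite (inner_delta 0 (lt _)) -[LHS]/((jacobi_op a b (Tpow a b n.*2) 0)^*%C).
rewrite tE -(fun_pow hA hB); congr (_^*%C); apply: etrans hJB.
by rewrite inner_delta//; apply: (bop_l2 bJ); rewrite (fun_pow hA hB) -tE.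
Qed.

End SpectralDataMoments.

Lemma odd_moment_eq (R : realType) (nu nu' : probability (measurableTypeR R) R)
    (psi psi' : R -> R[i]) n :
  Linfty nu psi -> Linfty nu' psi' ->
  (forall D : set (measurableTypeR R), measurable D -> nu D = nu' D) ->
  {ae nu, forall s : R, psi s = psi' s} ->
  odd_moment nu psi n = odd_moment nu' psi' n.
Proof.
move=> /psi0_measurable[mr mi] /psi0_measurable[mr' mi'] nuE pE.
have mD : measurable (`[0, +oo[%classic : set (measurableTypeR R)).
  exact: measurable_itv.
have mx : measurable_fun setT ((fun s => s * s ^+ n) : measurableTypeR R -> measurableTypeR R).
  by apply: measurable_funM => //; exact: exprn_measurable.
have E (g : R[i] -> R) :
    measurable_fun setT ((fun s => g (s%:C * (s ^+ n)%:C * psi s))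
      : measurableTypeR R -> measurableTypeR R) ->
    measurable_fun setT ((fun s => g (s%:C * (s ^+ n)%:C * psi' s))
      : measurableTypeR R -> measurableTypeR R) ->
    (\int[nu]_(s in `[0, +oo[) g (s%:C * (s ^+ n)%:C * psi s))%R =
    (\int[nu']_(s in `[0, +oo[) g (s%:C * (s ^+ n)%:C * psi' s))%R.
  move=> mg mg'; rewrite /Rintegral; congr fine.
  rewrite -(@eq_measure_integral _ _ _ _ nu' nu); last by move=> D mDD _; exact: nuE.
  apply: ae_eq_integral => //.
  - by apply/measurable_EFinP; exact: measurable_funS mg.
  - by apply/measurable_EFinP; exact: measurable_funS mg'.
  have [N [mN N0 hN]] := pE; exists N; split => // s /= hs.
  by apply: hN => /= h; apply: hs; rewrite h.
apply: eqC; apply: E.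
- by under eq_fun do rewrite -realCM ReMr; exact: measurable_funM.
- by under eq_fun do rewrite -realCM ReMr; exact: measurable_funM.
- by under eq_fun do rewrite -realCM ImMr; exact: measurable_funM.
- by under eq_fun do rewrite -realCM ImMr; exact: measurable_funM.
Qed.

Lemma uniqueness (R : realType) (a a' : nat -> R) (b b' : nat -> R[i])
    (nu nu' : probability (measurableTypeR R) R) (psi psi' : R -> R[i]) :
  (forall j, 0 < a j) -> bounded_jacobi a b ->
  (forall j, 0 < a' j) -> bounded_jacobi a' b' ->
  spectral_data a b nu psi -> spectral_data a' b' nu' psi' ->
  (forall D : set (measurableTypeR R), measurable D -> nu D = nu' D) ->
  {ae nu, forall s : R, psi s = psi' s} ->
  jacobi a b = jacobi a' b'.
Proof.
move=> a0 hb a0' hb' hd hd' nuE pE; apply: jacobi_eq => // k.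
have [L L'] : Linfty nu psi /\ Linfty nu' psi'.
  by have [? [_ _ [? _ _ _]]] := hd; have [? [_ _ [? _ _ _]]] := hd'.
have [e o] := Tpow_moments hb hd k./2; have [e' o'] := Tpow_moments hb' hd' k./2.
rewrite -(odd_double_half k); case: (odd k) => /=.
  by rewrite add1n o o' (odd_moment_eq _ L L' nuE pE).
rewrite add0n e e'; congr (_%:C); rewrite /Rintegral; congr fine.
by apply: eq_measure_integral => D mD _; exact: nuE.
Qed.

Theorem theorem2p3 (R : realType) :
  (forall (a a' : nat -> R) (b b' : nat -> R[i])
     (nu nu' : probability (measurableTypeR R) R) (psi psi' : R -> R[i]),
     (forall j, 0 < a j) -> bounded_jacobi a b ->
     (forall j, 0 < a' j) -> bounded_jacobi a' b' ->
     spectral_data a b nu psi -> spectral_data a' b' nu' psi' ->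
     (forall D : set (measurableTypeR R), measurable D -> nu D = nu' D) ->
     {ae nu, forall s : R, psi s = psi' s} ->
     jacobi a b = jacobi a' b')
  /\
  (forall (nu : probability (measurableTypeR R) R) (psi : R -> R[i]),
     msupport nu `<=` `[0, +oo[ -> bounded_set (msupport nu) ->
     infinite_set (msupport nu) ->
     Linfty nu psi -> {ae nu, forall s : R, 0 <= s -> `|psi s| <= 1} ->
     psi 0 = 1 ->
     exists (a : nat -> R) (b : nat -> R[i]),
       [/\ forall j, 0 < a j, bounded_jacobi a b & spectral_data a b nu psi]).
Proof.
split; first exact: uniqueness.
move=> nu psi supp0 suppb suppinf psiL psi_ae psi0.
exact: (surjectivity supp0 suppb suppinf psiL psi_ae psi0).
Qed.
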